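(* Let $M^2$ be a space (2-dimensional Riemannian manifold) of constant Gaussian curvature $K$. Suppose that $\xi$ is a unit geodesic vector field on $M^2$. Then $\xi(M^2)$ has constant Gaussian curvature in one of the following cases: (a) $K=-c^2<0$ and $\xi$ is a normal vector field for the family of horocycles on the hyperbolic 2-plane $L^2$ of curvature $-c^2$. In this case $K_\xi=-c^2$, and therefore $\xi(L^2)$ is locally isometric to $L^2$; (b) $K=0$ and $\xi$ is a parallel vector field on $M^2$. In this case $K_\xi=0$, and $\xi(M^2)$ is also locally isometric to $M^2$; (c) $K=1$ and $\xi$ is any (local) geodesic vector field on the standard sphere $S^2$. In this case $K_\xi=0$.
   Context: For a Riemannian manifold $(M,g)$ with Levi-Civita connection $\nabla$, each tangent vector $\tilde X$ to $TM$ decomposes as $\tilde X=X_1^h+X_2^v$ with $X_1,X_2$ tangent to $M$ at the base point, where $(\cdot)^h$ and $(\cdot)^v$ are the horizontal and vertical lifts. The Sasaki metric on $TM$ is $\langle\langle \tilde X,\tilde Y\rangle\rangle=\langle X_1,Y_1\rangle+\langle X_2,Y_2\rangle$, where $\langle\cdot,\cdot\rangle$ is the scalar product of $g$. The unit tangent bundle $T_1M\subset TM$ carries the induced metric. A unit vector field $\xi$ on $M$ is viewed as a map $\xi:M\to T_1M$, and its image $\xi(M)$ is a submanifold of $T_1M$ with the metric induced from $T_1M$; for $M=M^2$, $K_\xi$ denotes the Gaussian curvature of $\xi(M^2)$ in this metric. A unit vector field $\xi$ is geodesic if $\nabla_\xi\xi=0$. *)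

(* Defs.v *)
(* Stdlib reals with Coquelicot. *)
From Stdlib Require Import Reals Lra Lia Psatz ZArith Arith Cantor ProofIrrelevance.
From Stdlib Require Import FunctionalExtensionality.
From Coquelicot Require Import Coquelicot.
Open Scope R_scope.

Inductive ix : Set := I1 | I2.

Definition ix_eqb (i j : ix) : bool :=
  match i, j with I1, I1 | I2, I2 => true | _, _ => false end.

Definition Sum (F : ix -> R) : R := F I1 + F I2.

Definition vec := ix -> R.

Definition coord (i : ix) (p : R * R) : R :=
  match i with I1 => fst p | I2 => snd p end.

Definition basis (i : ix) : vec := fun k => if ix_eqb i k then 1 else 0.

Definition slice (i : ix) (f : R * R -> R) (p : R * R) : R -> R :=
  match i with I1 => fun t => f (t, snd p) | I2 => fun t => f (fst p, t) end.

Definition ex_pd (i : ix) (f : R * R -> R) (p : R * R) : Prop :=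
  ex_derive (slice i f p) (coord i p).

Definition pd (i : ix) (f : R * R -> R) (p : R * R) : R :=
  Derive (slice i f p) (coord i p).

(* [Ck k U f] is the usual C^k condition when U is open. *)
Fixpoint Ck (k : nat) (U : R * R -> Prop) (f : R * R -> R) : Prop :=
  (forall p, U p -> continuous f p) /\
  match k with
  | O => True
  | S k' => forall i, (forall p, U p -> ex_pd i f p) /\ Ck k' U (pd i f)
  end.

Definition smooth (U : R * R -> Prop) (f : R * R -> R) : Prop :=
  forall k, Ck k U f.

Definition jac (f : R * R -> R * R) (x : R * R) (k i : ix) : R :=
  pd i (fun z => coord k (f z)) x.

Definition push (f : R * R -> R * R) (x : R * R) (v : vec) : vec :=
  fun k => Sum (fun i => jac f x k i * v i).

Definition pull (f : R * R -> R * R) (x : R * R) (T : ix -> ix -> R)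
  : ix -> ix -> R :=
  fun i j => Sum (fun k => Sum (fun l => T k l * jac f x k i * jac f x l j)).

Definition lmetric := R * R -> ix -> ix -> R.
Definition lfield := R * R -> vec.

Definition dot (h : lmetric) (x : R * R) (v w : vec) : R :=
  Sum (fun i => Sum (fun j => h x i j * v i * w j)).

Definition det (h : lmetric) (x : R * R) : R :=
  h x I1 I1 * h x I2 I2 - h x I1 I2 * h x I2 I1.

Definition inv (h : lmetric) (x : R * R) (i j : ix) : R :=
  match i, j with
  | I1, I1 => h x I2 I2 / det h x
  | I2, I2 => h x I1 I1 / det h x
  | _, _ => - h x i j / det h x
  end.

(* [christoffel h x k i j] is the symbol with upper index k, lower indices i, j. *)
Definition christoffel (h : lmetric) (x : R * R) (k i j : ix) : R :=
  / 2 * Sum (fun l => inv h x k l *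
    (pd i (fun z => h z j l) x + pd j (fun z => h z i l) x
     - pd l (fun z => h z i j) x)).

(* Levi-Civita covariant derivative of Y in the direction X. *)
Definition cov (h : lmetric) (X Y : lfield) : lfield := fun x k =>
  Sum (fun i => X x i * pd i (fun z => Y z k) x) +
  Sum (fun i => Sum (fun j => christoffel h x k i j * X x i * Y x j)).

(* <R(d1,d2)d2, d1> / det h, where R(d1,d2)d2 = D_1 D_2 d2 - D_2 D_1 d2 for the
   commuting coordinate fields d1, d2. *)
Definition gauss (h : lmetric) (x : R * R) : R :=
  let d1 : lfield := fun _ => basis I1 in
  let d2 : lfield := fun _ => basis I2 in
  dot h x (fun k => cov h d1 (cov h d2 d2) x k - cov h d2 (cov h d1 d2) x k)
    (basis I1) / det h x.

(* In the coordinates (x, v) of the tangent bundle, a vector tangent to the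
   tangent bundle at (x, v) is a pair [A = (dx, dv)]. *)

Definition hlift (h : lmetric) (x : R * R) (v X : vec) : vec * vec :=
  (X, fun k => - Sum (fun i => Sum (fun j => christoffel h x k i j * X i * v j))).

Definition vlift (X : vec) : vec * vec := (fun _ => 0, X).

Definition hpart (A : vec * vec) : vec := fst A.

Definition vpart (h : lmetric) (x : R * R) (v : vec) (A : vec * vec) : vec :=
  fun k => snd A k +
    Sum (fun i => Sum (fun j => christoffel h x k i j * fst A i * v j)).

Lemma lift_decomposition (h : lmetric) (x : R * R) (v : vec) (A : vec * vec) (k : ix) :
  fst A k = fst (hlift h x v (hpart A)) k + fst (vlift (vpart h x v A)) k /\
  snd A k = snd (hlift h x v (hpart A)) k + snd (vlift (vpart h x v A)) k.
Proof. unfold hlift, vlift, hpart, vpart, Sum; simpl; split; ring. Qed.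

Lemma lift_parts (h : lmetric) (x : R * R) (v X1 X2 : vec) (k : ix) :
  let A : vec * vec := (fun i => fst (hlift h x v X1) i + fst (vlift X2) i,
            fun i => snd (hlift h x v X1) i + snd (vlift X2) i) in
  hpart A k = X1 k /\ vpart h x v A k = X2 k.
Proof. intros A; unfold A, hlift, vlift, hpart, vpart, Sum; simpl; split; ring. Qed.

Definition sasaki (h : lmetric) (x : R * R) (v : vec) (A B : vec * vec) : R :=
  dot h x (hpart A) (hpart B) + dot h x (vpart h x v A) (vpart h x v B).

(* Image of the i-th coordinate vector under the differential of the map
   x |-> (x, xi x). *)
Definition dsection (xi : lfield) (x : R * R) (i : ix) : vec * vec :=
  (basis i, fun k => pd i (fun z => xi z k) x).

(* The metric that the image of xi inherits from the Sasaki metric, in the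
   parametrization x |-> (x, xi x) of that image.  For a unit field the image
   lies in the unit tangent bundle, whose metric is a restriction of the Sasaki
   metric, so passing through it changes nothing. *)
Definition lsection (h : lmetric) (xi : lfield) : lmetric := fun x i j =>
  sasaki h x (xi x) (dsection xi x i) (dsection xi x j).

Definition atlas_open {P C : Type} (dom : C -> R * R -> Prop)
  (par : C -> R * R -> P) (V : P -> Prop) : Prop :=
  forall a, open (fun x => dom a x /\ V (par a x)).

(* A smooth 2-manifold, presented by an atlas: [par a] parametrizes the patch of
   the chart a by the open set [dom a], with inverse [crd a].  The topology is
   the one determined by the atlas. *)
Record surface := Surface {
  pt : Type;
  chart : Type;
  dom : chart -> R * R -> Prop;
  par : chart -> R * R -> pt;
  crd : chart -> pt -> R * R;
  patch := fun (a : chart) (p : pt) => exists x, dom a x /\ par a x = p;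
  mopen := atlas_open dom par;
  pt_inhabited : inhabited pt;
  dom_open : forall a, open (dom a);
  crd_par : forall a x, dom a x -> crd a (par a x) = x;
  patch_cover : forall p, exists a, patch a p;
  overlap_open : forall a b, open (fun x => dom a x /\ patch b (par a x));
  transition_smooth : forall a b i,
    smooth (fun x => dom a x /\ patch b (par a x))
           (fun x => coord i (crd b (par a x)));
  hausdorff : forall p q, p <> q -> exists V W : pt -> Prop,
    mopen V /\ mopen W /\ V p /\ W q /\ (forall r, ~ (V r /\ W r));
  second_countable : exists B : nat -> pt -> Prop,
    (forall n, mopen (B n)) /\
    (forall V p, mopen V -> V p ->
       exists n, B n p /\ forall q, B n q -> V q)
}.

Arguments dom {s}. Arguments par {s}. Arguments crd {s}.
Arguments patch {s}. Arguments mopen {s}.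

Definition tensor (M : surface) := chart M -> lmetric.

Record metric (M : surface) := Metric {
  gcomp :> tensor M;
  metric_smooth : forall a i j, smooth (dom a) (fun x => gcomp a x i j);
  metric_sym : forall a x i j, dom a x -> gcomp a x i j = gcomp a x j i;
  metric_pos : forall a x v, dom a x ->
    (exists i, v i <> 0) -> 0 < dot (gcomp a) x v v;
  metric_compat : forall a b x i j, dom a x -> patch b (par a x) ->
    let f := fun z => crd b (par a z) in
    gcomp a x i j = pull f x (gcomp b (f x)) i j
}.

Arguments gcomp {M}.

Record vfield (M : surface) := VField {
  vcomp :> chart M -> lfield;
  vfield_smooth : forall a k, smooth (dom a) (fun x => vcomp a x k);
  vfield_compat : forall a b x k, dom a x -> patch b (par a x) ->
    let f := fun z => crd b (par a z) in
    vcomp b (f x) k = push f x (vcomp a x) k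
}.

Definition unit_field {M : surface} (g : metric M) (xi : vfield M) : Prop :=
  forall a x, dom a x -> dot (gcomp g a) x (xi a x) (xi a x) = 1.

Definition geodesic_field {M : surface} (g : metric M) (xi : vfield M) : Prop :=
  forall a x k, dom a x -> cov (gcomp g a) (xi a) (xi a) x k = 0.

Definition parallel_field {M : surface} (g : metric M) (xi : vfield M) : Prop :=
  forall a x i k, dom a x -> cov (gcomp g a) (fun _ => basis i) (xi a) x k = 0.

Definition constant_curvature {M : surface} (h : tensor M) (K : R) : Prop :=
  forall a x, dom a x -> gauss (h a) x = K.

(* The image of xi is identified with M through xi, so that every chart of M
   gives a parametrization of it. *)
Definition section_metric {M : surface} (g : metric M) (xi : vfield M)
  : tensor M := fun a => lsection (gcomp g a) (xi a).

Definition connected {M : surface} (V : pt M -> Prop) : Prop :=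
  forall A B : pt M -> Prop, mopen A -> mopen B ->
    (forall p, V p -> A p \/ B p) -> (forall p, V p -> ~ (A p /\ B p)) ->
    (forall p, V p -> A p) \/ (forall p, V p -> B p).

Definition smooth_map {M N : surface} (V : pt M -> Prop) (phi : pt M -> pt N)
  : Prop :=
  forall (a : chart M) (b : chart N),
    let O := fun x => dom a x /\ V (par a x) /\ patch b (phi (par a x)) in
    open O /\ forall i, smooth O (fun x => coord i (crd b (phi (par a x)))).

(* phi is an isometry of the open set V of (M, h) onto an open set of (N, k). *)
Definition isometry {M N : surface} (h : tensor M) (k : tensor N)
  (V : pt M -> Prop) (phi : pt M -> pt N) : Prop :=
  mopen V /\
  (exists (W : pt N -> Prop) (psi : pt N -> pt M),
     mopen W /\
     (forall p, V p -> W (phi p) /\ psi (phi p) = p) /\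
     (forall q, W q -> V (psi q) /\ phi (psi q) = q) /\
     smooth_map V phi /\ smooth_map W psi) /\
  (forall a b x i j, dom a x -> V (par a x) -> patch b (phi (par a x)) ->
     let f := fun z => crd b (phi (par a z)) in
     h a x i j = pull f x (k b (f x)) i j).

Definition locally_isometric {M N : surface} (h : tensor M) (k : tensor N)
  : Prop :=
  forall p : pt M, exists (V : pt M -> Prop) (phi : pt M -> pt N),
    V p /\ isometry h k V phi.

Definition upper (x : R * R) : Prop := 0 < snd x.

Definition hpt := { x : R * R | upper x }.

(* The value outside the half-plane is irrelevant. *)
Definition hpar (x : R * R) : hpt :=
  match Rlt_dec 0 (snd x) with
  | left H => exist upper x H
  | right _ => exist upper (0, 1) Rlt_0_1
  end.

Lemma proj1_hpar x : upper x -> proj1_sig (hpar x) = x.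
Proof. unfold hpar, upper. destruct (Rlt_dec 0 (snd x)); simpl; tauto. Qed.

Lemma hpar_proj1 p : hpar (proj1_sig p) = p.
Proof.
destruct p as [x H]; unfold hpar; simpl.
destruct (Rlt_dec 0 (snd x)) as [H'|H']; [|contradiction].
now rewrite (proof_irrelevance _ H' H).
Qed.

Lemma upper_open : open upper.
Proof. apply (open_comp snd (fun y => 0 < y)); [|apply open_gt].
intros [x y] _; apply continuous_snd. Qed.

Lemma slice_coord i f p : slice i f p (coord i p) = f p.
Proof. destruct p, i; reflexivity. Qed.

Lemma locally_slice i (U : R * R -> Prop) p : open U -> U p ->
  locally (coord i p) (fun t => U (match i with I1 => (t, snd p) | I2 => (fst p, t) end)).
Proof.
intros HU Hp. destruct (HU p Hp) as [e He]. exists e. intros t Ht.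
apply He. destruct i; split; simpl; auto; apply ball_center.
Qed.

Lemma Ck_ext k : forall U f g, open U -> (forall p, U p -> f p = g p) ->
  Ck k U f -> Ck k U g.
Proof.
induction k as [|k IH]; intros U f g HU E [Hc H].
all: assert (Hc' : forall p, U p -> continuous g p) by
  (intros p Hp; apply (continuous_ext_loc g f p);
   [apply (filter_imp U); [exact E | now apply HU] | now apply Hc]).
{ now split. }
split; [exact Hc'|]. intros i. destruct (H i) as [H1 H2].
assert (L : forall p, U p -> locally (coord i p) (fun t => slice i f p t = slice i g p t)).
{ intros p Hp. generalize (locally_slice i U p HU Hp). apply filter_imp.
  intros t Ht. destruct i; simpl; now apply E. }
split.
- intros p Hp. exact (ex_derive_ext_loc _ _ _ (L p Hp) (H1 p Hp)).
- apply (IH U (pd i f)); auto. intros p Hp. exact (Derive_ext_loc _ _ _ (L p Hp)).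
Qed.

Lemma smooth_const U (c : R) : smooth U (fun _ => c).
Proof.
intros k; revert c; induction k as [|k IH]; intros c;
  (split; [intros; apply continuous_const|]); auto.
intros i. split.
- intros p _. destruct i; apply ex_derive_const.
- replace (pd i (fun _ => c)) with (fun _ : R * R => 0); [apply IH|].
  apply functional_extensionality; intros p.
  unfold pd; destruct i; simpl; now rewrite Derive_const.
Qed.

Lemma pd_coord i j p : pd i (coord j) p = if ix_eqb i j then 1 else 0.
Proof. destruct i, j; unfold pd; simpl;
  first [apply Derive_id | apply Derive_const]. Qed.

Lemma smooth_coord U j : smooth U (coord j).
Proof.
intros k. assert (C : forall p, U p -> continuous (coord j) p).
{ intros [x y] _; destruct j; [apply continuous_fst | apply continuous_snd]. }
destruct k as [|k]; (split; [exact C|]); auto.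
intros i. split.
- intros p _; unfold ex_pd; destruct i, j; simpl; auto_derive; exact I.
- replace (pd i (coord j)) with (fun _ : R * R => if ix_eqb i j then 1 else 0).
  + apply smooth_const.
  + apply functional_extensionality; intros p. symmetry; apply pd_coord.
Qed.

Lemma half_plane_open_iff (V : hpt -> Prop) :
  atlas_open (fun _ : unit => upper) (fun _ => hpar) V <->
  open (fun x => upper x /\ V (hpar x)).
Proof. split; intros H; [apply (H tt) | intros _; exact H]. Qed.

Lemma half_plane_hausdorff (p q : hpt) : p <> q ->
  exists V W : hpt -> Prop,
    atlas_open (fun _ : unit => upper) (fun _ => hpar) V /\
    atlas_open (fun _ : unit => upper) (fun _ => hpar) W /\
    V p /\ W q /\ (forall r, ~ (V r /\ W r)).
Proof.
intros Hpq.
assert (S : forall (j : ix) (D : R -> Prop), open D ->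
  atlas_open (fun _ : unit => upper) (fun _ => hpar)
    (fun r => D (coord j (proj1_sig r)))).
{ intros j D HD _. apply (open_ext (fun x => upper x /\ D (coord j x))).
  - intros x; split; intros [H1 H2]; split; auto; rewrite proj1_hpar in *; auto.
  - apply open_and; [exact upper_open|]. apply (open_comp (coord j)); auto.
    intros [x y] _; destruct j; [apply continuous_fst | apply continuous_snd]. }
assert (T : forall j, coord j (proj1_sig p) < coord j (proj1_sig q) \/
    coord j (proj1_sig q) < coord j (proj1_sig p) -> exists V W : hpt -> Prop,
    atlas_open (fun _ : unit => upper) (fun _ => hpar) V /\
    atlas_open (fun _ : unit => upper) (fun _ => hpar) W /\
    V p /\ W q /\ (forall r, ~ (V r /\ W r))).
{ intros j. set (m := (coord j (proj1_sig p) + coord j (proj1_sig q)) / 2).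
  intros [H|H].
  - exists (fun r => coord j (proj1_sig r) < m), (fun r => m < coord j (proj1_sig r)).
    repeat split; try (apply (S j (fun y => y < m)), open_lt);
      try (apply (S j (fun y => m < y)), open_gt); try (unfold m; lra).
    intros r; lra.
  - exists (fun r => m < coord j (proj1_sig r)), (fun r => coord j (proj1_sig r) < m).
    repeat split; try (apply (S j (fun y => y < m)), open_lt);
      try (apply (S j (fun y => m < y)), open_gt); try (unfold m; lra).
    intros r; lra. }
destruct (Rtotal_order (coord I1 (proj1_sig p)) (coord I1 (proj1_sig q)))
  as [H|[H|H]]; [now apply (T I1); left | | now apply (T I1); right].
destruct (Rtotal_order (coord I2 (proj1_sig p)) (coord I2 (proj1_sig q)))
  as [H'|[H'|H']]; [now apply (T I2); left | | now apply (T I2); right].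
exfalso; apply Hpq. rewrite <- (hpar_proj1 p), <- (hpar_proj1 q).
f_equal. destruct (proj1_sig p), (proj1_sig q); simpl in *; congruence.
Qed.

Definition rational_box (n : nat) (p : hpt) : Prop :=
  let (a1, n1) := Cantor.of_nat n in
  let (a2, n2) := Cantor.of_nat n1 in
  let (b1, n3) := Cantor.of_nat n2 in
  let (b2, k) := Cantor.of_nat n3 in
  let d := / (INR k + 1) in
  Rabs (fst (proj1_sig p) - (INR a1 - INR a2) * d) < 2 * d /\
  Rabs (snd (proj1_sig p) - (INR b1 - INR b2) * d) < 2 * d.

Lemma diff_nat_approx (x d : R) : 0 < d ->
  exists a b : nat, Rabs (x - (INR a - INR b) * d) < 2 * d.
Proof.
intros Hd. set (z := up (x / d)).
destruct (archimed (x / d)) as [H1 H2]. fold z in H1, H2.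
exists (Z.to_nat z), (Z.to_nat (- z)).
replace (INR (Z.to_nat z) - INR (Z.to_nat (- z))) with (IZR z).
- assert (E : x = x / d * d) by (field; lra).
  rewrite E, <- Rmult_minus_distr_r, Rabs_mult, (Rabs_pos_eq d) by lra.
  apply Rmult_lt_compat_r; [lra|]. apply Rabs_def1; lra.
- rewrite !INR_IZR_INZ, <- minus_IZR. f_equal. lia.
Qed.

Lemma half_plane_second_countable : exists B : nat -> hpt -> Prop,
  (forall n, atlas_open (fun _ : unit => upper) (fun _ => hpar) (B n)) /\
  (forall V p, atlas_open (fun _ : unit => upper) (fun _ => hpar) V -> V p ->
     exists n, B n p /\ forall q, B n q -> V q).
Proof.
exists rational_box. split.
- intros n _. unfold rational_box.
  destruct (Cantor.of_nat n) as [a1 n1], (Cantor.of_nat n1) as [a2 n2],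
    (Cantor.of_nat n2) as [b1 n3], (Cantor.of_nat n3) as [b2 k].
  set (d := / (INR k + 1)). cbv zeta.
  set (u := (INR a1 - INR a2) * d). set (w := (INR b1 - INR b2) * d).
  apply (open_ext (fun x => upper x /\
    ((u - 2 * d < coord I1 x /\ coord I1 x < u + 2 * d) /\
     (w - 2 * d < coord I2 x /\ coord I2 x < w + 2 * d)))).
  + intros x; split; intros [H1 H2]; split; auto;
      rewrite ?proj1_hpar in * by auto; simpl in *.
    * split; apply Rabs_def1; lra.
    * destruct H2 as [H2 H3]. apply Rabs_def2 in H2, H3. lra.
  + assert (C : forall j (D : R -> Prop), open D -> open (fun x => D (coord j x))).
    { intros j D HD. apply (open_comp (coord j)); auto.
      intros [x y] _; destruct j; [apply continuous_fst | apply continuous_snd]. }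
    apply open_and; [exact upper_open|].
    repeat apply open_and;
      first [ apply (C _ (fun y => _ < y)), open_gt
            | apply (C _ (fun y => y < _)), open_lt ].
- intros V p HV Hp. pose proof (proj1 (half_plane_open_iff V) HV) as HO.
  destruct (HO (proj1_sig p)) as [e He].
  { split; [exact (proj2_sig p) | now rewrite hpar_proj1]. }
  destruct (archimed_cor1 (e / 4)) as [N [HN HN0]].
  { destruct e as [e He']; simpl; lra. }
  set (d := / (INR N + 1)).
  assert (HNp : 0 < INR N) by (apply lt_0_INR; lia).
  assert (Hd : 0 < d) by (apply Rinv_0_lt_compat; lra).
  assert (Hde : 4 * d < e).
  { assert (d < / INR N) by (apply Rinv_lt_contravar; nra). lra. }
  destruct (diff_nat_approx (fst (proj1_sig p)) d Hd) as [a1 [a2 Ha]].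
  destruct (diff_nat_approx (snd (proj1_sig p)) d Hd) as [b1 [b2 Hb]].
  exists (Cantor.to_nat (a1, Cantor.to_nat (a2, Cantor.to_nat (b1, Cantor.to_nat (b2, N))))).
  unfold rational_box. rewrite !Cantor.cancel_of_to.
  fold d. split; [now split|].
  intros q [Hq1 Hq2].
  enough (H : upper (proj1_sig q) /\ V (hpar (proj1_sig q)))
    by (rewrite hpar_proj1 in H; apply H).
  apply He. apply Rabs_def2 in Ha, Hb, Hq1, Hq2.
  split; apply Rabs_def1; unfold minus, plus, opp; simpl; lra.
Qed.

Definition half_plane : surface.
Proof.
refine {| pt := hpt; chart := unit; dom := fun _ => upper; par := fun _ => hpar;
          crd := fun _ p => proj1_sig p;
          hausdorff := half_plane_hausdorff;
          second_countable := half_plane_second_countable |}.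
- exact (inhabits (hpar (0, 1))).
- intros _; exact upper_open.
- intros _ x H; now apply proj1_hpar.
- intros p; exists tt, (proj1_sig p). split; [exact (proj2_sig p) | apply hpar_proj1].
- intros _ _. apply (open_ext upper); [|exact upper_open].
  intros x; split; [|tauto]. intros H; split; [exact H|now exists x].
- intros _ _ i k.
  assert (HU : open (fun x => upper x /\ exists x0, upper x0 /\ hpar x0 = hpar x)).
  { apply (open_ext upper); [|exact upper_open].
    intros x; split; [|tauto]. intros H; split; [exact H|now exists x]. }
  apply (Ck_ext k _ (coord i)); [exact HU| |apply smooth_coord].
  intros x [H _]. now rewrite proj1_hpar.
Defined.

(* The metric (dx^2 + dy^2) / (c y)^2, of curvature - c^2. *)
Definition hyp_metric (c : R) : tensor half_plane := fun _ x i j =>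
  if ix_eqb i j then / (c * snd x) ^ 2 else 0.

(* Ideal points are [None] (infinity) and [Some a] (the point (a, 0)).  The
   horocycles centred at infinity are the lines y = t; those centred at (a, 0)
   are the Euclidean circles, here of diameter t, tangent to the x-axis at
   (a, 0), with the point of tangency removed. *)
Definition horocycle (w : option R) (t : R) (x : R * R) : Prop :=
  upper x /\
  match w with
  | None => snd x = t
  | Some a => (fst x - a) ^ 2 + snd x ^ 2 = t * snd x
  end.

(* The vector v at x is orthogonal to the velocity of every curve through x that
   stays in S. *)
Definition normal_to (h : lmetric) (S : R * R -> Prop) (x : R * R) (v : vec)
  : Prop :=
  forall (gam : R -> R * R) (gam' : vec),
    gam 0 = x -> locally 0 (fun s => S (gam s)) ->
    (forall i, is_derive (fun s => coord i (gam s)) 0 (gam' i)) ->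
    dot h x v gam' = 0.

(* (M, g) is locally the hyperbolic plane of curvature - c^2 and, under every
   isometry from a connected open set of M to that plane, xi corresponds to a
   field normal to the horocycles centred at one ideal point.  When M is the
   hyperbolic plane itself this covers the whole of M at once. *)
Definition horocycle_normal {M : surface} (c : R) (g : metric M) (xi : vfield M)
  : Prop :=
  locally_isometric g (hyp_metric c) /\
  forall (V : pt M -> Prop) (phi : pt M -> pt half_plane),
    connected V -> isometry g (hyp_metric c) V phi ->
    exists w : option R,
      forall (a : chart M) (x : R * R) (t : R), dom a x -> V (par a x) ->
        let f := fun z => proj1_sig (phi (par a z)) in
        horocycle w t (f x) ->
        normal_to (hyp_metric c tt) (horocycle w t) (f x) (push f x (xi a x)).

(* Main.v *)
Require Import Defs.
From Stdlib Require Import Reals Lra Lia Psatz.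
From Stdlib Require Import Classical ClassicalEpsilon FunctionalExtensionality.
From Coquelicot Require Import Coquelicot.
Open Scope R_scope.

(** The proof is Cartan's method of moving frames. Near each point take an
    orthonormal coframe [a], [b] with [a] dual to [xi]. The connection form
    evaluated on [xi] is the acceleration of [xi], so for a geodesic field [a] is
    closed, and all that remains is the function [m] with [db = m a ^ b], the
    divergence of [xi] ([adapted_closed], [cov_adapted]). In these terms

    - the curvature is given by the Riccati equation [xi(m) = - (K + m^2)]
      ([gauss_coframe], [riccati]);
    - the metric of the image is [a^2 + (1 + m^2) b^2], a metric of the same
      kind, whence its curvature is [(1 - K) (K - m^4) / (1 + m^2)^2]
      ([section_adapted], [gauss_section]).

    For [K = 1] this vanishes for every [m]. For [K <> 1] and constant curvature
    of the image, differentiating twice along [xi] forces the equilibrium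
    [m^2 = - K] ([equilibrium]). So [K <= 0]; for [K = 0] the field is parallel and
    the image has the metric of [M]; for [K = - c^2] it remains to see that
    [m^2 = c^2] means that [xi] is normal to concentric horocycles.

    If [m = c] or [m = - c], then [m a] and, after multiplication by an
    exponential, [b] are closed. Their primitives are half-plane coordinates, so
    by the Poincare lemma and the inverse function theorem the surface is locally
    the hyperbolic plane; the image only has [b] stretched by a constant and is
    so too ([coframe_locally_hyperbolic]).

    Let an isometry now map a connected piece of [M] into the half-plane. The
    structure equations express the derivative of the angle of the image of [xi]
    through the sign of [m] ([turning_of_divergence]), and from this the ideal
    endpoint of the geodesic through a point in the direction of [xi], or against
    it according to that sign, has derivative zero ([endpoint_pd]). It is
    therefore the same for all points of the piece ([common_endpoint]), and the
    horocycles centred there are orthogonal to [xi] ([endpoint_normal]).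

    Conversely, if [xi] is normal to concentric horocycles, move their centre to
    infinity by an inversion. Then [xi] is vertical in the half-plane, the forms
    [dY / (c Y)] and [dX / (c Y)] are adapted to it up to a sign, and [m^2 = c^2]
    is read off ([vertical_field_divergence]). *)


(** * Partial derivatives and smooth functions on the plane *)

Definition is_pd (i : ix) (f : R * R -> R) (p : R * R) (l : R) : Prop :=
  is_derive (slice i f p) (coord i p) l.

Lemma is_pd_unique i f p l : is_pd i f p l -> pd i f p = l.
Proof. apply is_derive_unique. Qed.

Lemma is_pd_ex i f p l : is_pd i f p l -> ex_pd i f p.
Proof. intros H; now exists l. Qed.

Lemma ex_pd_is i f p : ex_pd i f p -> is_pd i f p (pd i f p).
Proof. apply Derive_correct. Qed.

Lemma is_pd_ext_loc i (U : R * R -> Prop) f g p l : open U -> U p ->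
  (forall z, U z -> f z = g z) -> is_pd i f p l -> is_pd i g p l.
Proof.
intros HU Hp E. apply is_derive_ext_loc.
generalize (locally_slice i U p HU Hp). apply filter_imp.
intros t Ht; destruct i; simpl; now apply E.
Qed.

Lemma pd_ext_loc i (U : R * R -> Prop) f g p : open U -> U p ->
  (forall z, U z -> f z = g z) -> pd i f p = pd i g p.
Proof.
intros HU Hp E. apply Derive_ext_loc.
generalize (locally_slice i U p HU Hp). apply filter_imp.
intros t Ht; destruct i; simpl; now apply E.
Qed.

Lemma slice_continuous i f p : continuous f p ->
  continuous (slice i f p) (coord i p).
Proof.
intros H. destruct p as [x y], i; simpl.
- apply (continuous_comp (fun t => (t, y)) f); [|exact H].
  apply (continuous_comp_2 (fun t => t) (fun _ => y) (fun u v => (u, v)));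
    [apply continuous_id | apply continuous_const |].
  apply (continuous_ext (fun z => z)); [now intros [? ?] | apply continuous_id].
- apply (continuous_comp (fun t => (x, t)) f); [|exact H].
  apply (continuous_comp_2 (fun _ => x) (fun t => t) (fun u v => (u, v)));
    [apply continuous_const | apply continuous_id |].
  apply (continuous_ext (fun z => z)); [now intros [? ?] | apply continuous_id].
Qed.

Lemma is_pd_const i c p : is_pd i (fun _ => c) p 0.
Proof. destruct i; exact (is_derive_const c _). Qed.

Lemma is_pd_coord i j p : is_pd i (coord j) p (if ix_eqb i j then 1 else 0).
Proof.
rewrite <- (pd_coord i j p). apply ex_pd_is.
unfold ex_pd; destruct i, j; simpl; auto_derive; exact I.
Qed.

Lemma is_pd_plus i f g p l m : is_pd i f p l -> is_pd i g p m ->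
  is_pd i (fun z => f z + g z) p (l + m).
Proof. destruct i; intros Hf Hg; exact (is_derive_plus _ _ _ _ _ Hf Hg). Qed.

Lemma is_pd_opp i f p l : is_pd i f p l -> is_pd i (fun z => - f z) p (- l).
Proof. destruct i; intros Hf; exact (is_derive_opp _ _ _ Hf). Qed.

Lemma is_pd_minus i f g p l m : is_pd i f p l -> is_pd i g p m ->
  is_pd i (fun z => f z - g z) p (l - m).
Proof. intros Hf Hg. exact (is_pd_plus _ _ _ _ _ _ Hf (is_pd_opp _ _ _ _ Hg)). Qed.

Lemma is_pd_mult i f g p l m : is_pd i f p l -> is_pd i g p m ->
  is_pd i (fun z => f z * g z) p (l * g p + f p * m).
Proof.
intros Hf Hg. generalize (Derive.is_derive_mult _ _ _ _ _ Hf Hg).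
rewrite !slice_coord. destruct i; exact (fun H => H).
Qed.

Lemma is_pd_comp1 i (phi : R -> R) f p l d : is_pd i f p l ->
  is_derive phi (f p) d -> is_pd i (fun z => phi (f z)) p (d * l).
Proof.
intros Hf Hphi. rewrite Rmult_comm. rewrite <- (slice_coord i f p) in Hphi.
pose proof (is_derive_comp phi (slice i f p) _ _ _ Hphi Hf) as H.
unfold is_pd. destruct i; exact H.
Qed.

Lemma is_pd_inv i f p l : is_pd i f p l -> f p <> 0 ->
  is_pd i (fun z => / f z) p (- l * / f p * / f p).
Proof.
intros Hf H. replace (- l * / f p * / f p) with (- (1) / f p ^ 2 * l) by (field; auto).
apply (is_pd_comp1 i Rinv); auto. apply (is_derive_inv (fun y => y) (f p) 1); [exact (is_derive_id (f p))|exact H].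
Qed.

Lemma is_pd_pow2 i f p l : is_pd i f p l ->
  is_pd i (fun z => f z ^ 2) p (2 * f p * l).
Proof.
intros H. replace (2 * f p * l) with (INR 2 * 1 * f p ^ 1 * l) by (simpl; ring).
apply (is_pd_comp1 i (fun t => t ^ 2)); auto.
apply (is_derive_pow (fun t => t) 2 (f p) 1). exact (is_derive_id (f p)).
Qed.

Lemma is_pd_differentiable (U : R * R -> Prop) f (d : ix -> R * R -> R) p :
  open U -> U p -> (forall i z, U z -> is_pd i f z (d i z)) ->
  continuous (d I1) p ->
  differentiable_pt_lim (fun x y => f (x, y)) (fst p) (snd p) (d I1 p) (d I2 p).
Proof.
destruct p as [x y]; simpl. intros HU Hp Hd Hc.
apply filterdiff_differentiable_pt_lim.
eapply filterdiff_ext_lin.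
- apply (is_derive_filterdiff (fun x y => f (x, y)) x y (fun x y => d I1 (x, y)) (d I2 (x, y))).
  + generalize (HU _ Hp). apply filter_imp. intros [u v] Huv; simpl.
    exact (Hd I1 (u, v) Huv).
  + exact (Hd I2 (x, y) Hp).
  + apply (continuous_ext (d I1)); [now intros [? ?] | exact Hc].
- intros [u v]; simpl. reflexivity.
Qed.

Lemma differentiable_continuous f p l1 l2 :
  differentiable_pt_lim (fun x y => f (x, y)) (fst p) (snd p) l1 l2 -> continuous f p.
Proof.
destruct p as [x y]; simpl; intros H.
assert (C : continuity_2d_pt (fun x y => f (x, y)) x y)
  by (apply differentiable_continuity_pt; now exists l1, l2).
apply continuity_2d_pt_filterlim in C.
apply (continuous_ext (fun z => f (fst z, snd z))); [now intros [? ?]| exact C].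
Qed.

(** Above level 0 the continuity clause of [Ck] comes for free: continuous first
    partials make a function differentiable. *)
Lemma Ck_S_intro k U f (d : ix -> R * R -> R) : open U ->
  (forall i p, U p -> is_pd i f p (d i p)) -> (forall i, Ck k U (d i)) ->
  Ck (S k) U f.
Proof.
intros HU Hd Hk. split.
- intros p Hp. apply (differentiable_continuous f p (d I1 p) (d I2 p)).
  apply (is_pd_differentiable U); auto.
  assert (H := Hk I1). destruct k; destruct H as [H _]; now apply H.
- intros i. split.
  + intros p Hp. exact (is_pd_ex _ _ _ _ (Hd i p Hp)).
  + apply (Ck_ext k U (d i)); auto. intros p Hp. symmetry. apply is_pd_unique; auto.
Qed.

Lemma Ck_continuous k U f p : Ck k U f -> U p -> continuous f p.
Proof. destruct k; intros [H _]; auto. Qed.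

Lemma Ck_pred k : forall U f, Ck (S k) U f -> Ck k U f.
Proof.
induction k as [|k IH]; intros U f [Hc H].
- now split.
- split; auto. intros i. destruct (H i) as [H1 H2]. auto.
Qed.

Lemma Ck_is_pd k U f i p : Ck (S k) U f -> U p -> is_pd i f p (pd i f p).
Proof. intros [_ H] Hp. apply ex_pd_is. now apply (H i). Qed.

Lemma Ck_pd k U f i : Ck (S k) U f -> Ck k U (pd i f).
Proof. intros [_ H]. now apply (H i). Qed.

Lemma smooth_is_pd U f i p : smooth U f -> U p -> is_pd i f p (pd i f p).
Proof. intros H. exact (Ck_is_pd 0 U f i p (H 1%nat)). Qed.

Lemma smooth_pd U f i : smooth U f -> smooth U (pd i f).
Proof. intros H k. exact (Ck_pd k U f i (H (S k))). Qed.

Lemma smooth_continuous U f p : smooth U f -> U p -> continuous f p.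
Proof. intros H. exact (Ck_continuous 0 U f p (H O)). Qed.

Lemma smooth_ext U f g : open U -> (forall p, U p -> f p = g p) ->
  smooth U f -> smooth U g.
Proof. intros HU E H k. exact (Ck_ext k U f g HU E (H k)). Qed.

Lemma Ck_sub k : forall (U V : R * R -> Prop) f, (forall p, V p -> U p) ->
  Ck k U f -> Ck k V f.
Proof.
induction k as [|k IH]; intros U V f HVU [Hc H].
- split; auto.
- split; auto. intros i. destruct (H i) as [H1 H2]. split; auto. now apply (IH U).
Qed.

Lemma smooth_sub (U V : R * R -> Prop) f : (forall p, V p -> U p) ->
  smooth U f -> smooth V f.
Proof. intros HVU H k. exact (Ck_sub k U V f HVU (H k)). Qed.

Lemma Ck_plus k : forall U f g, open U -> Ck k U f -> Ck k U g ->
  Ck k U (fun z => f z + g z).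
Proof.
induction k as [|k IH]; intros U f g HU Hf Hg.
- split; auto. intros p Hp. apply (continuous_plus f g).
  + now apply (Ck_continuous 0 U). + now apply (Ck_continuous 0 U).
- apply (Ck_S_intro k U _ (fun i z => pd i f z + pd i g z)); auto.
  + intros i p Hp. apply is_pd_plus; eapply Ck_is_pd; eauto.
  + intros i. apply IH; auto; now apply Ck_pd.
Qed.

Lemma Ck_mult k : forall U f g, open U -> Ck k U f -> Ck k U g ->
  Ck k U (fun z => f z * g z).
Proof.
induction k as [|k IH]; intros U f g HU Hf Hg.
- split; auto. intros p Hp. apply (continuous_mult f g).
  + now apply (Ck_continuous 0 U). + now apply (Ck_continuous 0 U).
- apply (Ck_S_intro k U _ (fun i z => pd i f z * g z + f z * pd i g z)); auto.
  + intros i p Hp. apply is_pd_mult; eapply Ck_is_pd; eauto.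
  + intros i. apply Ck_plus; auto; apply IH; auto; solve [now apply Ck_pd | now apply Ck_pred].
Qed.

Lemma Ck_const k U c : Ck k U (fun _ => c).
Proof. apply smooth_const. Qed.

Lemma Ck_opp k U f : open U -> Ck k U f -> Ck k U (fun z => - f z).
Proof.
intros HU Hf. apply (Ck_ext k U (fun z => (-1) * f z)); auto.
- intros; ring.
- apply Ck_mult; auto. apply Ck_const.
Qed.

Lemma Ck_inv k : forall U f, open U -> (forall p, U p -> f p <> 0) -> Ck k U f ->
  Ck k U (fun z => / f z).
Proof.
induction k as [|k IH]; intros U f HU H0 Hf.
- split; auto. intros p Hp.
  apply (continuous_comp f Rinv); [now apply (Ck_continuous 0 U)|].
  apply (ex_derive_continuous Rinv). exact (ex_derive_inv (fun y => y) (f p) (ex_derive_id (f p)) (H0 p Hp)).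
- apply (Ck_S_intro k U _ (fun i z => - pd i f z * / f z * / f z)); auto.
  + intros i p Hp. apply is_pd_inv; auto. eapply Ck_is_pd; eauto.
  + intros i. repeat apply Ck_mult; auto; try (apply IH; auto; now apply Ck_pred).
    apply Ck_opp; auto; now apply Ck_pd.
Qed.

Lemma Ck_sqrt k : forall U f, open U -> (forall p, U p -> 0 < f p) -> Ck k U f ->
  Ck k U (fun z => sqrt (f z)).
Proof.
induction k as [|k IH]; intros U f HU H0 Hf.
- split; auto. intros p Hp.
  apply (continuous_comp f sqrt); [now apply (Ck_continuous 0 U)|]. apply continuous_sqrt.
- apply (Ck_S_intro k U _ (fun i z => / (2 * sqrt (f z)) * pd i f z)); auto.
  + intros i p Hp. apply (is_pd_comp1 i sqrt); [eapply Ck_is_pd; eauto|].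
    replace (/ (2 * sqrt (f p))) with (1 / (2 * sqrt (f p)))
      by (field; apply Rgt_not_eq, sqrt_lt_R0; auto).
    apply (is_derive_sqrt (fun t => t) (f p) 1); auto. exact (is_derive_id (f p)).
  + intros i. apply Ck_mult; auto; [|now apply Ck_pd].
    apply Ck_inv; auto.
    * intros p Hp. apply Rmult_integral_contrapositive; split; [lra|].
      apply Rgt_not_eq, sqrt_lt_R0; auto.
    * apply Ck_mult; auto; [apply Ck_const|]. apply IH; auto; now apply Ck_pred.
Qed.

Lemma Ck_exp k : forall U f, open U -> Ck k U f -> Ck k U (fun z => exp (f z)).
Proof.
induction k as [|k IH]; intros U f HU Hf.
- split; auto. intros p Hp.
  apply (continuous_comp f exp); [now apply (Ck_continuous 0 U)|].
  apply (ex_derive_continuous exp). exists (exp (f p)). apply is_derive_exp.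
- apply (Ck_S_intro k U _ (fun i z => exp (f z) * pd i f z)); auto.
  + intros i p Hp. apply (is_pd_comp1 i exp); [eapply Ck_is_pd; eauto|]. apply is_derive_exp.
  + intros i. apply Ck_mult; auto; [|now apply Ck_pd]. apply IH; auto; now apply Ck_pred.
Qed.

Section SmoothAlgebra.
Variables (U : R * R -> Prop) (HU : open U).

Lemma smooth_plus f g : smooth U f -> smooth U g -> smooth U (fun z => f z + g z).
Proof. intros Hf Hg k; now apply Ck_plus. Qed.

Lemma smooth_mult f g : smooth U f -> smooth U g -> smooth U (fun z => f z * g z).
Proof. intros Hf Hg k; now apply Ck_mult. Qed.

Lemma smooth_opp f : smooth U f -> smooth U (fun z => - f z).
Proof. intros Hf k; now apply Ck_opp. Qed.

Lemma smooth_minus f g : smooth U f -> smooth U g -> smooth U (fun z => f z - g z).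
Proof. intros Hf Hg. apply smooth_plus; auto. now apply smooth_opp. Qed.

Lemma smooth_inv f : smooth U f -> (forall p, U p -> f p <> 0) ->
  smooth U (fun z => / f z).
Proof. intros Hf H k; now apply Ck_inv. Qed.

Lemma smooth_div f g : smooth U f -> smooth U g -> (forall p, U p -> g p <> 0) ->
  smooth U (fun z => f z / g z).
Proof. intros Hf Hg H. apply smooth_mult; auto. now apply smooth_inv. Qed.

Lemma smooth_pow f n : smooth U f -> smooth U (fun z => f z ^ n).
Proof.
intros Hf. induction n as [|n IH]; simpl.
- apply smooth_const.
- now apply smooth_mult.
Qed.

Lemma smooth_sqrt f : smooth U f -> (forall p, U p -> 0 < f p) ->
  smooth U (fun z => sqrt (f z)).
Proof. intros Hf H k; now apply Ck_sqrt. Qed.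

Lemma smooth_exp f : smooth U f -> smooth U (fun z => exp (f z)).
Proof. intros Hf k; now apply Ck_exp. Qed.

Lemma smooth_Sum (F : R * R -> ix -> R) : (forall i, smooth U (fun z => F z i)) ->
  smooth U (fun z => Sum (F z)).
Proof. intros H. unfold Sum. apply smooth_plus; auto. Qed.

End SmoothAlgebra.

Ltac smooth_tac :=
  repeat first
    [ assumption
    | apply smooth_const
    | apply smooth_coord
    | match goal with H : forall i, smooth ?U _ |- smooth ?U _ => solve [apply H] end
    | match goal with H : forall i j, smooth ?U _ |- smooth ?U _ => solve [apply H] end
    | apply smooth_plus | apply smooth_minus | apply smooth_opp | apply smooth_div
    | apply smooth_mult | apply smooth_inv | apply smooth_pow
    | apply smooth_Sum; intro | apply smooth_pd ].

Lemma continuous_continuity_2d f x y : continuous f (x, y) ->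
  continuity_2d_pt (fun u v => f (u, v)) x y.
Proof.
intros H. apply continuity_2d_pt_filterlim.
apply (continuous_ext f (fun z => f (fst z, snd z))); [now intros [? ?] | exact H].
Qed.

Lemma smooth_schwarz U f p : open U -> smooth U f -> U p ->
  pd I1 (pd I2 f) p = pd I2 (pd I1 f) p.
Proof.
intros HU Hf Hp. destruct p as [x y]. unfold pd at 1 3. simpl.
assert (C : forall g, smooth U g -> continuity_2d_pt (fun u v => g (u, v)) x y).
{ intros g Hg. apply continuous_continuity_2d. now apply (smooth_continuous U). }
generalize (Schwarz (fun u v => f (u, v)) x y). unfold pd; simpl.
intros S; apply S.
- apply locally_2d_locally. generalize (HU _ Hp). apply filter_imp.
  intros [u v] H; simpl. repeat split.
  + exact (is_pd_ex I1 f (u, v) _ (smooth_is_pd U f I1 _ Hf H)).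
  + exact (is_pd_ex I2 f (u, v) _ (smooth_is_pd U f I2 _ Hf H)).
  + exact (is_pd_ex I1 (pd I2 f) (u, v) _
      (smooth_is_pd U _ I1 _ (smooth_pd U f I2 Hf) H)).
  + exact (is_pd_ex I2 (pd I1 f) (u, v) _
      (smooth_is_pd U _ I2 _ (smooth_pd U f I1 Hf) H)).
- exact (C (pd I1 (pd I2 f)) (smooth_pd _ _ _ (smooth_pd _ _ _ Hf))).
- exact (C (pd I2 (pd I1 f)) (smooth_pd _ _ _ (smooth_pd _ _ _ Hf))).
Qed.

Lemma Ck1_differentiable k U f p : open U -> Ck (S k) U f -> U p ->
  differentiable_pt_lim (fun x y => f (x, y)) (fst p) (snd p) (pd I1 f p) (pd I2 f p).
Proof.
intros HU Hf Hp. apply (is_pd_differentiable U f (fun i => pd i f)); auto.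
- intros i z Hz. eapply Ck_is_pd; eauto.
- apply (Ck_continuous k U); auto. now apply Ck_pd.
Qed.

(** The partials of [g] are needed at the single point [p] only, because a [C^1]
    function [f] is differentiable and not merely partially so. *)
Lemma is_pd_comp k U f (g : R * R -> R * R) i p (l : vec) :
  open U -> Ck (S k) U f -> U (g p) ->
  (forall j, is_pd i (fun z => coord j (g z)) p (l j)) ->
  is_pd i (fun z => f (g z)) p (Sum (fun j => pd j f (g p) * l j)).
Proof.
intros HU Hf Hp Hg.
pose proof (Ck1_differentiable k U f (g p) HU Hf Hp) as D.
set (s := fun t => match i with I1 => (t, snd p) | I2 => (fst p, t) end).
assert (Es : s (coord i p) = p) by (destruct i, p; reflexivity).
assert (H := derivable_pt_lim_comp_2d (fun x y => f (x, y))
  (fun t => fst (g (s t))) (fun t => snd (g (s t))) (coord i p)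
  (pd I1 f (g p)) (pd I2 f (g p)) (l I1) (l I2)).
cbv beta in H. rewrite Es in H. specialize (H D).
assert (H1 := Hg I1). assert (H2 := Hg I2).
refine (is_derive_ext _ _ _ _ _ (proj2 (is_derive_Reals _ _ _) (H _ _))).
- intros t. unfold s. destruct i; simpl; rewrite <- surjective_pairing; reflexivity.
- apply is_derive_Reals. unfold is_pd in H1. unfold s. destruct i; exact H1.
- apply is_derive_Reals. unfold is_pd in H2. unfold s. destruct i; exact H2.
Qed.

Lemma Ck_comp k : forall U V f (g : R * R -> R * R), open U -> open V ->
  (forall p, V p -> U (g p)) -> Ck k U f -> (forall j, Ck k V (fun z => coord j (g z))) ->
  Ck k V (fun z => f (g z)).
Proof.
induction k as [|k IH]; intros U V f g HU HV HUV Hf Hg.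
- split; auto. intros p Hp. apply (continuous_comp g f).
  + apply (continuous_ext (fun z => (fst (g z), snd (g z)))).
    { intros z; now destruct (g z). }
    apply (continuous_comp_2 (fun z => fst (g z)) (fun z => snd (g z)) (fun u v => (u, v))).
    * exact (Ck_continuous 0 V _ p (Hg I1) Hp).
    * exact (Ck_continuous 0 V _ p (Hg I2) Hp).
    * apply (continuous_ext (fun z => z)); [now intros [? ?] | apply continuous_id].
  + apply (Ck_continuous 0 U); auto.
- apply (Ck_S_intro k V _ (fun i z => Sum (fun j => pd j f (g z) *
    pd i (fun z => coord j (g z)) z))); auto.
  + intros i p Hp. apply (is_pd_comp k U); auto.
    intros j. eapply Ck_is_pd; eauto.
  + intros i. unfold Sum. apply Ck_plus; auto; apply Ck_mult; auto;
      solve [ apply Ck_pd; auto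
            | apply (IH U); auto; [now apply Ck_pd | intros j; now apply Ck_pred]].
Qed.

Lemma smooth_comp U V f (g : R * R -> R * R) : open U -> open V ->
  (forall p, V p -> U (g p)) -> smooth U f -> (forall j, smooth V (fun z => coord j (g z))) ->
  smooth V (fun z => f (g z)).
Proof. intros HU HV H Hf Hg k. apply (Ck_comp k U V f g); auto. intros j; apply Hg. Qed.

Lemma pd_comp U V f (g : R * R -> R * R) i p : open U -> smooth U f -> U (g p) ->
  V p -> (forall j, smooth V (fun z => coord j (g z))) ->
  pd i (fun z => f (g z)) p = Sum (fun j => pd j f (g p) * jac g p j i).
Proof.
intros HU Hf Hp HV Hg. apply is_pd_unique. apply (is_pd_comp 0 U); auto.
intros j. apply (smooth_is_pd V); auto.
Qed.

(** * Orthonormal coframes and curvature *)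

Definition contract (a v : vec) : R := Sum (fun i => a i * v i).

Definition wedge (a b : lfield) (x : R * R) : R :=
  a x I1 * b x I2 - a x I2 * b x I1.

(** The exterior derivative of the 1-form [a], evaluated on the coordinate
    fields. *)
Definition curl (a : lfield) (x : R * R) : R :=
  pd I1 (fun z => a z I2) x - pd I2 (fun z => a z I1) x.

Record coframe (U : R * R -> Prop) (h : lmetric) (a b : lfield) : Prop := {
  coframe_open : open U;
  coframe_smooth1 : forall i, smooth U (fun x => a x i);
  coframe_smooth2 : forall i, smooth U (fun x => b x i);
  coframe_metric : forall x i j, U x -> h x i j = a x i * a x j + b x i * b x j;
  coframe_wedge : forall x, U x -> wedge a b x <> 0
}.

(** The Levi-Civita connection form [w], determined by [da = w ^ b] and
    [db = - w ^ a]. *)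
Definition connection (a b : lfield) (x : R * R) (i : ix) : R :=
  (curl a x * a x i + curl b x * b x i) / wedge a b x.

Section Coframe.
Variables (U : R * R -> Prop) (h : lmetric) (a b : lfield).
Hypothesis HF : coframe U h a b.

Let HU := coframe_open _ _ _ _ HF.
Let Ha := coframe_smooth1 _ _ _ _ HF.
Let Hb := coframe_smooth2 _ _ _ _ HF.

Lemma coframe_pd_metric x i j l : U x ->
  pd i (fun z => h z j l) x =
  pd i (fun z => a z j) x * a x l + a x j * pd i (fun z => a z l) x +
  (pd i (fun z => b z j) x * b x l + b x j * pd i (fun z => b z l) x).
Proof.
intros Hx. apply is_pd_unique.
apply (is_pd_ext_loc i U (fun z => a z j * a z l + b z j * b z l)); auto.
- intros z Hz. symmetry. now apply (coframe_metric _ _ _ _ HF).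
- apply is_pd_plus; apply is_pd_mult; now apply (smooth_is_pd U).
Qed.

Lemma coframe_det x : U x -> det h x = wedge a b x ^ 2.
Proof.
intros Hx. unfold det, wedge. rewrite !(coframe_metric _ _ _ _ HF) by auto. ring.
Qed.

(** The Koszul formula in the coframe. For each pair of indices it is an identity
    between rational functions of the coefficients of the two forms and of their
    first partials. *)
Lemma christoffel_coframe x i j : U x ->
  contract (a x) (fun k => christoffel h x k i j) =
    pd i (fun z => a z j) x - connection a b x i * b x j /\
  contract (b x) (fun k => christoffel h x k i j) =
    pd i (fun z => b z j) x + connection a b x i * a x j.
Proof.
intros Hx. pose proof (coframe_wedge _ _ _ _ HF x Hx) as Hw.
unfold contract, christoffel, connection, curl, Sum.
rewrite !(fun i j l => coframe_pd_metric x i j l Hx).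
unfold inv. rewrite (coframe_det x Hx).
rewrite !(fun i j => coframe_metric _ _ _ _ HF x i j Hx).
unfold wedge in *.
destruct i, j; split; field; exact Hw.
Qed.

(** Cartan's first structure equation: in the frame dual to [a], [b], covariant
    differentiation is ordinary differentiation of components plus the rotation
    by the connection form. *)
Lemma cov_coframe (X Y : lfield) x : U x ->
  (forall k i, ex_pd i (fun z => Y z k) x) ->
  contract (a x) (cov h X Y x) =
    Sum (fun i => X x i * pd i (fun z => contract (a z) (Y z)) x)
    - contract (connection a b x) (X x) * contract (b x) (Y x) /\
  contract (b x) (cov h X Y x) =
    Sum (fun i => X x i * pd i (fun z => contract (b z) (Y z)) x)
    + contract (connection a b x) (X x) * contract (a x) (Y x).
Proof.
intros Hx HY.
assert (P : forall (c : lfield), (forall i, smooth U (fun x => c x i)) -> forall i,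
  pd i (fun z => contract (c z) (Y z)) x =
  Sum (fun j => pd i (fun z => c z j) x * Y x j + c x j * pd i (fun z => Y z j) x)).
{ intros c Hc i. apply is_pd_unique. unfold contract, Sum.
  apply is_pd_plus; apply is_pd_mult;
    solve [now apply (smooth_is_pd U) | now apply ex_pd_is]. }
unfold Sum at 1 2.
rewrite (P a Ha I1), (P a Ha I2), (P b Hb I1), (P b Hb I2).
destruct (christoffel_coframe x I1 I1 Hx) as [A11 B11].
destruct (christoffel_coframe x I1 I2 Hx) as [A12 B12].
destruct (christoffel_coframe x I2 I1 Hx) as [A21 B21].
destruct (christoffel_coframe x I2 I2 Hx) as [A22 B22].
unfold contract, cov, Sum in *.
split.
- replace (a x I1 * _ + a x I2 * _) with
   (a x I1 * (X x I1 * pd I1 (fun z => Y z I1) x + X x I2 * pd I2 (fun z => Y z I1) x) +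
    a x I2 * (X x I1 * pd I1 (fun z => Y z I2) x + X x I2 * pd I2 (fun z => Y z I2) x) +
    ((a x I1 * christoffel h x I1 I1 I1 + a x I2 * christoffel h x I2 I1 I1) * X x I1 * Y x I1
    + (a x I1 * christoffel h x I1 I1 I2 + a x I2 * christoffel h x I2 I1 I2) * X x I1 * Y x I2
    + (a x I1 * christoffel h x I1 I2 I1 + a x I2 * christoffel h x I2 I2 I1) * X x I2 * Y x I1
    + (a x I1 * christoffel h x I1 I2 I2 + a x I2 * christoffel h x I2 I2 I2) * X x I2 * Y x I2))
   by ring.
  rewrite A11, A12, A21, A22. ring.
- replace (b x I1 * _ + b x I2 * _) with
   (b x I1 * (X x I1 * pd I1 (fun z => Y z I1) x + X x I2 * pd I2 (fun z => Y z I1) x) +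
    b x I2 * (X x I1 * pd I1 (fun z => Y z I2) x + X x I2 * pd I2 (fun z => Y z I2) x) +
    ((b x I1 * christoffel h x I1 I1 I1 + b x I2 * christoffel h x I2 I1 I1) * X x I1 * Y x I1
    + (b x I1 * christoffel h x I1 I1 I2 + b x I2 * christoffel h x I2 I1 I2) * X x I1 * Y x I2
    + (b x I1 * christoffel h x I1 I2 I1 + b x I2 * christoffel h x I2 I2 I1) * X x I2 * Y x I1
    + (b x I1 * christoffel h x I1 I2 I2 + b x I2 * christoffel h x I2 I2 I2) * X x I2 * Y x I2))
   by ring.
  rewrite B11, B12, B21, B22. ring.
Qed.

Lemma contract_determines x (v : vec) : U x ->
  v I1 = (b x I2 * contract (a x) v - a x I2 * contract (b x) v) / wedge a b x /\
  v I2 = (a x I1 * contract (b x) v - b x I1 * contract (a x) v) / wedge a b x.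
Proof.
intros Hx. pose proof (coframe_wedge _ _ _ _ HF x Hx) as Hw.
unfold contract, Sum, wedge in *. split; field; exact Hw.
Qed.

Lemma coframe_dot x v w : U x ->
  dot h x v w = contract (a x) v * contract (a x) w + contract (b x) v * contract (b x) w.
Proof.
intros Hx. unfold dot, contract, Sum. rewrite !(coframe_metric _ _ _ _ HF) by auto. ring.
Qed.

Lemma smooth_wedge : smooth U (wedge a b).
Proof. unfold wedge. smooth_tac. Qed.

Lemma smooth_curl2 : smooth U (curl b).
Proof. unfold curl. apply smooth_minus; auto; apply smooth_pd; apply Hb. Qed.

(** The second structure equation for a coframe whose first form is closed.
    Then [db = m a ^ b], the connection form is [m b], and its exterior
    derivative gives the curvature as minus the derivative of [m] along the
    vector dual to [a], minus [m^2]: the Riccati equation. *)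
Lemma gauss_coframe (m : R * R -> R) x :
  (forall z, U z -> curl a z = 0) ->
  (forall z, U z -> curl b z = m z * wedge a b z) ->
  smooth U m -> U x ->
  gauss h x =
    - ((b x I2 * pd I1 m x - b x I1 * pd I2 m x) / wedge a b x + m x ^ 2).
Proof.
intros Hca Hcb Hm Hx.
assert (Hw := coframe_wedge _ _ _ _ HF).
assert (HC : forall z i, U z -> connection a b z i = m z * b z i).
{ intros z i Hz. unfold connection. rewrite Hca, Hcb by auto. field. now apply Hw. }
assert (Cd : forall (j : ix) (f : R * R -> vec) z, contract (f z) (basis j) = f z j).
{ intros j f z. unfold contract, Sum, basis. destruct j; simpl; ring. }
(* coordinate fields have constant components, so only the forms are differentiated *)
assert (Pa : forall i j z, U z -> contract (a z) (cov h (fun _ => basis i) (fun _ => basis j) z)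
   = pd i (fun y => a y j) z - m z * b z i * b z j).
{ intros i j z Hz.
  destruct (cov_coframe (fun _ => basis i) (fun _ => basis j) z Hz) as [E _].
  { intros k l. eexists; apply is_pd_const. }
  rewrite E, !Cd, (HC z i Hz). f_equal.
  rewrite (functional_extensionality (fun z => contract (a z) (basis j)) (fun z => a z j))
    by (intros; apply Cd).
  unfold Sum, basis; destruct i; simpl; ring. }
assert (Pb : forall i j z, U z -> contract (b z) (cov h (fun _ => basis i) (fun _ => basis j) z)
   = pd i (fun y => b y j) z + m z * b z i * a z j).
{ intros i j z Hz.
  destruct (cov_coframe (fun _ => basis i) (fun _ => basis j) z Hz) as [_ E].
  { intros k l. eexists; apply is_pd_const. }
  rewrite E, !Cd, (HC z i Hz). f_equal.
  rewrite (functional_extensionality (fun z => contract (b z) (basis j)) (fun z => b z j))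
    by (intros; apply Cd).
  unfold Sum, basis; destruct i; simpl; ring. }
assert (Da : forall i j k, is_pd k
   (fun z => contract (a z) (cov h (fun _ => basis i) (fun _ => basis j) z)) x
   (pd k (pd i (fun y => a y j)) x -
    ((pd k m x * b x i + m x * pd k (fun z => b z i) x) * b x j
      + m x * b x i * pd k (fun z => b z j) x))).
{ intros i j k.
  apply (is_pd_ext_loc k U (fun z => pd i (fun y => a y j) z - m z * b z i * b z j)); auto.
  - intros z Hz. symmetry; now apply Pa.
  - apply is_pd_minus; [|apply is_pd_mult; [apply is_pd_mult|]];
      apply (smooth_is_pd U); auto; smooth_tac. }
assert (Db : forall i j k, is_pd k
   (fun z => contract (b z) (cov h (fun _ => basis i) (fun _ => basis j) z)) x
   (pd k (pd i (fun y => b y j)) x +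
    ((pd k m x * b x i + m x * pd k (fun z => b z i) x) * a x j
      + m x * b x i * pd k (fun z => a z j) x))).
{ intros i j k.
  apply (is_pd_ext_loc k U (fun z => pd i (fun y => b y j) z + m z * b z i * a z j)); auto.
  - intros z Hz. symmetry; now apply Pb.
  - apply is_pd_plus; [|apply is_pd_mult; [apply is_pd_mult|]];
      apply (smooth_is_pd U); auto; smooth_tac. }
assert (Ex : forall i j k l,
  ex_pd l (fun z => cov h (fun _ => basis i) (fun _ => basis j) z k) x).
{ intros i j k l.
  assert (S : smooth U (fun z => cov h (fun _ => basis i) (fun _ => basis j) z k)).
  { destruct k.
    - apply (smooth_ext U (fun z => (b z I2 * (pd i (fun y => a y j) z - m z * b z i * b z j)
        - a z I2 * (pd i (fun y => b y j) z + m z * b z i * a z j)) / wedge a b z)); auto.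
      + intros z Hz. rewrite <- (Pa i j z Hz), <- (Pb i j z Hz). symmetry.
        now apply contract_determines.
      + apply smooth_div; auto; [smooth_tac | apply smooth_wedge].
    - apply (smooth_ext U (fun z => (a z I1 * (pd i (fun y => b y j) z + m z * b z i * a z j)
        - b z I1 * (pd i (fun y => a y j) z - m z * b z i * b z j)) / wedge a b z)); auto.
      + intros z Hz. rewrite <- (Pa i j z Hz), <- (Pb i j z Hz). symmetry.
        now apply contract_determines.
      + apply smooth_div; auto; [smooth_tac | apply smooth_wedge]. }
  exact (is_pd_ex _ _ _ _ (smooth_is_pd U _ l x S Hx)). }
unfold gauss. cbv zeta. rewrite (coframe_dot x _ _ Hx), (coframe_det x Hx), !Cd.
assert (L : forall c : vec, forall v w : vec,
  contract c (fun k => v k - w k) = contract c v - contract c w)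
  by (intros; unfold contract, Sum; ring).
rewrite !L.
destruct (cov_coframe (fun _ => basis I1) (cov h (fun _ => basis I2) (fun _ => basis I2)) x Hx)
  as [E1 E2]; [intros; apply Ex|].
destruct (cov_coframe (fun _ => basis I2) (cov h (fun _ => basis I1) (fun _ => basis I2)) x Hx)
  as [E3 E4]; [intros; apply Ex|].
rewrite E1, E2, E3, E4. clear E1 E2 E3 E4.
rewrite !(fun i => Cd i (connection a b) x), !(fun i => HC x i Hx), !(fun i j => Pa i j x Hx),
  !(fun i j => Pb i j x Hx).
unfold Sum at 1 2 3 4.
rewrite !(fun i j k => is_pd_unique _ _ _ _ (Da i j k)),
  !(fun i j k => is_pd_unique _ _ _ _ (Db i j k)).
rewrite (smooth_schwarz U (fun y => a y I2) x HU (Ha I2) Hx),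
  (smooth_schwarz U (fun y => b y I2) x HU (Hb I2) Hx).
specialize (Hca x Hx). specialize (Hcb x Hx). specialize (Hw x Hx).
unfold curl, basis in *. unfold wedge in *. simpl.
revert Hca Hcb Hw.
generalize (a x I1) (a x I2) (b x I1) (b x I2) (m x) (pd I1 m x) (pd I2 m x)
  (pd I2 (pd I1 (fun y => a y I2)) x) (pd I2 (pd I1 (fun y => b y I2)) x)
  (pd I1 (pd I1 (fun y => b y I2)) x) (pd I2 (pd I2 (fun y => b y I2)) x)
  (pd I1 (pd I1 (fun y => a y I2)) x) (pd I2 (pd I2 (fun y => a y I2)) x).
generalize (pd I1 (fun z => a z I1) x) (pd I1 (fun z => a z I2) x)
  (pd I2 (fun z => a z I1) x) (pd I2 (fun z => a z I2) x)
  (pd I1 (fun z => b z I1) x) (pd I1 (fun z => b z I2) x)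
  (pd I2 (fun z => b z I1) x) (pd I2 (fun z => b z I2) x).
intros a11 a12 a21 a22 b11 b12 b21 b22 a1 a2 b1 b2 M M1 M2 s1 s2 s3 s4 s5 s6 Hca Hcb Hw.
replace a12 with a21 by lra.
replace b12 with (b21 + M * (a1 * b2 - a2 * b1)) by lra.
field. exact Hw.
Qed.

End Coframe.

(** * The image of a unit geodesic field *)

(** In such a coframe a unit geodesic field is described by a single function,
    the divergence defined below. *)
Record adapted (U : R * R -> Prop) (h : lmetric) (xi a b : lfield) : Prop := {
  adapted_coframe : coframe U h a b;
  adapted_smooth : forall i, smooth U (fun x => xi x i);
  adapted_dual1 : forall x, U x -> contract (a x) (xi x) = 1;
  adapted_dual2 : forall x, U x -> contract (b x) (xi x) = 0
}.

(** The number [m] with [nabla_X xi = m b(X) e2], which is the divergence of a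
    geodesic field and the geodesic curvature of its orthogonal trajectories. *)
Definition divergence (a b : lfield) (x : R * R) : R := curl b x / wedge a b x.

Section Adapted.
Variables (U : R * R -> Prop) (h : lmetric) (xi a b : lfield).
Hypothesis HA : adapted U h xi a b.
Hypothesis Hgeo : forall x k, U x -> cov h xi xi x k = 0.

Let HF := adapted_coframe _ _ _ _ _ HA.
Let HU := coframe_open _ _ _ _ HF.
Let Ha := coframe_smooth1 _ _ _ _ HF.
Let Hb := coframe_smooth2 _ _ _ _ HF.
Let Hw := coframe_wedge _ _ _ _ HF.
Let Hxi := adapted_smooth _ _ _ _ _ HA.
Let m := divergence a b.

Lemma smooth_divergence : smooth U m.
Proof.
apply smooth_div; auto.
- exact (smooth_curl2 _ _ _ _ HF).
- exact (smooth_wedge _ _ _ _ HF).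
Qed.

Lemma curl_divergence x : U x -> curl b x = m x * wedge a b x.
Proof. intros Hx. unfold m, divergence. field. now apply Hw. Qed.

Lemma ex_pd_field x k i : U x -> ex_pd i (fun z => xi z k) x.
Proof. intros Hx. exact (is_pd_ex _ _ _ _ (smooth_is_pd U _ i x (Hxi k) Hx)). Qed.

Lemma pd_dual1 i x : U x -> pd i (fun z => contract (a z) (xi z)) x = 0.
Proof.
intros Hx. rewrite (pd_ext_loc i U _ (fun _ => 1) x HU Hx (adapted_dual1 _ _ _ _ _ HA)).
apply is_pd_unique, is_pd_const.
Qed.

Lemma pd_dual2 i x : U x -> pd i (fun z => contract (b z) (xi z)) x = 0.
Proof.
intros Hx. rewrite (pd_ext_loc i U _ (fun _ => 0) x HU Hx (adapted_dual2 _ _ _ _ _ HA)).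
apply is_pd_unique, is_pd_const.
Qed.

(** The acceleration of [xi] is the value on [xi] of the connection form, and
    this value is the factor of [da]. *)
Lemma adapted_closed x : U x -> curl a x = 0.
Proof.
intros Hx.
destruct (cov_coframe U h a b HF xi xi x Hx) as [_ E].
{ intros k i. now apply ex_pd_field. }
unfold contract at 1 in E. unfold Sum at 1 2 in E.
rewrite !Hgeo, !pd_dual2 in E by auto.
rewrite (adapted_dual1 _ _ _ _ _ HA x Hx) in E.
assert (E' : contract (connection a b x) (xi x) =
  (curl a x * contract (a x) (xi x) + curl b x * contract (b x) (xi x)) / wedge a b x).
{ unfold connection, contract, Sum. field. now apply Hw. }
rewrite E', (adapted_dual1 _ _ _ _ _ HA x Hx), (adapted_dual2 _ _ _ _ _ HA x Hx) in E.
replace (curl a x) with ((curl a x * 1 + curl b x * 0) / wedge a b x * wedge a b x)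
  by (field; now apply Hw).
replace ((curl a x * 1 + curl b x * 0) / wedge a b x) with 0 by lra. ring.
Qed.

Lemma adapted_connection x i : U x -> connection a b x i = m x * b x i.
Proof.
intros Hx. unfold connection. rewrite adapted_closed, curl_divergence by auto.
field. now apply Hw.
Qed.

Lemma vpart_dsection x i k :
  vpart h x (xi x) (dsection xi x i) k = cov h (fun _ => basis i) xi x k.
Proof. unfold vpart, dsection, cov, Sum, basis. destruct i; simpl; ring. Qed.

(** A unit field turns only orthogonally to itself, and a geodesic one does not
    turn along its own trajectories; what is left is [m b(X)]. *)
Lemma cov_adapted x l : U x ->
  contract (a x) (cov h (fun _ => basis l) xi x) = 0 /\
  contract (b x) (cov h (fun _ => basis l) xi x) = m x * b x l.
Proof.
intros Hx.
destruct (cov_coframe U h a b HF (fun _ => basis l) xi x Hx) as [E1 E2].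
{ intros k i'. now apply ex_pd_field. }
unfold Sum in E1, E2. rewrite !pd_dual1 in E1 by auto. rewrite !pd_dual2 in E2 by auto.
rewrite (adapted_dual2 _ _ _ _ _ HA x Hx) in E1.
rewrite (adapted_dual1 _ _ _ _ _ HA x Hx) in E2.
assert (E3 : contract (connection a b x) (basis l) = m x * b x l).
{ rewrite <- (adapted_connection x l Hx). unfold contract, Sum, basis. destruct l; simpl; ring. }
rewrite E3 in E2. split; lra.
Qed.

Lemma section_adapted x i j : U x ->
  lsection h xi x i j = a x i * a x j + (1 + m x ^ 2) * (b x i * b x j).
Proof.
intros Hx. unfold lsection, sasaki.
rewrite !(coframe_dot U h a b HF) by auto.
rewrite !(fun l => functional_extensionality _ _ (vpart_dsection x l)).
destruct (cov_adapted x i Hx) as [V1 V2], (cov_adapted x j Hx) as [V3 V4].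
rewrite V1, V2, V3, V4.
assert (B : forall c l, contract c (hpart (dsection xi x l)) = c l).
{ intros c l. unfold contract, Sum, hpart, dsection, basis. destruct l; simpl; ring. }
rewrite !B. ring.
Qed.

(** Differentiation along [xi], whose components are [(b_2, - b_1) / (a ^ b)]. *)
Let along (f : R * R -> R) (x : R * R) : R :=
  (b x I2 * pd I1 f x - b x I1 * pd I2 f x) / wedge a b x.

Lemma along_comp1 f (phi : R -> R) d x : smooth U f -> U x -> is_derive phi (f x) d ->
  along (fun z => phi (f z)) x = d * along f x.
Proof.
intros Hf Hx Hd. unfold along.
rewrite !(fun i => is_pd_unique i _ x _
  (is_pd_comp1 i phi f x _ d (smooth_is_pd U f i x Hf Hx) Hd)).
field. now apply Hw.
Qed.

Lemma along_locally_constant f (c : R) x : (forall z, U z -> f z = c) -> U x ->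
  along f x = 0.
Proof.
intros Hf Hx. unfold along.
rewrite !(fun i => pd_ext_loc i U f (fun _ => c) x HU Hx Hf).
rewrite !(fun i => is_pd_unique i _ x _ (is_pd_const i c x)).
field. now apply Hw.
Qed.

Variable K : R.
Hypothesis HK : forall x, U x -> gauss h x = K.

Lemma riccati x : U x -> along m x = - (K + m x ^ 2).
Proof.
intros Hx. rewrite <- (HK x Hx).
rewrite (gauss_coframe U h a b HF m x); auto.
- unfold along. ring.
- exact adapted_closed.
- exact curl_divergence.
- exact smooth_divergence.
Qed.

(** On [xi(M)] the coframe becomes [a], [sqrt (1 + m^2) b]; the first form stays
    closed, so [gauss_coframe] applies again, and the Riccati equation removes
    the derivatives. *)
Lemma gauss_section x : U x ->
  gauss (lsection h xi) x = (1 - K) * (K - m x ^ 4) / (1 + m x ^ 2) ^ 2.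
Proof.
intros Hx.
assert (P : forall z, 0 < 1 + m z ^ 2) by (intros z; generalize (pow2_ge_0 (m z)); lra).
assert (Sm := smooth_divergence).
set (s := fun z => sqrt (1 + m z ^ 2)).
assert (Ps : forall z, 0 < s z) by (intros z; apply sqrt_lt_R0, P).
assert (Ss : forall z, s z * s z = 1 + m z ^ 2) by (intros z; apply sqrt_sqrt; generalize (P z); lra).
assert (Sms : smooth U s).
{ apply smooth_sqrt; auto. apply smooth_plus; auto; [apply smooth_const|].
  now apply smooth_pow. }
set (b' := fun z i => s z * b z i).
assert (W : forall z, wedge a b' z = s z * wedge a b z) by (intros; unfold wedge, b'; ring).
assert (HF' : coframe U (lsection h xi) a b').
{ split; auto.
  - intros i. apply smooth_mult; auto.
  - intros z i j Hz. rewrite section_adapted by auto. unfold b'. rewrite <- Ss. ring.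
  - intros z Hz. rewrite W. apply Rmult_integral_contrapositive. split; auto.
    apply Rgt_not_eq, Ps. }
set (m' := fun z => m z * (1 - K) / (1 + m z ^ 2)).
assert (Dphi : forall t, is_derive (fun t => t * (1 - K) / (1 + t ^ 2)) t
  ((1 - K) * (1 - t ^ 2) / (1 + t ^ 2) ^ 2)).
{ intros t. assert (0 < 1 + t ^ 2) by (generalize (pow2_ge_0 t); lra).
  auto_derive; [lra|]. field. lra. }
assert (Sm' : smooth U m').
{ apply smooth_div; auto.
  - apply smooth_mult; auto. apply smooth_const.
  - apply smooth_plus; auto; [apply smooth_const | now apply smooth_pow].
  - intros z _. apply Rgt_not_eq, P. }
rewrite (gauss_coframe U (lsection h xi) a b' HF' m' x); auto.
- replace ((b' x I2 * pd I1 m' x - b' x I1 * pd I2 m' x) / wedge a b' x) with (along m' x).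
  + unfold m' at 1.
    rewrite (along_comp1 m (fun t => t * (1 - K) / (1 + t ^ 2)) _ x Sm Hx (Dphi (m x))).
    rewrite riccati by auto. unfold m'. field. apply Rgt_not_eq, P.
  + unfold along. rewrite W. unfold b'. field. split; [now apply Hw|].
    apply Rgt_not_eq, Ps.
- exact adapted_closed.
- intros z Hz.
  assert (Ds : is_derive (fun t => sqrt (1 + t ^ 2)) (m z) (m z / s z)).
  { specialize (P z). specialize (Ps z). unfold s in *. auto_derive; [lra|].
    replace (1 + m z * (m z * 1)) with (1 + m z ^ 2) by ring. field. lra. }
  assert (As := along_comp1 m (fun t => sqrt (1 + t ^ 2)) _ z Sm Hz Ds).
  rewrite riccati in As by auto. fold s in As.
  assert (C : curl b' z = along s z * wedge a b z + s z * curl b z).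
  { unfold curl, along, b'.
    rewrite !(fun i j => is_pd_unique i _ z _ (is_pd_mult i s (fun y => b y j) z _ _
      (smooth_is_pd U s i z Sms Hz) (smooth_is_pd U _ i z (Hb j) Hz))).
    field. now apply Hw. }
  rewrite C, W, As, curl_divergence by auto. unfold m'.
  specialize (Ps z). specialize (Ss z). specialize (P z).
  apply (Rmult_eq_reg_l (s z)); [|lra].
  replace (s z * (m z / s z * - (K + m z ^ 2) * wedge a b z + s z * (m z * wedge a b z)))
    with ((- m z * (K + m z ^ 2) + (s z * s z) * m z) * wedge a b z) by (field; lra).
  replace (s z * (m z * (1 - K) / (1 + m z ^ 2) * (s z * wedge a b z)))
    with ((s z * s z) * (m z * (1 - K) / (1 + m z ^ 2)) * wedge a b z) by (field; lra).
  rewrite Ss. field. lra.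
Qed.

(** If the curvature of the image is constant and [K <> 1], differentiating it
    along [xi] gives [m (m^2 + K) = 0], and differentiating this once more leaves only the
    equilibria [m^2 = - K] of the Riccati equation. *)
Lemma equilibrium kappa x : K <> 1 ->
  (forall z, U z -> gauss (lsection h xi) z = kappa) -> U x -> m x ^ 2 = - K.
Proof.
intros HK1 Hk Hx. assert (Sm := smooth_divergence).
assert (E1 : forall z, U z -> m z * (m z ^ 2 + K) = 0).
{ intros z Hz.
  assert (P : 0 < 1 + m z ^ 2) by (generalize (pow2_ge_0 (m z)); lra).
  assert (D : is_derive (fun t => (1 - K) * (K - t ^ 4) / (1 + t ^ 2) ^ 2) (m z)
    (- (4) * (1 - K) * m z * (m z ^ 2 + K) / (1 + m z ^ 2) ^ 3)).
  { auto_derive; [|field; lra].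
    apply Rgt_not_eq. simpl in P |- *. nra. }
  assert (A := along_comp1 m _ _ z Sm Hz D).
  rewrite (along_locally_constant _ kappa) in A; auto.
  2: { intros y Hy. rewrite <- (Hk y Hy). symmetry. now apply gauss_section. }
  rewrite riccati in A by auto.
  assert (A' : 4 * (1 - K) * (m z * (m z ^ 2 + K) ^ 2) = 0).
  { replace (4 * (1 - K) * (m z * (m z ^ 2 + K) ^ 2)) with
     (- (4) * (1 - K) * m z * (m z ^ 2 + K) / (1 + m z ^ 2) ^ 3 * - (K + m z ^ 2) * (1 + m z ^ 2) ^ 3)
     by (field; lra).
    rewrite <- A. ring. }
  apply Rmult_integral in A'. destruct A' as [A'|A']; [lra|].
  apply Rmult_integral in A'. destruct A' as [A'|A']; [rewrite A'; ring|].
  replace (m z ^ 2 + K) with 0; [ring|]. nra. }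
assert (D : is_derive (fun t => t * (t ^ 2 + K)) (m x) (3 * m x ^ 2 + K)).
{ auto_derive; auto. ring. }
assert (A := along_comp1 m _ _ x Sm Hx D).
rewrite (along_locally_constant _ 0) in A; auto.
rewrite riccati in A by auto.
assert (B := E1 x Hx). apply Rmult_integral in B. destruct B as [B|B]; [|lra].
rewrite B in *. nra.
Qed.

End Adapted.

(** * The coframe of a unit field *)

Definition dual_form (h : lmetric) (xi : lfield) : lfield := fun x i =>
  Sum (fun j => h x i j * xi x j).

(** The contraction of the area form with [xi]. *)
Definition normal_form (h : lmetric) (xi : lfield) : lfield := fun x i =>
  sqrt (det h x) * match i with I1 => - xi x I2 | I2 => xi x I1 end.

(** The metric is evaluated on the vector [(- g_12, g_11)], where it takes the
    value [g_11 det g]. *)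
Lemma metric_det_pos (M : surface) (g : metric M) a x : dom a x -> 0 < det (gcomp g a) x.
Proof.
intros Hx.
assert (S := metric_sym M g a x I1 I2 Hx).
assert (Q := metric_pos M g a x (basis I1) Hx
  (ex_intro _ I1 R1_neq_R0)).
assert (P := metric_pos M g a x
  (fun i => match i with I1 => - gcomp g a x I1 I2 | I2 => gcomp g a x I1 I1 end) Hx).
unfold dot, Sum, basis, det in *; simpl in *.
rewrite <- S in *.
assert (Q1 : 0 < gcomp g a x I1 I1) by lra.
specialize (P (ex_intro _ I2 (Rgt_not_eq _ _ Q1))).
apply (Rmult_lt_reg_l _ _ _ Q1). lra.
Qed.

(** That the two forms are orthonormal is Lagrange's identity
    [g(X, xi)^2 + area(xi, X)^2 = g(X, X) g(xi, xi)], polarized. *)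
Lemma unit_field_adapted (M : surface) (g : metric M) (xi : vfield M) a :
  unit_field g xi ->
  adapted (dom a) (gcomp g a) (xi a) (dual_form (gcomp g a) (xi a))
    (normal_form (gcomp g a) (xi a)).
Proof.
intros Hu.
assert (HU := dom_open M a).
assert (Hg := metric_smooth M g a).
assert (Hxi := vfield_smooth M xi a).
assert (HD := metric_det_pos M g a).
assert (Hs := fun x Hx => sqrt_sqrt _ (Rlt_le _ _ (HD x Hx))).
assert (Sd : smooth (dom a) (fun x => sqrt (det (gcomp g a) x))).
{ apply smooth_sqrt; auto. unfold det. smooth_tac. }
split.
- split; auto.
  + intros i. unfold dual_form. smooth_tac; auto.
  + intros i. unfold normal_form. apply smooth_mult; auto.
    destruct i; [apply smooth_opp|]; auto.
  + intros x i j Hx. specialize (Hu a x Hx). specialize (Hs x Hx).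
    assert (S := metric_sym M g a x I1 I2 Hx).
    unfold dual_form, normal_form.
    replace (sqrt (det (gcomp g a) x) * _ * (sqrt (det (gcomp g a) x) * _)) with
      (sqrt (det (gcomp g a) x) * sqrt (det (gcomp g a) x) *
       (match i with I1 => - xi a x I2 | I2 => xi a x I1 end *
        match j with I1 => - xi a x I2 | I2 => xi a x I1 end)) by ring.
    rewrite Hs. unfold det, dot, Sum in *. rewrite <- S in *.
    transitivity (gcomp g a x i j * (gcomp g a x I1 I1 * xi a x I1 * xi a x I1 +
      gcomp g a x I1 I2 * xi a x I1 * xi a x I2 +
      (gcomp g a x I1 I2 * xi a x I2 * xi a x I1 + gcomp g a x I2 I2 * xi a x I2 * xi a x I2))).
    * rewrite Hu. ring.
    * destruct i, j; rewrite <- ?S; ring.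
  + intros x Hx. specialize (Hu a x Hx). specialize (HD x Hx).
    replace (wedge _ _ x) with (sqrt (det (gcomp g a) x) * dot (gcomp g a) x (xi a x) (xi a x)).
    * rewrite Hu. apply Rgt_not_eq. rewrite Rmult_1_r. now apply sqrt_lt_R0.
    * unfold wedge, dual_form, normal_form, dot, Sum. ring.
- auto.
- intros x Hx. rewrite <- (Hu a x Hx). unfold contract, dual_form, dot, Sum. ring.
- intros x Hx. unfold contract, normal_form, Sum. ring.
Qed.

(** The first form of an adapted coframe is intrinsic, and so is [b b = h - a a];
    only the sign of [b] is a choice. *)
Lemma adapted_dual_form U h xi a b x i : adapted U h xi a b -> U x ->
  dual_form h xi x i = a x i.
Proof.
intros HA Hx. unfold dual_form, Sum.
rewrite !(coframe_metric _ _ _ _ (adapted_coframe _ _ _ _ _ HA)) by auto.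
transitivity (a x i * contract (a x) (xi x) + b x i * contract (b x) (xi x)).
- unfold contract, Sum. ring.
- rewrite (adapted_dual1 _ _ _ _ _ HA x Hx), (adapted_dual2 _ _ _ _ _ HA x Hx). ring.
Qed.

(** * Analysis on squares of the plane *)

Definition dist_max (z w : R * R) : R :=
  Rmax (Rabs (fst z - fst w)) (Rabs (snd z - snd w)).

Definition square (p : R * R) (r : R) (z : R * R) : Prop := dist_max z p < r.

Lemma square_coords p r z : square p r z <->
  Rabs (fst z - fst p) < r /\ Rabs (snd z - snd p) < r.
Proof.
unfold square, dist_max. split.
- intros H. split; eapply Rle_lt_trans; [apply Rmax_l | exact H | apply Rmax_r | exact H].
- intros [H1 H2]. now apply Rmax_lub_lt.
Qed.

Lemma dist_max_coord z w i : Rabs (coord i z - coord i w) <= dist_max z w.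
Proof. destruct i; [apply Rmax_l | apply Rmax_r]. Qed.

Lemma dist_max_lub z w r : (forall i, Rabs (coord i z - coord i w) <= r) ->
  dist_max z w <= r.
Proof. intros H. apply Rmax_lub; [exact (H I1) | exact (H I2)]. Qed.

Lemma dist_max_pos z w : 0 <= dist_max z w.
Proof. eapply Rle_trans; [apply Rabs_pos | apply (dist_max_coord z w I1)]. Qed.

Lemma dist_max_refl z : dist_max z z = 0.
Proof. unfold dist_max. rewrite !Rminus_diag, Rabs_R0. now apply Rmax_left. Qed.

Lemma dist_max_sym z w : dist_max z w = dist_max w z.
Proof. unfold dist_max. f_equal; apply Rabs_minus_sym. Qed.

Lemma dist_max_triangle z w y : dist_max z y <= dist_max z w + dist_max w y.
Proof.
apply dist_max_lub. intros i.
replace (coord i z - coord i y) with ((coord i z - coord i w) + (coord i w - coord i y)) by ring.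
eapply Rle_trans; [apply Rabs_triang|].
apply Rplus_le_compat; apply dist_max_coord.
Qed.

Lemma square_center p r : 0 < r -> square p r p.
Proof. intros H. unfold square. now rewrite dist_max_refl. Qed.

Lemma locally_square p (P : R * R -> Prop) :
  locally p P <-> exists r, 0 < r /\ forall z, square p r z -> P z.
Proof.
split.
- intros [e He]. exists e. split; [apply cond_pos|]. intros z Hz. apply He.
  apply square_coords in Hz. exact Hz.
- intros [r [Hr H]]. exists (mkposreal r Hr). intros z Hz. apply H.
  apply square_coords. exact Hz.
Qed.

Lemma square_open p r : open (square p r).
Proof.
intros z Hz. apply locally_square. exists (r - dist_max z p).
split; [unfold square in Hz; lra|]. intros w Hw. unfold square in *.
generalize (dist_max_triangle w z p). lra.
Qed.

Lemma open_square (U : R * R -> Prop) p : open U -> U p ->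
  exists r, 0 < r /\ forall z, square p r z -> U z.
Proof. intros HU Hp. apply locally_square. exact (HU p Hp). Qed.

Lemma continuous_eps (f : R * R -> R) p eps : continuous f p -> 0 < eps ->
  locally p (fun z => Rabs (f z - f p) < eps).
Proof.
intros H He. apply (H (fun y => Rabs (y - f p) < eps)).
now exists (mkposreal eps He).
Qed.

Lemma open_preimage (U : R * R -> Prop) (f : R * R -> R) (D : R -> Prop) :
  open U -> (forall p, U p -> continuous f p) -> open D ->
  open (fun p => U p /\ D (f p)).
Proof.
intros HU Hf HD p [Hp HDp]. apply filter_and.
- exact (HU p Hp).
- exact (Hf p Hp D (HD _ HDp)).
Qed.

Lemma open_preimage2 (U : R * R -> Prop) (f : R * R -> R * R) (D : R * R -> Prop) :
  open U -> (forall i p, U p -> continuous (fun z => coord i (f z)) p) -> open D ->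
  open (fun p => U p /\ D (f p)).
Proof.
intros HU Hf HD p [Hp HDp]. apply filter_and; [exact (HU p Hp)|].
destruct (open_square D (f p) HD HDp) as [r [Hr HrD]].
generalize (filter_and _ _ (continuous_eps _ p r (Hf I1 p Hp) Hr)
  (continuous_eps _ p r (Hf I2 p Hp) Hr)).
apply filter_imp. intros z [H1 H2]. apply HrD, square_coords. now split.
Qed.

(** Moving first in one coordinate and then in the other stays in the square. *)
Lemma square_increment p r (f : R * R -> R) (d : ix -> R * R -> R) D z w :
  square p r z -> square p r w -> 
  (forall i y, square p r y -> is_pd i f y (d i y) /\ Rabs (d i y) <= D) ->
  Rabs (f z - f w) <= D * Rabs (fst z - fst w) + D * Rabs (snd z - snd w).
Proof.
intros Hz Hw Hd. apply square_coords in Hz, Hw.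
destruct z as [z1 z2], w as [w1 w2], p as [p1 p2]; simpl in *.
assert (B : forall c u v t, Rabs (u - c) < r -> Rabs (v - c) < r ->
  Rmin u v <= t <= Rmax u v -> Rabs (t - c) < r).
{ intros c u v t Hu Hv Ht. apply Rabs_def2 in Hu, Hv. apply Rabs_def1;
  revert Ht; unfold Rmin, Rmax; destruct (Rle_dec u v); lra. }
assert (E1 : Rabs (f (z1, z2) - f (w1, z2)) <= D * Rabs (z1 - w1)).
{ destruct (MVT_gen (fun t => f (t, z2)) w1 z1 (fun t => d I1 (t, z2))) as [c [Hc E]].
  - intros t Ht. apply (Hd I1 (t, z2)). apply square_coords; simpl. split; [|tauto].
    apply (B _ w1 z1); try tauto; lra.
  - intros t Ht. apply continuity_pt_filterlim.
    assert (Q : square (p1, p2) r (t, z2)).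
    { apply square_coords; simpl. split; [|tauto]. apply (B _ w1 z1); tauto. }
    apply (ex_derive_continuous (fun t => f (t, z2)) t).
    exists (d I1 (t, z2)). apply (Hd I1 (t, z2) Q).
  - rewrite E, Rabs_mult. apply Rmult_le_compat_r; [apply Rabs_pos|].
    apply (Hd I1). apply square_coords; simpl. split; [|tauto]. apply (B _ w1 z1); tauto. }
assert (E2 : Rabs (f (w1, z2) - f (w1, w2)) <= D * Rabs (z2 - w2)).
{ destruct (MVT_gen (fun t => f (w1, t)) w2 z2 (fun t => d I2 (w1, t))) as [c [Hc E]].
  - intros t Ht. apply (Hd I2 (w1, t)). apply square_coords; simpl. split; [tauto|].
    apply (B _ w2 z2); try tauto; lra.
  - intros t Ht. apply continuity_pt_filterlim.
    assert (Q : square (p1, p2) r (w1, t)).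
    { apply square_coords; simpl. split; [tauto|]. apply (B _ w2 z2); tauto. }
    apply (ex_derive_continuous (fun t => f (w1, t)) t).
    exists (d I2 (w1, t)). apply (Hd I2 (w1, t) Q).
  - rewrite E, Rabs_mult. apply Rmult_le_compat_r; [apply Rabs_pos|].
    apply (Hd I2). apply square_coords; simpl. split; [tauto|]. apply (B _ w2 z2); tauto. }
replace (f (z1, z2) - f (w1, w2)) with
  ((f (z1, z2) - f (w1, z2)) + (f (w1, z2) - f (w1, w2))) by ring.
eapply Rle_trans; [apply Rabs_triang|]. lra.
Qed.

Lemma square_constant p r (f : R * R -> R) z : square p r z ->
  (forall i y, square p r y -> is_pd i f y 0) -> f z = f p.
Proof.
intros Hz Hd.
assert (H := square_increment p r f (fun _ _ => 0) 0 z p Hz).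
assert (0 < r) by (generalize (dist_max_pos z p); unfold square in Hz; lra).
specialize (H (square_center p r H0)).
assert (E : Rabs (f z - f p) <= 0).
{ rewrite !Rmult_0_l, Rplus_0_l in H. apply H. intros i y Hy. split; auto.
  rewrite Rabs_R0. lra. }
generalize (Rabs_pos (f z - f p)). intros E'.
apply Rminus_diag_uniq. destruct (Req_dec (f z - f p) 0) as [|N]; auto.
apply Rabs_pos_lt in N. lra.
Qed.

(** The indicator function of one of two separating open sets would have
    vanishing derivative. *)
Lemma square_connected p r (A B : R * R -> Prop) : open A -> open B ->
  (forall z, square p r z -> A z \/ B z) -> (forall z, square p r z -> ~ (A z /\ B z)) ->
  (forall z, square p r z -> A z) \/ (forall z, square p r z -> B z).
Proof.
intros HA HB Hc Hd.
set (chi := fun z => if excluded_middle_informative (A z) then 1 else 0).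
assert (C : forall z, square p r z -> chi z = chi p).
{ intros z Hz. apply (square_constant p r); auto. intros i y Hy.
  set (U := fun u => square p r u /\ (if excluded_middle_informative (A y) then A u else B u)).
  assert (HU : open U).
  { apply open_and; [apply square_open|]. destruct (excluded_middle_informative (A y)); auto. }
  apply (is_pd_ext_loc i U (fun _ => chi y)); auto.
  - split; auto. destruct (excluded_middle_informative (A y)); auto.
    destruct (Hc y Hy); tauto.
  - intros u [Hu1 Hu2]. unfold chi.
    destruct (excluded_middle_informative (A y)), (excluded_middle_informative (A u)); auto.
    + tauto. + exfalso. apply (Hd u Hu1). tauto.
  - apply is_pd_const. }
unfold chi in C. destruct (excluded_middle_informative (A p)) as [Hp|Hp].
- left. intros z Hz. specialize (C z Hz).
  destruct (excluded_middle_informative (A z)); auto. lra.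
- right. intros z Hz. specialize (C z Hz).
  destruct (excluded_middle_informative (A z)); [lra|]. destruct (Hc z Hz); tauto.
Qed.

Lemma smooth_primitive (U : R * R -> Prop) (u : R * R -> R) (w : ix -> R * R -> R) :
  open U -> (forall i, smooth U (w i)) ->
  (forall i z, U z -> is_pd i u z (w i z)) -> smooth U u.
Proof.
intros HU Hw Hu k. apply Ck_pred. apply (Ck_S_intro k U u w); auto.
intros i; apply Hw.
Qed.

(** Poincare lemma: integrate along the two sides of a coordinate rectangle. *)
Lemma closed_form_exact p r (w : lfield) : 0 < r ->
  (forall i, smooth (square p r) (fun z => w z i)) ->
  (forall z, square p r z -> curl w z = 0) ->
  exists u, forall i z, square p r z -> is_pd i u z (w z i).
Proof.
intros Hr Hw Hc. destruct p as [x0 y0].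
assert (C : forall i x y, Rabs (x - x0) < r -> Rabs (y - y0) < r ->
  continuous (fun z => w z i) (x, y)).
{ intros i x y Hx Hy. apply (smooth_continuous (square (x0, y0) r)); auto.
  apply square_coords; now split. }
assert (B : forall c t b, Rabs (b - c) < r -> Rmin c b <= t <= Rmax c b -> Rabs (t - c) < r).
{ intros c t b Hb Ht. apply Rabs_def2 in Hb. apply Rabs_def1;
  revert Ht; unfold Rmin, Rmax; destruct (Rle_dec c b); lra. }
assert (N : forall c b, Rabs (b - c) < r -> locally b (fun t => Rabs (t - c) < r)).
{ intros c b Hb. assert (He : 0 < r - Rabs (b - c)) by lra.
  exists (mkposreal _ He). intros t Ht.
  unfold ball in Ht; simpl in Ht; unfold AbsRing_ball, abs, minus, plus, opp in Ht; simpl in Ht.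
  replace (t - c) with ((t + - b) + (b - c)) by ring.
  eapply Rle_lt_trans; [apply Rabs_triang|]. lra. }
set (F := fun x : R => (RInt (fun s => w (s, y0) I1) x0 x : R)).
set (G := fun x y => (RInt (fun t => w (x, t) I2) y0 y : R)).
assert (Z : Rabs (y0 - y0) < r) by (rewrite Rminus_diag, Rabs_R0; exact Hr).
assert (HF : forall x, Rabs (x - x0) < r -> is_derive F x (w (x, y0) I1)).
{ intros x Hx. apply (is_derive_RInt (fun s => w (s, y0) I1) F x0 x).
  - generalize (N x0 x Hx). apply filter_imp. intros b Hb.
    apply (RInt_correct (fun s => w (s, y0) I1)), ex_RInt_continuous.
    intros t Ht. exact (slice_continuous I1 _ (t, y0) (C I1 t y0 (B _ _ _ Hb Ht) Z)).
  - exact (slice_continuous I1 _ (x, y0) (C I1 x y0 Hx Z)). }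
assert (GI : forall x b, Rabs (x - x0) < r -> Rabs (b - y0) < r ->
  ex_RInt (V := R_NormedModule) (fun t => w (x, t) I2) y0 b).
{ intros x b Hx Hb. apply (ex_RInt_continuous (V := R_CompleteNormedModule)). intros t Ht.
  exact (slice_continuous I2 _ (x, t) (C I2 x t Hx (B _ _ _ Hb Ht))). }
assert (HG2 : forall x y, Rabs (x - x0) < r -> Rabs (y - y0) < r ->
  is_derive (fun y => G x y) y (w (x, y) I2)).
{ intros x y Hx Hy. apply (is_derive_RInt (fun t => w (x, t) I2) (G x) y0 y).
  - generalize (N y0 y Hy). apply filter_imp. intros b Hb.
    apply (RInt_correct (fun t => w (x, t) I2)). now apply GI.
  - exact (slice_continuous I2 _ (x, y) (C I2 x y Hx Hy)). }
assert (Q : forall x y, Rabs (x - x0) < r -> Rabs (y - y0) < r -> square (x0, y0) r (x, y)).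
{ intros x y Hx Hy. apply square_coords; now split. }
assert (HG1 : forall x y, Rabs (x - x0) < r -> Rabs (y - y0) < r ->
  is_derive (fun x => G x y) x (w (x, y) I1 - w (x, y0) I1)).
{ intros x y Hx Hy.
  assert (D1 : forall t, Rabs (t - y0) < r ->
    is_derive (fun t => w (x, t) I1) t (pd I2 (fun z => w z I1) (x, t))).
  { intros t Ht. exact (smooth_is_pd _ _ I2 _ (Hw I1) (Q x t Hx Ht)). }
  assert (E : RInt (fun t => Derive (fun u => w (u, t) I2) x) y0 y = w (x, y) I1 - w (x, y0) I1).
  { rewrite <- (RInt_Derive (fun t => w (x, t) I1)).
    - apply RInt_ext. intros t Ht.
      assert (Ht' : Rabs (t - y0) < r) by (apply (B y0 t y Hy); lra).
      assert (H := Hc (x, t) (Q x t Hx Ht')). unfold curl in H.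
      apply Rminus_diag_uniq in H. exact H.
    - intros t Ht. eexists. apply D1. exact (B y0 t y Hy Ht).
    - intros t Ht. assert (Ht' := B y0 t y Hy Ht).
      exact (slice_continuous I2 _ (x, t) (smooth_continuous _ _ _
        (smooth_pd _ _ I2 (Hw I1)) (Q x t Hx Ht'))). }
  rewrite <- E. apply (is_derive_RInt_param (fun x t => w (x, t) I2) y0 y x).
  - generalize (N x0 x Hx). apply filter_imp. intros x' Hx' t Ht.
    exact (is_pd_ex I1 _ (x', t) _ (smooth_is_pd _ _ I1 _ (Hw I2) (Q x' t Hx' (B _ _ _ Hy Ht)))).
  - intros t Ht.
    apply (continuous_continuity_2d (pd I1 (fun z => w z I2))).
    exact (smooth_continuous _ _ _ (smooth_pd _ _ I1 (Hw I2)) (Q x t Hx (B _ _ _ Hy Ht))).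
  - generalize (N x0 x Hx). apply filter_imp. intros x' Hx'. now apply GI. }
exists (fun z => F (fst z) + G (fst z) (snd z)).
intros i [x y] Hz. apply square_coords in Hz; simpl in Hz. destruct Hz as [Hx Hy].
unfold is_pd. destruct i; simpl.
- replace (w (x, y) I1) with (w (x, y0) I1 + (w (x, y) I1 - w (x, y0) I1)) by ring.
  exact (is_derive_plus _ _ _ _ _ (HF x Hx) (HG1 x y Hx Hy)).
- replace (w (x, y) I2) with (0 + w (x, y) I2) by ring.
  exact (is_derive_plus (fun _ => F x) (fun y => G x y) _ _ _ (is_derive_const _ _) (HG2 x y Hx Hy)).
Qed.

(** * Inverse function theorem *)

Lemma dist_max_eq z w : dist_max z w <= 0 -> z = w.
Proof.
intros H. assert (H1 := dist_max_coord z w I1). assert (H2 := dist_max_coord z w I2).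
assert (E : forall s t, Rabs (s - t) <= 0 -> s = t).
{ intros s t Hst. apply Rminus_diag_uniq.
  destruct (Req_dec (s - t) 0) as [|N]; auto. apply Rabs_pos_lt in N. lra. }
destruct z, w; simpl in *. f_equal; apply E; lra.
Qed.

(** Banach's fixed point theorem, for a map that contracts on a square only: the
    iterates of the centre move by at most twice the first step. *)
Lemma contraction_fixpoint (T : R * R -> R * R) p r :
  (forall z w, square p r z -> square p r w -> dist_max (T z) (T w) <= / 2 * dist_max z w) ->
  2 * dist_max (T p) p < r -> exists z, square p r z /\ T z = z.
Proof.
intros HT Hp. set (d := dist_max (T p) p) in *.
assert (Hd : 0 <= d) by apply dist_max_pos.
set (X := fun n => Nat.iter n T p).
assert (P2 : forall n, 0 < (/ 2) ^ n) by (intros; apply pow_lt; lra).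
assert (S1 : forall n, dist_max (X n) p <= 2 * d * (1 - (/ 2) ^ n) /\
  dist_max (X (S n)) (X n) <= d * (/ 2) ^ n).
{ induction n as [|n [IH1 IH2]].
  - simpl. rewrite dist_max_refl. split; [lra|]. fold d. lra.
  - assert (IH3 : dist_max (X (S n)) p <= 2 * d * (1 - (/ 2) ^ S n)).
    { generalize (dist_max_triangle (X (S n)) (X n) p). simpl pow. specialize (P2 n). nra. }
    split; auto. change (X (S (S n))) with (T (X (S n))). change (X (S n)) with (T (X n)) at 2.
    eapply Rle_trans; [apply HT|].
    + unfold square. specialize (P2 (S n)). nra.
    + unfold square. specialize (P2 n). nra.
    + simpl pow. lra. }
assert (S2 : forall n k, dist_max (X (k + n)%nat) (X n) <= 2 * d * (/ 2) ^ n * (1 - (/ 2) ^ k)).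
{ intros n. induction k as [|k IH].
  - simpl. rewrite dist_max_refl. lra.
  - change (S k + n)%nat with (S (k + n)).
    generalize (dist_max_triangle (X (S (k + n))) (X (k + n)%nat) (X n)).
    destruct (S1 (k + n)%nat) as [_ H]. rewrite pow_add in H. simpl pow.
    intros H'. lra. }
assert (C : forall i, ex_finite_lim_seq (fun n => coord i (X n))).
{ intros i. apply ex_lim_seq_cauchy_corr. intros eps.
  assert (L : is_lim_seq (fun n => 4 * d * (/ 2) ^ n) 0).
  { replace (Finite 0) with (Rbar_mult (4 * d) 0) by (simpl; f_equal; ring).
    apply is_lim_seq_scal_l. apply is_lim_seq_geom. rewrite Rabs_pos_eq; lra. }
  apply is_lim_seq_spec in L. destruct (L eps) as [N HN].
  exists N. intros n m Hn Hm.
  assert (A : forall k, (N <= k)%nat -> dist_max (X k) (X N) <= 2 * d * (/ 2) ^ N).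
  { intros k Hk. replace k with ((k - N) + N)%nat by lia.
    eapply Rle_trans; [apply S2|]. assert (Q := P2 N). specialize (P2 (k - N)%nat).
    assert (0 <= d * (/ 2) ^ N) by (apply Rmult_le_pos; lra). nra. }
  eapply Rle_lt_trans; [apply dist_max_coord|].
  eapply Rle_lt_trans; [apply (dist_max_triangle _ (X N))|].
  rewrite (dist_max_sym (X N)).
  specialize (HN N (le_n N)). rewrite Rminus_0_r in HN. apply Rabs_def2 in HN.
  generalize (A n Hn) (A m Hm). lra. }
destruct (C I1) as [l1 L1], (C I2) as [l2 L2].
assert (D : forall eps, 0 < eps -> exists N, forall n, (N <= n)%nat -> dist_max (X n) (l1, l2) < eps).
{ intros eps He. apply is_lim_seq_spec in L1, L2.
  destruct (L1 (mkposreal _ He)) as [N1 H1], (L2 (mkposreal _ He)) as [N2 H2].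
  exists (max N1 N2). intros n Hn. apply Rmax_lub_lt; [apply H1 | apply H2]; lia. }
assert (Hl : square p r (l1, l2)).
{ assert (He : 0 < r - 2 * d) by lra. destruct (D _ He) as [N HN].
  specialize (HN N (le_n N)). destruct (S1 N) as [H _].
  generalize (dist_max_triangle (l1, l2) (X N) p). rewrite (dist_max_sym (l1, l2) (X N)).
  unfold square. specialize (P2 N).
  assert (0 <= d * (/ 2) ^ N) by (apply Rmult_le_pos; lra). lra. }
exists (l1, l2). split; auto. apply dist_max_eq.
apply Rnot_lt_le. intros Hlt.
assert (He : 0 < dist_max (T (l1, l2)) (l1, l2) / 2) by lra.
destruct (D _ He) as [N HN].
assert (H1 := HN N (le_n N)). assert (H2 := HN (S N) (le_S _ _ (le_n N))).
assert (H3 : dist_max (T (X N)) (T (l1, l2)) <= / 2 * dist_max (X N) (l1, l2)).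
{ apply HT; auto. unfold square. destruct (S1 N) as [H _]. specialize (P2 N). nra. }
change (X (S N)) with (T (X N)) in H2.
generalize (dist_max_triangle (T (l1, l2)) (T (X N)) (l1, l2)).
rewrite (dist_max_sym (T (l1, l2)) (T (X N))). lra.
Qed.

Definition jac_det (f : R * R -> R * R) (x : R * R) : R :=
  jac f x I1 I1 * jac f x I2 I2 - jac f x I1 I2 * jac f x I2 I1.

Definition jac_inv (f : R * R -> R * R) (x : R * R) (i j : ix) : R :=
  match i, j with
  | I1, I1 => jac f x I2 I2 / jac_det f x
  | I2, I2 => jac f x I1 I1 / jac_det f x
  | _, _ => - jac f x i j / jac_det f x
  end.

Section InverseFunction.
Variables (U : R * R -> Prop) (f : R * R -> R * R).
Hypothesis HU : open U.
Hypothesis Hf : forall j, smooth U (fun z => coord j (f z)).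

Lemma smooth_jac k i : smooth U (fun z => jac f z k i).
Proof. exact (smooth_pd U _ i (Hf k)). Qed.

Lemma smooth_jac_det : smooth U (jac_det f).
Proof. unfold jac_det. pose proof smooth_jac. smooth_tac. Qed.

Lemma jac_inv_solve x (v : vec) : jac_det f x <> 0 ->
  forall j, v j = Sum (fun k => jac_inv f x j k * Sum (fun l => jac f x k l * v l)).
Proof.
intros H j. unfold jac_inv, Sum, jac_det in *. destruct j; field; exact H.
Qed.

(** With [A] the inverse of the differential at [p], the error [z - A (f z)] has
    small derivative near [p], hence is a contraction there. *)
Lemma error_contracts p : U p -> jac_det f p <> 0 ->
  exists r, 0 < r /\ (forall z, square p r z -> U z /\ jac_det f z <> 0) /\
  forall j z w, square p r z -> square p r w ->
  Rabs ((coord j z - Sum (fun k => jac_inv f p j k * coord k (f z))) -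
        (coord j w - Sum (fun k => jac_inv f p j k * coord k (f w)))) <= / 2 * dist_max z w.
Proof.
intros Hp HJ.
set (d := fun j i z => (if ix_eqb i j then 1 else 0) -
  Sum (fun k => jac_inv f p j k * jac f z k i)).
assert (Sd : forall j i, smooth U (d j i)).
{ intros j i. unfold d. pose proof smooth_jac. smooth_tac. }
assert (D0 : forall j i, d j i p = 0).
{ intros j i. unfold d, jac_inv, Sum, jac_det in *. destruct j, i; simpl; field; exact HJ. }
assert (Q : locally p (fun z => U z /\ jac_det f z <> 0 /\
  forall j i, Rabs (d j i z) < / 4)).
{ assert (E : forall j i, locally p (fun z => Rabs (d j i z) < / 4)).
  { intros j i. apply (filter_imp (fun z => Rabs (d j i z - d j i p) < / 4)).
    - intros z. now rewrite D0, Rminus_0_r.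
    - apply continuous_eps; [|lra]. now apply (smooth_continuous U). }
  apply filter_and; [exact (HU p Hp)|]. apply filter_and.
  - assert (N : 0 < Rabs (jac_det f p)) by now apply Rabs_pos_lt.
    generalize (continuous_eps _ p _ (smooth_continuous U _ p smooth_jac_det Hp) N).
    apply filter_imp. intros z Hz Hz0. rewrite Hz0, Rminus_0_l, Rabs_Ropp in Hz. lra.
  - generalize (filter_and _ _ (filter_and _ _ (E I1 I1) (E I1 I2))
      (filter_and _ _ (E I2 I1) (E I2 I2))).
    apply filter_imp. intros z [[? ?] [? ?]] j i. destruct j, i; assumption. }
apply locally_square in Q. destruct Q as [r [Hr Q]].
exists r. split; auto. split.
{ intros z Hz. destruct (Q z Hz) as [? [? _]]; auto. }
intros j z w Hz Hw.
assert (Inc := square_increment p r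
  (fun z => coord j z - Sum (fun k => jac_inv f p j k * coord k (f z))) (d j) (/ 4) z w Hz Hw).
eapply Rle_trans; [apply Inc|].
- intros i y Hy. destruct (Q y Hy) as [HUy [_ Hdy]]. split.
  + unfold d. apply is_pd_minus; [apply is_pd_coord|]. unfold Sum.
    assert (M : forall k, is_pd i (fun z => jac_inv f p j k * coord k (f z)) y
      (jac_inv f p j k * jac f y k i)).
    { intros k. replace (jac_inv f p j k * jac f y k i) with
       (0 * coord k (f y) + jac_inv f p j k * jac f y k i) by ring.
      exact (is_pd_mult i (fun _ => jac_inv f p j k) (fun z => coord k (f z)) y _ _
        (is_pd_const i _ y) (smooth_is_pd U _ i y (Hf k) HUy)). }
    exact (is_pd_plus i _ _ y _ _ (M I1) (M I2)).
  + left. apply Hdy.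
- generalize (dist_max_coord z w I1) (dist_max_coord z w I2). simpl. lra.
Qed.

(** The first-order expansion of [f] at [g y] can be solved for the increment of
    [g], since the Lipschitz bound on [g] turns an error that is small compared
    with this increment into one that is small compared with [z - y]. *)
Lemma inverse_is_pd (W : R * R -> Prop) (g : R * R -> R * R) C y i j :
  open W -> W y -> (forall z, W z -> U (g z) /\ f (g z) = z) -> 0 < C ->
  (forall z, W z -> dist_max (g z) (g y) <= C * dist_max z y) ->
  jac_det f (g y) <> 0 ->
  is_pd i (fun z => coord j (g z)) y (jac_inv f (g y) j i).
Proof.
intros HW Hy Hg HC HL HJ.
set (x := g y) in *. assert (Hx : U x) by now apply Hg.
set (B := Rabs (jac_inv f x j I1) + Rabs (jac_inv f x j I2) + 1).
assert (HB : 0 < B).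
{ unfold B. generalize (Rabs_pos (jac_inv f x j I1)) (Rabs_pos (jac_inv f x j I2)). lra. }
split; [apply is_linear_scal_l|].
intros t0 Ht0. rewrite <- (is_filter_lim_locally_unique (V := R_NormedModule) _ _ Ht0). clear t0 Ht0.
intros eps.
assert (He : 0 < eps / (B * C)) by (apply Rdiv_lt_0_compat; [apply cond_pos | nra]).
assert (D : forall k, locally x (fun z => Rabs (coord k (f z) - coord k (f x) -
  (jac f x k I1 * (fst z - fst x) + jac f x k I2 * (snd z - snd x)))
  <= eps / (B * C) * dist_max z x)).
{ intros k. generalize (Ck1_differentiable 0 U _ x HU (Hf k 1%nat) Hx (mkposreal _ He)).
  intros H. apply locally_2d_locally in H. destruct x as [x1 x2].
  revert H. apply filter_imp. intros [z1 z2]; simpl. exact (fun h => h). }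
generalize (filter_and _ _ (D I1) (D I2)). intros D'.
apply locally_square in D'. destruct D' as [rho [Hrho D']].
assert (Hr : 0 < rho / C) by now apply Rdiv_lt_0_compat.
set (yt := fun t => match i with I1 => (t, snd y) | I2 => (fst y, t) end).
assert (Eyt : forall t, dist_max (yt t) y = Rabs (t - coord i y)).
{ intros t. unfold dist_max, yt. destruct i; simpl; rewrite Rminus_diag, Rabs_R0.
  - apply Rmax_left, Rabs_pos. - apply Rmax_right, Rabs_pos. }
assert (Est : forall t, slice i (fun z => coord j (g z)) y t = coord j (g (yt t))).
{ intros t. unfold yt. destruct i; reflexivity. }
assert (N1 := locally_slice i W y HW Hy).
assert (N2 : locally (coord i y) (fun t => Rabs (t - coord i y) < rho / C))
  by now exists (mkposreal _ Hr).
generalize (filter_and _ _ N1 N2). apply filter_imp.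
intros t [Ht1 Ht2].
assert (HWt : W (yt t)) by (unfold yt; destruct i; exact Ht1).
rewrite Est, slice_coord. fold x.
set (z := g (yt t)).
assert (Lz : dist_max z x <= C * Rabs (t - coord i y)) by (rewrite <- Eyt; now apply HL).
assert (Sz : square x rho z).
{ unfold square. eapply Rle_lt_trans; [exact Lz|].
  apply (Rmult_lt_compat_l C) in Ht2; [|exact HC].
  replace (C * (rho / C)) with rho in Ht2 by (field; lra). exact Ht2. }
destruct (D' z Sz) as [E1 E2].
destruct (Hg (yt t) HWt) as [_ Fz]. destruct (Hg y Hy) as [_ Fx]. fold z in Fz. fold x in Fx.
rewrite Fz, Fx in E1, E2.
assert (V := jac_inv_solve x (fun l => coord l z - coord l x) HJ j).
change (norm (minus (minus (coord j z) (coord j x)) (scal (minus t (coord i y)) (jac_inv f x j i))))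
  with (Rabs ((coord j z - coord j x) - (t - coord i y) * jac_inv f x j i)).
change (norm (minus t (coord i y))) with (Rabs (t - coord i y)).
cbv beta in V. rewrite V.
set (e := fun k => coord k (yt t) - coord k y -
    (jac f x k I1 * (fst z - fst x) + jac f x k I2 * (snd z - snd x))) in *.
replace (Sum _ - (t - coord i y) * jac_inv f x j i) with
  (- (jac_inv f x j I1 * e I1 + jac_inv f x j I2 * e I2)).
2: { unfold Sum, e, yt. destruct i; simpl; ring. }
rewrite Rabs_Ropp. eapply Rle_trans; [apply Rabs_triang|]. rewrite !Rabs_mult.
change (Rabs (e I1) <= eps / (B * C) * dist_max z x) in E1.
change (Rabs (e I2) <= eps / (B * C) * dist_max z x) in E2.
assert (M : eps / (B * C) * dist_max z x <= eps / B * Rabs (t - coord i y)).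
{ replace (eps / B * Rabs (t - coord i y)) with
   (eps / (B * C) * (C * Rabs (t - coord i y))) by (field; lra).
  apply Rmult_le_compat_l; lra. }
assert (T : forall k, Rabs (e k) <= eps / B * Rabs (t - coord i y)) by (intros []; lra).
apply Rle_trans with (B * (eps / B * Rabs (t - coord i y))).
2: { right. field. lra. }
assert (0 <= eps / B * Rabs (t - coord i y)) by (eapply Rle_trans; [apply Rabs_pos | apply (T I1)]).
unfold B at 1. rewrite !Rmult_plus_distr_r.
generalize (Rmult_le_compat_l _ _ _ (Rabs_pos (jac_inv f x j I1)) (T I1))
  (Rmult_le_compat_l _ _ _ (Rabs_pos (jac_inv f x j I2)) (T I2)). lra.
Qed.

(** To solve [f z = y], iterate [z |-> z + A (y - f z)] from [p], where [A] is the
    inverse of the differential at [p]. The inverse [g] is Lipschitz, so it has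
    the differential [(Df)^-1 o g], and its smoothness improves by one degree at
    a time. *)
Lemma inverse_function p : U p -> jac_det f p <> 0 ->
  exists (V W : R * R -> Prop) (g : R * R -> R * R),
    open V /\ V p /\ (forall z, V z -> U z) /\ open W /\
    (forall z, V z -> W (f z) /\ g (f z) = z) /\
    (forall y, W y -> V (g y) /\ f (g y) = y) /\
    (forall j, smooth W (fun y => coord j (g y))).
Proof.
intros Hp HJ.
destruct (error_contracts p Hp HJ) as [r [Hr [HUr HE]]].
set (B := Rabs (jac_inv f p I1 I1) + Rabs (jac_inv f p I1 I2) +
  Rabs (jac_inv f p I2 I1) + Rabs (jac_inv f p I2 I2) + 1).
assert (HBe : forall j k, 0 <= Rabs (jac_inv f p j k)) by (intros; apply Rabs_pos).
assert (HB : 0 < B).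
{ unfold B. generalize (HBe I1 I1) (HBe I1 I2) (HBe I2 I1) (HBe I2 I2). lra. }
assert (HA : forall j (u v : R * R),
  Rabs (Sum (fun k => jac_inv f p j k * (coord k u - coord k v))) <= B * dist_max u v).
{ intros j u v. unfold Sum. eapply Rle_trans; [apply Rabs_triang|]. rewrite !Rabs_mult.
  generalize (Rmult_le_compat_l _ _ _ (HBe j I1) (dist_max_coord u v I1))
    (Rmult_le_compat_l _ _ _ (HBe j I2) (dist_max_coord u v I2)).
  assert (0 <= dist_max u v) by apply dist_max_pos.
  assert (Rabs (jac_inv f p j I1) + Rabs (jac_inv f p j I2) <= B).
  { unfold B. generalize (HBe I1 I1) (HBe I1 I2) (HBe I2 I1) (HBe I2 I2). destruct j; lra. }
  nra. }
assert (HL : forall z w, square p r z -> square p r w ->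
  dist_max z w <= 2 * B * dist_max (f z) (f w)).
{ intros z w Hz Hw.
  assert (dist_max z w <= B * dist_max (f z) (f w) + / 2 * dist_max z w); [|lra].
  apply dist_max_lub. intros j.
  replace (coord j z - coord j w) with
    (Sum (fun k => jac_inv f p j k * (coord k (f z) - coord k (f w))) +
     ((coord j z - Sum (fun k => jac_inv f p j k * coord k (f z))) -
        (coord j w - Sum (fun k => jac_inv f p j k * coord k (f w)))))
    by (unfold Sum; ring).
  eapply Rle_trans; [apply Rabs_triang|]. apply Rplus_le_compat; auto. }
(* for [y] at distance less than [rho] the first step of the iteration is at most [r / 4] *)
set (rho := r / (4 * B)).
assert (Hrho : 0 < rho) by (apply Rdiv_lt_0_compat; lra).
assert (HS : forall y, square (f p) rho y -> exists z, square p r z /\ f z = y).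
{ intros y Hy.
  set (T := fun z => (fst z + Sum (fun k => jac_inv f p I1 k * (coord k y - coord k (f z))),
                      snd z + Sum (fun k => jac_inv f p I2 k * (coord k y - coord k (f z))))).
  assert (ET : forall j z, coord j (T z) =
    coord j z + Sum (fun k => jac_inv f p j k * (coord k y - coord k (f z)))) by now intros [].
  destruct (contraction_fixpoint T p r) as [z [Hz Hfix]].
  - intros z w Hz Hw. apply dist_max_lub. intros j. rewrite !ET.
    generalize (HE j z w Hz Hw). unfold Sum. intros H. eapply Rle_trans; [|exact H].
    right. f_equal. ring.
  - assert (dist_max (T p) p <= B * rho).
    { apply dist_max_lub. intros j. rewrite ET.
      replace (coord j p + _ - coord j p) with
        (Sum (fun k => jac_inv f p j k * (coord k y - coord k (f p)))) by ring.
      eapply Rle_trans; [apply HA|]. unfold square in Hy. nra. }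
    replace (B * rho) with (r / 4) in H by (unfold rho; field; lra). lra.
  - exists z. split; auto.
    assert (Z : forall j, Sum (fun k => jac_inv f p j k * (coord k y - coord k (f z))) = 0).
    { intros j. generalize (ET j z). rewrite Hfix. lra. }
    assert (E : forall k, coord k y - coord k (f z) = 0).
    { intros k.
      set (v := fun k => coord k y - coord k (f z)) in *.
      transitivity (Sum (fun j => jac f p k j * Sum (fun k => jac_inv f p j k * v k))).
      - unfold Sum, jac_inv, jac_det, v in *. destruct k; field; exact HJ.
      - unfold Sum at 1. rewrite !Z. ring. }
    generalize (E I1) (E I2). destruct y, (f z); simpl. intros. f_equal; lra. }
set (W := square (f p) rho).
set (V := fun z => square p r z /\ W (f z)).
set (g := fun y => epsilon (inhabits p) (fun z => square p r z /\ f z = y)).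
assert (Hg : forall y, W y -> square p r (g y) /\ f (g y) = y).
{ intros y Hy. apply (epsilon_spec (inhabits p) (fun z => square p r z /\ f z = y)).
  now apply HS. }
assert (HW : open W) by apply square_open.
assert (Lg : forall y z, W y -> W z -> dist_max (g z) (g y) <= 2 * B * dist_max z y).
{ intros y z Hy Hz. destruct (Hg y Hy) as [Hy1 Hy2], (Hg z Hz) as [Hz1 Hz2].
  rewrite <- Hy2 at 2. rewrite <- Hz2 at 2. now apply HL. }
exists V, W, g. split; [|split; [|split; [|split; [|split; [|split]]]]]; auto.
- apply open_preimage2; auto; [apply square_open|].
  intros i z Hz. apply (smooth_continuous U); auto. now apply HUr.
- split; now apply square_center.
- intros z [Hz _]. now apply HUr.
- intros z [Hz1 Hz2]. split; auto. destruct (Hg (f z) Hz2) as [H1 H2].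
  apply dist_max_eq. eapply Rle_trans; [now apply HL|].
  rewrite H2, dist_max_refl. lra.
- intros y Hy. destruct (Hg y Hy) as [H E]. split; auto. split; auto. now rewrite E.
- set (U' := fun z => U z /\ jac_det f z <> 0).
  assert (HU' : open U').
  { apply open_preimage with (D := fun t => t <> 0); auto.
    - intros z Hz. apply (smooth_continuous U); auto. apply smooth_jac_det.
    - apply open_neq. }
  assert (GU : forall y, W y -> U' (g y)) by (intros y Hy; apply HUr, Hg, Hy).
  assert (SJ : forall i j, smooth U' (fun x => jac_inv f x j i)).
  { intros i j. assert (S := smooth_jac). assert (SD := smooth_jac_det).
    assert (SU : forall k l, smooth U' (fun z => jac f z k l)).
    { intros k l. apply (smooth_sub U); auto. now intros z [? _]. }
    assert (SDU : smooth U' (jac_det f)) by (apply (smooth_sub U); auto; now intros z [? _]).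
    unfold jac_inv. destruct j, i; apply smooth_div; auto; try (now intros z [_ ?]);
      apply smooth_opp; auto. }
  intros j k. revert j. induction k as [|k IH]; intros j.
  + split; auto. intros y Hy.
    apply (filterlim_locally (F := locally y)). intros e.
    assert (He : 0 < e / (2 * B)) by (apply Rdiv_lt_0_compat; [apply cond_pos | lra]).
    assert (N : locally y (fun z => W z /\ dist_max z y < e / (2 * B))).
    { apply filter_and; [exact (HW y Hy)|]. apply locally_square. exists (e / (2 * B)).
      split; auto. }
    revert N. apply filter_imp. intros z [Hz1 Hz2].
    change (Rabs (coord j (g z) - coord j (g y)) < e).
    eapply Rle_lt_trans; [apply dist_max_coord|].
    eapply Rle_lt_trans; [now apply Lg|].
    apply (Rmult_lt_compat_l (2 * B)) in Hz2; [|lra].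
    replace (2 * B * (e / (2 * B))) with (pos e) in Hz2 by (field; lra). exact Hz2.
  + apply (Ck_S_intro k W _ (fun i y => jac_inv f (g y) j i)); auto.
    * intros i y Hy. apply (inverse_is_pd W g (2 * B)); auto; try lra.
      -- intros z Hz. destruct (Hg z Hz). split; auto. now apply HUr.
      -- now apply GU.
    * intros i. apply (Ck_comp k U' W (fun x => jac_inv f x j i)); auto. apply SJ.
Qed.

End InverseFunction.

(** * Charts and isometries *)

Definition transition {M : surface} (a b : chart M) (x : R * R) : R * R :=
  crd b (par a x).

Definition overlap {M : surface} (a b : chart M) (x : R * R) : Prop :=
  dom a x /\ patch b (par a x).

Lemma overlap_dom (M : surface) (a b : chart M) x : overlap a b x ->
  dom b (transition a b x) /\ par b (transition a b x) = par a x.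
Proof.
intros [Hx [y [Hy E]]]. unfold transition. rewrite <- E, crd_par by auto. now split.
Qed.

Lemma mopen_image (M : surface) (a : chart M) (U : R * R -> Prop) :
  open U -> (forall x, U x -> dom a x) -> mopen (fun p => exists x, U x /\ par a x = p).
Proof.
intros HU HUd b.
apply (open_ext (fun y => overlap b a y /\ U (transition b a y))).
- intros y; split.
  + intros [Ho Hu]. split; [apply Ho|]. exists (transition b a y). split; auto.
    now apply overlap_dom.
  + intros [Hy [x [Hx E]]]. split.
    * split; auto. exists x. auto.
    * unfold transition. rewrite <- E, crd_par; auto.
- apply open_preimage2; auto.
  + apply overlap_open.
  + intros i y Hy. exact (smooth_continuous _ _ _ (transition_smooth M b a i) Hy).
Qed.

Lemma pull_chain (f F t : R * R -> R * R) x y T i j :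
  (forall k l, jac F x k l = Sum (fun n => jac f y k n * jac t x n l)) ->
  pull F x T i j = pull t x (pull f y T) i j.
Proof. intros E. unfold pull. unfold Sum at 1 2 3. rewrite !E. unfold Sum. ring. Qed.

Lemma pull_ext f x (T T' : ix -> ix -> R) i j : (forall k l, T k l = T' k l) ->
  pull f x T i j = pull f x T' i j.
Proof. intros E. unfold pull, Sum. now rewrite !E. Qed.

Lemma jac_comp U V (f t : R * R -> R * R) x k i : open U ->
  (forall j, smooth U (fun z => coord j (f z))) -> U (t x) -> V x ->
  (forall j, smooth V (fun z => coord j (t z))) ->
  jac (fun z => f (t z)) x k i = Sum (fun n => jac f (t x) k n * jac t x n i).
Proof.
intros HU Hf Hx HV Ht. unfold jac at 1.
exact (pd_comp U V (fun z => coord k (f z)) t i x HU (Hf k) Hx HV Ht).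
Qed.

Lemma jac_ext_loc (U : R * R -> Prop) (f g : R * R -> R * R) x k i : open U -> U x ->
  (forall z, U z -> f z = g z) -> jac f x k i = jac g x k i.
Proof.
intros HU Hx E. apply (pd_ext_loc i U); auto. intros z Hz. now rewrite E.
Qed.

Definition tensor_compat {M : surface} (h : tensor M) : Prop :=
  forall a b x i j, overlap a b x ->
    h a x i j = pull (transition a b) x (h b (transition a b x)) i j.

Lemma metric_tensor_compat (M : surface) (g : metric M) : tensor_compat g.
Proof. intros a b x i j [Hx Hp]. exact (metric_compat M g a b x i j Hx Hp). Qed.

Definition chart_map {M : surface} (phi : pt M -> pt half_plane) (a : chart M)
  (z : R * R) : R * R := proj1_sig (phi (par a z)).

Lemma half_plane_patch (q : pt half_plane) : patch (tt : chart half_plane) q.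
Proof. exists (proj1_sig q). split; [exact (proj2_sig q) | apply hpar_proj1]. Qed.

Lemma isometry_chart (M : surface) (h : tensor M) c V phi a :
  isometry h (hyp_metric c) V phi ->
  open (fun z => dom a z /\ V (par a z)) /\
  (forall i, smooth (fun z => dom a z /\ V (par a z))
     (fun z => coord i (chart_map phi a z))) /\
  (forall x i j, dom a x -> V (par a x) ->
     h a x i j = pull (chart_map phi a) x (hyp_metric c tt (chart_map phi a x)) i j).
Proof.
intros [HV [[W [psi [_ [_ [_ [Hs _]]]]]] Hm]].
split; [exact (HV a)|]. split.
- intros i. destruct (Hs a tt) as [_ S].
  apply (smooth_sub (fun x => dom a x /\ V (par a x) /\ patch (tt : chart half_plane) (phi (par a x)))).
  + intros z [H1 H2]. split; [|split]; auto. apply half_plane_patch.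
  + exact (S i).
- intros x i j Hx HVx. exact (Hm a tt x i j Hx HVx (half_plane_patch _)).
Qed.

(** The new image is the preimage of [V'] under the inverse of [phi]; it is open
    because, in every chart of [M], that inverse is continuous. *)
Lemma isometry_restrict (M : surface) (h : tensor M) c (V V' : pt M -> Prop) phi :
  isometry h (hyp_metric c) V phi -> mopen V' -> (forall p, V' p -> V p) ->
  isometry h (hyp_metric c) V' phi.
Proof.
intros [HV [[W [psi [HW [H1 [H2 [S1 S2]]]]]] Hm]] HV' HVV.
split; auto. split.
- set (W' := fun q => W q /\ V' (psi q)).
  assert (OW : forall a : chart M, open (fun y => (upper y /\ W (hpar y) /\
     patch a (psi (hpar y))) /\ (dom a (crd a (psi (hpar y))) /\
       V' (par a (crd a (psi (hpar y))))))).
  { intros a. destruct (S2 tt a) as [O2 Sm2].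
    apply (open_preimage2 _ (fun y => crd a (psi (hpar y))) (fun x => dom a x /\ V' (par a x))).
    - exact O2.
    - intros i y Hy. exact (smooth_continuous _ _ _ (Sm2 i) Hy).
    - exact (HV' a). }
  assert (PC : forall (a : chart M) p, patch a p -> dom a (crd a p) /\ par a (crd a p) = p).
  { intros a p [x [Hx E]]. rewrite <- E, crd_par by auto. auto. }
  exists W', psi. split; [|split; [|split; [|split]]].
  + apply (proj2 (half_plane_open_iff W')).
    intros y [Hy [HWy HVy]].
    destruct (patch_cover M (psi (hpar y))) as [a Ha].
    assert (Q := OW a y). destruct (PC a _ Ha) as [Q1 Q2].
    rewrite <- Q2 in HVy.
    generalize (Q (conj (conj Hy (conj HWy Ha)) (conj Q1 HVy))). apply filter_imp.
    intros z [[Z1 [Z2 Z3]] [Z4 Z5]]. destruct (PC a _ Z3) as [_ E]. rewrite E in Z5.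
    repeat split; auto.
  + intros p Hp. destruct (H1 p (HVV p Hp)) as [E1 E2]. split; auto.
    split; auto. now rewrite E2.
  + intros q [Hq1 Hq2]. split; auto. now apply H2.
  + intros a b. destruct (S1 a b) as [O Sm]. split.
    * apply (open_ext (fun x => (dom a x /\ V (par a x) /\ patch b (phi (par a x))) /\
        (dom a x /\ V' (par a x)))).
      -- intros x. split; [tauto|]. intros [? [? ?]]. auto 7.
      -- apply open_and; auto.
    * intros i. apply (smooth_sub _ _ _ ) with (2 := Sm i). intros x [? [? ?]]; auto.
  + intros b a. destruct b. destruct (S2 tt a) as [O Sm]. split.
    * apply (open_ext _ _) with (2 := OW a). intros y. split.
      -- intros [[Z1 [Z2 Z3]] [Z4 Z5]]. destruct (PC a _ Z3) as [_ E]. rewrite E in Z5.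
         repeat split; auto.
      -- intros [Z1 [[Z2 Z5] Z3]]. destruct (PC a _ Z3) as [Z4 E].
         rewrite <- E in Z5. repeat split; auto.
    * intros i. apply (smooth_sub _ _ _ ) with (2 := Sm i). intros x [? [[? ?] ?]]; auto.
- intros a b x i j Hx HVx Hp. exact (Hm a b x i j Hx (HVV _ HVx) Hp).
Qed.

Lemma connected_square (M : surface) (a : chart M) p r :
  (forall x, square p r x -> dom a x) ->
  connected (fun q => exists x, square p r x /\ par a x = q).
Proof.
intros Hd A B HA HB Hc Hdis.
destruct (square_connected p r (fun x => dom a x /\ A (par a x)) (fun x => dom a x /\ B (par a x)))
  as [H|H].
- exact (HA a). - exact (HB a).
- intros z Hz. destruct (Hc (par a z)); eauto.
- intros z Hz [[_ H1] [_ H2]]. apply (Hdis (par a z)); eauto.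
- left. intros q [x [Hx E]]. rewrite <- E. now apply H.
- right. intros q [x [Hx E]]. rewrite <- E. now apply H.
Qed.

(** For a parallel field, where the identity of [M] carries one metric to the
    other. *)
Lemma locally_isometric_refl (M : surface) (h k : tensor M) : tensor_compat k ->
  (forall a x i j, dom a x -> h a x i j = k a x i j) -> locally_isometric h k.
Proof.
intros Hk E p. exists (fun _ => True), (fun q => q).
assert (S : smooth_map (M := M) (N := M) (fun _ => True) (fun q => q)).
{ intros a b. split.
  - apply (open_ext (overlap a b)); [|apply overlap_open].
    intros x; unfold overlap; tauto.
  - intros i. apply (smooth_sub (overlap a b)); [unfold overlap; tauto|].
    apply transition_smooth. }
assert (O : mopen (fun _ : pt M => True)).
{ intros a. apply (open_ext (dom a)); [tauto | apply dom_open]. }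
split; auto. split; auto. split.
- exists (fun _ => True), (fun q => q). repeat split; auto; apply S.
- intros a b x i j Hx _ Hp. rewrite E by auto. exact (Hk a b x i j (conj Hx Hp)).
Qed.

(** * Surfaces with a coframe of constant divergence are hyperbolic *)

(** If [a] is closed and [db = m a ^ b] then [m a] and [exp (- u) b], with
    [du = m a], are locally exact; as [m^2 = c^2], the primitives of [c exp (- u) b] and
    of [- m exp (- u) a] are half-plane coordinates. *)
Lemma half_plane_coordinates U h a b c m x0 : 0 < c -> m ^ 2 = c ^ 2 ->
  coframe U h a b -> (forall x, U x -> curl a x = 0) ->
  (forall x, U x -> curl b x = m * wedge a b x) -> U x0 ->
  exists (U' : R * R -> Prop) (f : R * R -> R * R),
    open U' /\ U' x0 /\ (forall x, U' x -> U x) /\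
    (forall j, smooth U' (fun z => coord j (f z))) /\
    (forall x, U' x -> upper (f x) /\ jac_det f x <> 0) /\
    (forall x i j, U' x -> h x i j = pull f x (hyp_metric c tt (f x)) i j).
Proof.
intros Hc Hm HF Ha Hb Hx0.
assert (HU := coframe_open _ _ _ _ HF).
destruct (open_square U x0 HU Hx0) as [r [Hr HrU]].
assert (HS := square_open x0 r).
assert (Sa : forall i, smooth (square x0 r) (fun z => a z i)).
{ intros i. apply (smooth_sub U); auto. apply (coframe_smooth1 _ _ _ _ HF). }
assert (Sb : forall i, smooth (square x0 r) (fun z => b z i)).
{ intros i. apply (smooth_sub U); auto. apply (coframe_smooth2 _ _ _ _ HF). }
destruct (closed_form_exact x0 r (fun z i => m * a z i) Hr) as [u Hu].
- intros i. apply smooth_mult; auto. apply smooth_const.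
- intros z Hz. unfold curl.
  rewrite !(fun i j => is_pd_unique i _ z _ (is_pd_mult i (fun _ => m) (fun y => a y j) z _ _
    (is_pd_const i m z) (smooth_is_pd _ _ i z (Sa j) Hz))).
  specialize (Ha z (HrU z Hz)). unfold curl in Ha.
  replace (pd I1 (fun z => a z I2) z) with (pd I2 (fun z => a z I1) z) by lra. ring.
- assert (Su : smooth (square x0 r) u).
  { apply (smooth_primitive _ u (fun i z => m * a z i)); auto.
    intros i. apply smooth_mult; auto. apply smooth_const. }
  set (y := fun z => exp (- u z)).
  assert (Sy : smooth (square x0 r) y) by (apply smooth_exp; auto; now apply smooth_opp).
  assert (Dy : forall i z, square x0 r z -> is_pd i y z (- m * y z * a z i)).
  { intros i z Hz. replace (- m * y z * a z i) with (exp (- u z) * - (m * a z i))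
      by (unfold y; ring).
    apply (is_pd_comp1 i exp); [|apply is_derive_exp]. apply is_pd_opp. now apply Hu. }
  destruct (closed_form_exact x0 r (fun z i => c * y z * b z i) Hr) as [x Hx].
  + intros i. repeat apply smooth_mult; auto. apply smooth_const.
  + intros z Hz. unfold curl.
    rewrite !(fun i j => is_pd_unique i _ z _ (is_pd_mult i (fun y' => c * y y') (fun y => b y j) z _ _
      (is_pd_mult i (fun _ => c) y z _ _ (is_pd_const i c z) (Dy i z Hz))
      (smooth_is_pd _ _ i z (Sb j) Hz))).
    specialize (Hb z (HrU z Hz)). unfold curl, wedge in Hb.
    replace (pd I1 (fun z => b z I2) z) with
     (pd I2 (fun z => b z I1) z + m * (a z I1 * b z I2 - a z I2 * b z I1)) by lra. ring.
  + assert (Y : forall z, 0 < y z) by (intros; apply exp_pos).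
    assert (J1 : forall i z, square x0 r z -> jac (fun z => (x z, y z)) z I1 i = c * y z * b z i).
    { intros i z Hz. now apply is_pd_unique, Hx. }
    assert (J2 : forall i z, square x0 r z -> jac (fun z => (x z, y z)) z I2 i = - m * y z * a z i).
    { intros i z Hz. now apply is_pd_unique, Dy. }
    exists (square x0 r), (fun z => (x z, y z)). repeat split; auto.
    * now apply square_center.
    * intros j. destruct j; simpl; auto.
      apply (smooth_primitive _ x (fun i z => c * y z * b z i)); auto.
      intros i. repeat apply smooth_mult; auto. apply smooth_const.
    * unfold upper. apply Y.
    * unfold jac_det. rewrite !J1, !J2 by auto.
      replace (c * y x1 * b x1 I1 * (- m * y x1 * a x1 I2) -
        c * y x1 * b x1 I2 * (- m * y x1 * a x1 I1)) with
        (c * m * y x1 * y x1 * wedge a b x1) by (unfold wedge; ring).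
      assert (m <> 0) by nra.
      specialize (Y x1). generalize (coframe_wedge _ _ _ _ HF x1 (HrU _ H)). intros Hw.
      repeat apply Rmult_integral_contrapositive_currified; auto; lra.
    * intros z i j Hz. rewrite (coframe_metric _ _ _ _ HF) by auto.
      unfold pull, Sum. rewrite !J1, !J2 by auto. unfold hyp_metric. simpl snd. simpl ix_eqb.
      cbv iota. specialize (Y z).
      transitivity (m ^ 2 / c ^ 2 * (a z i * a z j) + b z i * b z j).
      -- rewrite Hm. field. lra.
      -- field. lra.
Qed.

(** The half-plane coordinates of one chart form a local diffeomorphism [f] by the
    inverse function theorem; in the other charts the isometry is [f] composed
    with the change of charts. *)
Lemma coframe_locally_hyperbolic (M : surface) (h : tensor M) c : 0 < c ->
  tensor_compat h ->
  (forall a x0, dom a x0 -> exists U al be m, U x0 /\ (forall z, U z -> dom a z) /\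
    m ^ 2 = c ^ 2 /\ coframe U (h a) al be /\ (forall x, U x -> curl al x = 0) /\
    (forall x, U x -> curl be x = m * wedge al be x)) ->
  locally_isometric h (hyp_metric c).
Proof.
intros Hc Hh HF p.
destruct (patch_cover M p) as [a [x0 [Hx0 Ep]]].
destruct (HF a x0 Hx0) as [U [al [be [m [HU0 [HUd [Hm [Hco [Hal Hbe]]]]]]]]].
destruct (half_plane_coordinates U (h a) al be c m x0 Hc Hm Hco Hal Hbe HU0)
  as [U' [f [HU' [HU'0 [HU'U [Sf [HJ Hpull]]]]]]].
destruct (inverse_function U' f HU' Sf x0 HU'0 (proj2 (HJ x0 HU'0)))
  as [V0 [W0 [G [HV0 [HV0x [HV0U [HW0 [HfG [HGf SG]]]]]]]]].
assert (Dv : forall x, V0 x -> dom a x) by auto.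
assert (Up : forall x, V0 x -> upper (f x)) by (intros x Hx; apply HJ; auto).
set (V := fun q => exists x, V0 x /\ par a x = q).
set (phi := fun q : pt M => hpar (f (crd a q)) : pt half_plane).
set (W := fun q : pt half_plane => W0 (proj1_sig q)).
set (psi := fun q : pt half_plane => par a (G (proj1_sig q))).
assert (HV : mopen V) by now apply mopen_image.
assert (EW : forall y, upper y -> proj1_sig (hpar y) = y) by apply proj1_hpar.
assert (Vt : forall a' x, dom a' x -> V (par a' x) ->
  overlap a' a x /\ V0 (transition a' a x)).
{ intros a' x Hx [y [Hy E]]. split.
  - split; auto. exists y. auto.
  - unfold transition. rewrite <- E, crd_par; auto. }
assert (Ephi : forall a' x, dom a' x -> V (par a' x) ->
  proj1_sig (phi (par a' x)) = f (transition a' a x)).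
{ intros a' x Hx HVx. unfold phi. apply EW, Up. now apply Vt. }
assert (St : forall a' j, smooth (fun x => dom a' x /\ V (par a' x))
  (fun z => coord j (transition a' a z))).
{ intros a' j. apply (smooth_sub (overlap a' a)).
  - intros x [H1 H2]. now apply Vt.
  - apply transition_smooth. }
exists V, phi. split; [now exists x0|]. split; auto. split.
- exists W, psi. split; [|split; [|split; [|split]]].
  + apply (proj2 (half_plane_open_iff W)).
    apply (open_ext (fun y => upper y /\ W0 y)).
    * intros y. unfold W. split; intros [H1 H2]; split; auto; rewrite EW in *; auto.
    * apply open_and; auto. apply upper_open.
  + intros q [x [Hx E]]. unfold W, psi, phi. rewrite <- E, crd_par, EW by auto.
    destruct (HfG x Hx) as [H1 H2]. rewrite H2. auto.
  + intros q Hq. destruct (HGf _ Hq) as [H1 H2]. split.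
    * unfold V, psi. eauto.
    * unfold phi, psi. rewrite crd_par by auto. rewrite H2. apply hpar_proj1.
  + intros a' b. destruct b.
    assert (O : open (fun x => dom a' x /\ V (par a' x) /\
      patch (tt : chart half_plane) (phi (par a' x)))).
    { apply (open_ext (fun x => dom a' x /\ V (par a' x))); [|exact (HV a')].
      intros x. split; [|tauto]. intros [H1 H2]. split; [|split]; auto. apply half_plane_patch. }
    split; auto.
    intros i. apply (smooth_sub (fun x => dom a' x /\ V (par a' x))); [tauto|].
    apply (smooth_ext _ (fun x => coord i (f (transition a' a x)))); [exact (HV a')| |].
    * intros x [H1 H2]. exact (f_equal (coord i) (eq_sym (Ephi a' x H1 H2))).
    * apply (smooth_comp U' _ (fun x => coord i (f x)) (transition a' a)); auto.
      intros x [H1 H2]. apply HV0U. now apply Vt.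
  + intros b a'. destruct b.
    assert (O : open (fun y => (upper y /\ W0 y) /\ overlap a a' (G y))).
    { apply open_preimage2.
      - apply open_and; auto. apply upper_open.
      - intros i y [_ Hy]. now apply (smooth_continuous W0).
      - apply overlap_open. }
    assert (EO : forall y, (upper y /\ W0 y) /\ overlap a a' (G y) <->
      upper y /\ W (hpar y) /\ patch a' (psi (hpar y))).
    { intros y. unfold W, psi. split.
      - intros [[H1 H2] [H3 H4]]. rewrite EW by auto. auto.
      - intros [H1 [H2 H3]]. rewrite EW in * by auto. split; auto. split; auto.
        apply Dv. now apply HGf. }
    split; [exact (open_ext _ _ EO O)|].
    intros i. apply (smooth_sub (fun y => (upper y /\ W0 y) /\ overlap a a' (G y))).
    * intros y. apply EO.
    * apply (smooth_ext _ (fun y => coord i (transition a a' (G y)))); auto.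
      -- intros y [[H1 _] _]. unfold transition, psi. simpl. now rewrite EW.
      -- apply (smooth_comp (overlap a a') _ (fun x => coord i (transition a a' x)) G).
         ++ apply overlap_open. ++ exact O.
         ++ tauto.
         ++ apply transition_smooth.
         ++ intros j. apply (smooth_sub W0); [tauto|]. apply SG.
- intros a' b x i j Hx HVx _. destruct b. cbv zeta.
  destruct (Vt a' x Hx HVx) as [Ho Hv].
  rewrite (Hh a' a x i j Ho).
  change (@crd half_plane tt (phi (par a' x))) with (proj1_sig (phi (par a' x))).
  rewrite (Ephi a' x Hx HVx).
  transitivity (pull (transition a' a) x (pull f (transition a' a x)
    (hyp_metric c tt (f (transition a' a x)))) i j).
  + apply pull_ext. intros k l. exact (Hpull _ k l (HV0U _ Hv)).
  + symmetry. apply pull_chain. intros k l.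
    transitivity (jac (fun z => f (transition a' a z)) x k l).
    * apply (jac_ext_loc (fun z => dom a' z /\ V (par a' z))); auto.
      intros z [Hz1 Hz2]. exact (Ephi a' z Hz1 Hz2).
    * apply (jac_comp U' (fun z => dom a' z /\ V (par a' z))); auto.
Qed.

(** * Geodesic fields of constant squared divergence *)

(** The two possible values are [2 c] apart, while values at nearby points differ by
    less than [c]. *)
Lemma locally_constant_sign (U : R * R -> Prop) f c x0 : 0 < c -> open U ->
  (forall x, U x -> continuous f x) -> (forall x, U x -> f x ^ 2 = c ^ 2) -> U x0 ->
  exists r, 0 < r /\ forall x, square x0 r x -> U x /\ f x = f x0.
Proof.
intros Hc HU Hf Hs Hx0.
assert (L := filter_and _ _ (HU x0 Hx0) (continuous_eps f x0 c (Hf x0 Hx0) Hc)).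
apply locally_square in L. destruct L as [r [Hr L]].
exists r. split; auto. intros x Hx. destruct (L x Hx) as [Hu Hd]. split; auto.
apply Rabs_def2 in Hd. assert (E1 := Hs x Hu). assert (E2 := Hs x0 Hx0).
assert (E : (f x - f x0) * (f x + f x0) = 0) by (ring_simplify; lra).
apply Rmult_integral in E. destruct E as [E|E]; [lra|].
assert (F : f x = - f x0) by lra. rewrite F in Hd. nra.
Qed.

(** The coframe may depend on the point, because the coframes that arise from a
    map to the half-plane exist only locally and up to sign. *)
Definition squared_divergence {M : surface} (g : metric M) (xi : vfield M) (c : R) : Prop :=
  forall (a : chart M) x0, dom a x0 -> exists U al be,
    U x0 /\ (forall x, U x -> dom a x) /\ adapted U (gcomp g a) (xi a) al be /\
    (forall x, U x -> divergence al be x ^ 2 = c ^ 2).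

Section GeodesicField.
Variables (M : surface) (g : metric M) (xi : vfield M).
Hypothesis Hunit : unit_field g xi.
Hypothesis Hgeo : geodesic_field g xi.

Let th1 (a : chart M) := dual_form (gcomp g a) (xi a).
Let th2 (a : chart M) := normal_form (gcomp g a) (xi a).

Lemma section_gauss_squared_divergence K c : constant_curvature g K ->
  squared_divergence g xi c ->
  constant_curvature (section_metric g xi) ((1 - K) * (K - c ^ 4) / (1 + c ^ 2) ^ 2).
Proof.
intros HK Hc a x Hx. destruct (Hc a x Hx) as [U [al [be [HUx [HUd [HA HD]]]]]].
unfold section_metric.
rewrite (gauss_section U (gcomp g a) (xi a) al be HA) with (K := K); auto.
replace (divergence al be x ^ 4) with ((divergence al be x ^ 2) ^ 2) by ring.
rewrite HD by auto. replace ((c ^ 2) ^ 2) with (c ^ 4) by ring. reflexivity.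
Qed.

Lemma section_squared_divergence c a x i j : squared_divergence g xi c -> dom a x ->
  section_metric g xi a x i j =
    (1 + c ^ 2) * gcomp g a x i j - c ^ 2 * (th1 a x i * th1 a x j).
Proof.
intros Hc Hx. destruct (Hc a x Hx) as [U [al [be [HUx [HUd [HA HD]]]]]].
unfold section_metric, th1.
rewrite (section_adapted U (gcomp g a) (xi a) al be HA) by
  (try (intros y k Hy; apply Hgeo); auto).
rewrite !(fun i => adapted_dual_form _ _ _ _ _ x i HA HUx).
rewrite (coframe_metric _ _ _ _ (adapted_coframe _ _ _ _ _ HA)) by auto.
rewrite HD by auto. ring.
Qed.

Lemma dual_form_compat a b x i : overlap a b x ->
  th1 a x i = Sum (fun k => th1 b (transition a b x) k * jac (transition a b) x k i).
Proof.
intros H. unfold th1, dual_form.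
assert (V : forall k, xi b (transition a b x) k = push (transition a b) x (xi a x) k)
  by (intros k; exact (vfield_compat M xi a b x k (proj1 H) (proj2 H))).
unfold Sum at 1 3. rewrite !(metric_tensor_compat M g a b x _ _ H), !V.
unfold pull, push, Sum. ring.
Qed.

(** Writing the metric of the image through [g] and the form dual to [xi], which
    are both tensorial, avoids the transformation law of the Christoffel
    symbols. *)
Lemma section_compat c : squared_divergence g xi c ->
  tensor_compat (section_metric g xi).
Proof.
intros Hc a b x i j H.
rewrite (section_squared_divergence c) by (auto; apply H).
rewrite (pull_ext _ x (section_metric g xi b (transition a b x)) (fun k l =>
  (1 + c ^ 2) * gcomp g b (transition a b x) k l -
  c ^ 2 * (th1 b (transition a b x) k * th1 b (transition a b x) l))).
2: { intros k l. apply section_squared_divergence; auto. now apply overlap_dom. }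
rewrite !(dual_form_compat a b x _ H), (metric_tensor_compat M g a b x i j H).
unfold pull, Sum. ring.
Qed.

(** Stretching by [s] the directions orthogonal to [xi] does not change its
    divergence. *)
Lemma stretched_locally_hyperbolic (h : tensor M) c s : 0 < c -> 0 < s ->
  squared_divergence g xi c -> tensor_compat h ->
  (forall a x i j, dom a x -> h a x i j =
     s ^ 2 * gcomp g a x i j - (s ^ 2 - 1) * (th1 a x i * th1 a x j)) ->
  locally_isometric h (hyp_metric c).
Proof.
intros Hc Hs HD Hh Hst. apply coframe_locally_hyperbolic; auto.
intros a x0 Hx0. destruct (HD a x0 Hx0) as [U [al [be [HUx [HUd [HA HDv]]]]]].
assert (HF := adapted_coframe _ _ _ _ _ HA).
assert (HU := coframe_open _ _ _ _ HF).
assert (G : forall y k, U y -> cov (gcomp g a) (xi a) (xi a) y k = 0)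
  by (intros; apply Hgeo; auto).
assert (Sm := smooth_divergence U _ _ al be HA).
destruct (locally_constant_sign U (divergence al be) c x0 Hc HU) as [r [Hr HrU]]; auto.
{ intros x Hx. now apply (smooth_continuous U). }
assert (HrU1 : forall x, square x0 r x -> U x) by (intros x Hx; now apply HrU).
assert (HQ : open (square x0 r)) by apply square_open.
assert (Sb : forall i, smooth (square x0 r) (fun z => be z i)).
{ intros i. apply (smooth_sub U); auto. apply (coframe_smooth2 _ _ _ _ HF). }
exists (square x0 r), al, (fun z i => s * be z i), (divergence al be x0).
split; [now apply square_center|]. split; [auto|]. split; [auto|]. split.
- split; auto.
  + intros i. apply (smooth_sub U); auto. apply (coframe_smooth1 _ _ _ _ HF).
  + intros i. apply smooth_mult; auto. apply smooth_const.
  + intros x i j Hx. rewrite Hst by auto. unfold th1.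
    rewrite !(fun i => adapted_dual_form _ _ _ _ _ x i HA (HrU1 x Hx)).
    rewrite (coframe_metric _ _ _ _ HF) by auto. ring.
  + intros x Hx. replace (wedge al _ x) with (s * wedge al be x) by (unfold wedge; ring).
    apply Rmult_integral_contrapositive_currified; [lra|]. now apply (coframe_wedge _ _ _ _ HF), HrU1.
- split.
  + intros x Hx. apply (adapted_closed U (gcomp g a) (xi a) al be); auto.
  + intros x Hx. destruct (HrU x Hx) as [Hu E]. rewrite <- E.
    assert (C := curl_divergence U _ _ al be HA x Hu). unfold curl in *.
    rewrite !(fun i j => is_pd_unique i _ x _ (is_pd_mult i (fun _ => s) (fun y => be y j) x _ _
      (is_pd_const i s x) (smooth_is_pd _ _ i x (Sb j) Hx))).
    replace (wedge al (fun z i => s * be z i) x) with (s * wedge al be x) by (unfold wedge; ring).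
    replace (divergence al be x * (s * wedge al be x)) with
      (s * (divergence al be x * wedge al be x)) by ring.
    rewrite <- C. ring.
Qed.

Lemma metric_locally_hyperbolic c : 0 < c -> squared_divergence g xi c ->
  locally_isometric g (hyp_metric c).
Proof.
intros Hc HD. apply (stretched_locally_hyperbolic g c 1); auto; try lra.
- apply metric_tensor_compat.
- intros. ring.
Qed.

Lemma section_locally_hyperbolic c : 0 < c -> squared_divergence g xi c ->
  locally_isometric (section_metric g xi) (hyp_metric c).
Proof.
intros Hc HD.
assert (P : 0 < 1 + c ^ 2) by (generalize (pow2_ge_0 c); lra).
apply (stretched_locally_hyperbolic (section_metric g xi) c (sqrt (1 + c ^ 2))); auto.
- now apply sqrt_lt_R0.
- now apply (section_compat c).
- intros a x i j Hx. rewrite (section_squared_divergence c) by auto.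
  rewrite pow2_sqrt by lra. ring.
Qed.

Lemma constant_section_curvature K kappa : constant_curvature g K ->
  constant_curvature (section_metric g xi) kappa -> K <> 1 ->
  K <= 0 /\ squared_divergence g xi (sqrt (- K)).
Proof.
intros HK Hk HK1.
assert (E : forall a x, dom a x -> divergence (th1 a) (th2 a) x ^ 2 = - K).
{ intros a x Hx.
  apply (equilibrium (dom a) (gcomp g a) (xi a) (th1 a) (th2 a)) with (kappa := kappa); auto.
  - now apply unit_field_adapted.
  - exact (Hk a). }
assert (HK0 : K <= 0).
{ destruct (pt_inhabited M) as [p]. destruct (patch_cover M p) as [a [x [Hx _]]].
  generalize (E a x Hx) (pow2_ge_0 (divergence (th1 a) (th2 a) x)). lra. }
split; auto. intros a x0 Hx0. exists (dom a), (th1 a), (th2 a).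
split; [|split; [|split]]; auto; [now apply unit_field_adapted|].
intros x Hx. rewrite E, pow2_sqrt; auto. lra.
Qed.

Lemma parallel_iff_squared_divergence :
  parallel_field g xi <-> squared_divergence g xi 0.
Proof.
assert (HA := fun a => unit_field_adapted M g xi a Hunit).
split.
- intros HP a x0 Hx0. exists (dom a), (th1 a), (th2 a). split; [|split; [|split]]; auto.
  intros x Hx. replace (divergence (th1 a) (th2 a) x) with 0; [ring|].
  assert (C : forall l, divergence (th1 a) (th2 a) x * th2 a x l = 0).
  { intros l.
    destruct (cov_adapted (dom a) _ _ _ _ (HA a) (fun x k => Hgeo a x k) x l Hx) as [_ E].
    unfold th1, th2. rewrite <- E. unfold contract, Sum. rewrite !HP by auto. ring. }
  assert (W := coframe_wedge _ _ _ _ (adapted_coframe _ _ _ _ _ (HA a)) x Hx).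
  apply (Rmult_eq_reg_r (wedge (th1 a) (th2 a) x)); auto.
  transitivity (th1 a x I1 * (divergence (th1 a) (th2 a) x * th2 a x I2) -
    th1 a x I2 * (divergence (th1 a) (th2 a) x * th2 a x I1)).
  + rewrite !C. ring. + unfold wedge. ring.
- intros HD a x i k Hx. destruct (HD a x Hx) as [U [al [be [HUx [HUd [HAU HDv]]]]]].
  assert (G : forall y k, U y -> cov (gcomp g a) (xi a) (xi a) y k = 0)
    by (intros; apply Hgeo; auto).
  destruct (cov_adapted U _ _ al be HAU G x i HUx) as [E1 E2].
  assert (m0 : divergence al be x = 0) by (specialize (HDv x HUx); nra).
  rewrite m0, Rmult_0_l in E2.
  destruct (contract_determines U _ al be (adapted_coframe _ _ _ _ _ HAU) x
    (cov (gcomp g a) (fun _ => basis i) (xi a) x) HUx) as [F1 F2].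
  rewrite E1, E2 in F1, F2.
  destruct k; [rewrite F1 | rewrite F2]; unfold Rdiv; ring.
Qed.

(** If the isometry [f] of a chart into the half-plane carries [xi] to a vertical
    field, then [dY / (c Y)], up to sign, and [dX / (c Y)] are adapted to [xi]. *)
Lemma vertical_field_divergence c a S (f : R * R -> R * R) x0 : 0 < c -> open S -> S x0 ->
  (forall x, S x -> dom a x) -> (forall j, smooth S (fun z => coord j (f z))) ->
  (forall x, S x -> upper (f x)) ->
  (forall x i j, S x -> gcomp g a x i j = pull f x (hyp_metric c tt (f x)) i j) ->
  (forall x, S x -> push f x (xi a x) I1 = 0) ->
  exists U al be, U x0 /\ (forall x, U x -> dom a x) /\
    adapted U (gcomp g a) (xi a) al be /\
    (forall x, U x -> divergence al be x ^ 2 = c ^ 2).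
Proof.
intros Hc HS HS0 HSd Sf Hup Hpull Hpush.
assert (Pos : forall x, S x -> 0 < c * coord I2 (f x)).
{ intros x Hx. apply Rmult_lt_0_compat; auto. now apply Hup. }
assert (Nz : forall x, S x -> coord I2 (f x) <> 0 /\ c <> 0).
{ intros x Hx. split; [apply Rgt_not_eq; now apply Hup | lra]. }
assert (Gm : forall x i j, S x -> gcomp g a x i j =
  (jac f x I1 i * jac f x I1 j + jac f x I2 i * jac f x I2 j) / (c * coord I2 (f x)) ^ 2).
{ intros x i j Hx. rewrite Hpull by auto.
  unfold pull, Sum, hyp_metric. simpl. field. exact (Nz x Hx). }
assert (Sj : forall k i, smooth S (fun z => jac f z k i)) by (intros; now apply smooth_jac).
set (q := fun x => / (c * coord I2 (f x))).
assert (Sq : smooth S q).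
{ apply smooth_inv; auto.
  - apply smooth_mult; auto. apply smooth_const.
  - intros x Hx. apply Rgt_not_eq. now apply Pos. }
assert (Sxi : forall i, smooth S (fun z => xi a z i)).
{ intros i. apply (smooth_sub (dom a)); auto. apply vfield_smooth. }
set (s := fun x => push f x (xi a x) I2 * q x).
assert (Ss : smooth S s).
{ apply smooth_mult; auto. unfold push. apply smooth_Sum; auto. intros i. now apply smooth_mult. }
assert (s1 : forall x, S x -> s x ^ 2 = 1 ^ 2).
{ intros x Hx. replace (1 ^ 2) with (dot (gcomp g a) x (xi a x) (xi a x))
    by (rewrite Hunit by auto; ring).
  transitivity (s x ^ 2 + (push f x (xi a x) I1 * q x) ^ 2).
  - rewrite Hpush by auto. ring.
  - unfold dot, s, Sum. rewrite !Gm by auto. unfold push, Sum, q. field.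
    exact (Nz x Hx). }
destruct (locally_constant_sign S s 1 x0) as [r [Hr HrS]]; auto; [lra | |].
{ intros x Hx. now apply (smooth_continuous S). }
assert (HQ : open (square x0 r)) by apply square_open.
assert (HQS : forall x, square x0 r x -> S x) by (intros x Hx; now apply HrS).
assert (Ssub : forall u, smooth S u -> smooth (square x0 r) u)
  by (intros u; now apply smooth_sub).
set (al := fun x i => s x0 * (jac f x I2 i * q x)).
set (be := fun x i => jac f x I1 i * q x).
assert (e1 : s x0 ^ 2 = 1) by (rewrite s1 by auto; ring).
assert (Hw : forall x, S x -> wedge al be x <> 0).
{ intros x Hx E. generalize (metric_det_pos M g a x (HSd x Hx)).
  replace (det (gcomp g a) x) with (s x0 ^ 2 * det (gcomp g a) x) by (rewrite e1; ring).
  replace (s x0 ^ 2 * det (gcomp g a) x) with (wedge al be x ^ 2).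
  - rewrite E. lra.
  - unfold det. rewrite !Gm by auto. unfold wedge, al, be, q. field.
    exact (Nz x Hx). }
exists (square x0 r), al, be. split; [now apply square_center|]. split; [auto|]. split.
- split.
  + split; auto.
    * intros i. apply Ssub. apply smooth_mult; auto; [apply smooth_const|]. now apply smooth_mult.
    * intros i. apply Ssub. now apply smooth_mult.
    * intros x i j Hx. rewrite Gm by auto. unfold al, be, q.
      transitivity ((s x0 ^ 2 * (jac f x I2 i * jac f x I2 j) + jac f x I1 i * jac f x I1 j)
        / (c * coord I2 (f x)) ^ 2).
      -- rewrite e1. unfold Rdiv. ring.
      -- field. exact (Nz x (HQS x Hx)).
  + intros i. auto.
  + intros x Hx. destruct (HrS x Hx) as [HSx E].
    transitivity (s x0 * s x).
    * unfold contract, al, s at 3, push, Sum. ring.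
    * rewrite E, <- e1. ring.
  + intros x Hx. transitivity (push f x (xi a x) I1 * q x).
    * unfold contract, be, push, Sum. ring.
    * rewrite Hpush by auto. ring.
- intros x Hx. assert (HSx := HQS x Hx).
  assert (Cb : curl be x = - c * (jac f x I2 I1 * jac f x I1 I2 - jac f x I2 I2 * jac f x I1 I1)
    * q x * q x).
  { unfold curl, be.
    assert (Dq : forall i, is_pd i q x (- (0 * coord I2 (f x) + c * jac f x I2 i) * q x * q x)).
    { intros i. apply (is_pd_inv i (fun x => c * coord I2 (f x))).
      - exact (is_pd_mult i (fun _ => c) (fun z => coord I2 (f z)) x _ _ (is_pd_const i c x)
          (smooth_is_pd S _ i x (Sf I2) HSx)).
      - apply Rgt_not_eq. now apply Pos. }
    rewrite !(fun i j => is_pd_unique i _ x _ (is_pd_mult i (fun y => jac f y I1 j) q x _ _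
      (smooth_is_pd S _ i x (Sj I1 j) HSx) (Dq i))).
    change (fun y => jac f y I1 I2) with (pd I2 (fun z => coord I1 (f z))).
    change (fun y => jac f y I1 I1) with (pd I1 (fun z => coord I1 (f z))).
    rewrite (smooth_schwarz S _ x HS (Sf I1) HSx). ring. }
  assert (Wb : wedge al be x = s x0 *
    (jac f x I2 I1 * jac f x I1 I2 - jac f x I2 I2 * jac f x I1 I1) * q x * q x).
  { unfold wedge, al, be. ring. }
  unfold divergence. assert (W := Hw x HSx).
  replace (curl be x) with (- c * s x0 * wedge al be x).
  + replace ((- c * s x0 * wedge al be x / wedge al be x) ^ 2) with (c ^ 2 * s x0 ^ 2)
      by (field; auto). rewrite e1. ring.
  + rewrite Cb, Wb. transitivity (s x0 ^ 2 * - c *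
     (jac f x I2 I1 * jac f x I1 I2 - jac f x I2 I2 * jac f x I1 I1) * q x * q x).
    * ring. * rewrite e1. ring.
Qed.

End GeodesicField.

(** * Normals of horocycles *)

Lemma hyp_dot c y (v w : vec) : dot (hyp_metric c tt) y v w =
  (v I1 * w I1 + v I2 * w I2) * / (c * snd y) ^ 2.
Proof. unfold dot, Sum, hyp_metric. simpl. ring. Qed.

Lemma normal_to_line c y (v : vec) : 0 < c -> upper y ->
  normal_to (hyp_metric c tt) (horocycle None (snd y)) y v -> v I1 = 0.
Proof.
intros Hc Hy H.
assert (E := H (fun s => (fst y + s, snd y)) (basis I1)).
rewrite hyp_dot in E. unfold basis in E. simpl ix_eqb in E. cbv iota in E.
assert (P : 0 < / (c * snd y) ^ 2).
{ apply Rinv_0_lt_compat, pow_lt, Rmult_lt_0_compat; auto. }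
apply (Rmult_eq_reg_r (/ (c * snd y) ^ 2)); [|lra].
rewrite Rmult_0_l, <- E; [ring | | |].
- destruct y; simpl. f_equal. ring.
- apply filter_forall. intros s. now split.
- intros []; simpl; unfold basis; simpl; auto_derive; auto.
Qed.

(** The test curve is the rotation about the Euclidean centre [(e, t / 2)]. *)
Lemma normal_to_circle c e y (v : vec) : 0 < c -> upper y ->
  normal_to (hyp_metric c tt)
    (horocycle (Some e) (((fst y - e) ^ 2 + snd y ^ 2) / snd y)) y v ->
  ((fst y - e) ^ 2 - snd y ^ 2) * v I1 + 2 * (fst y - e) * snd y * v I2 = 0.
Proof.
intros Hc Hy H. unfold upper in Hy.
set (t := ((fst y - e) ^ 2 + snd y ^ 2) / snd y) in *.
assert (Et : t * snd y = (fst y - e) ^ 2 + snd y ^ 2) by (unfold t; field; lra).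
set (g1 := fun s => e + (fst y - e) * cos s - (snd y - t / 2) * sin s).
set (g2 := fun s => t / 2 + (fst y - e) * sin s + (snd y - t / 2) * cos s).
assert (D1 : is_derive g1 0 (- (snd y - t / 2))).
{ unfold g1. auto_derive; auto. rewrite cos_0, sin_0. ring. }
assert (D2 : is_derive g2 0 (fst y - e)).
{ unfold g2. auto_derive; auto. rewrite cos_0, sin_0. ring. }
assert (E0 : g2 0 = snd y) by (unfold g2; rewrite cos_0, sin_0; ring).
assert (E := H (fun s => (g1 s, g2 s))
  (fun i => match i with I1 => - (snd y - t / 2) | I2 => fst y - e end)).
rewrite hyp_dot in E.
assert (P : 0 < / (c * snd y) ^ 2).
{ apply Rinv_0_lt_compat, pow_lt, Rmult_lt_0_compat; auto. }
assert (E' : v I1 * - (snd y - t / 2) + v I2 * (fst y - e) = 0).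
{ apply (Rmult_eq_reg_r (/ (c * snd y) ^ 2)); [|lra].
  rewrite Rmult_0_l, <- E; [ring | | |].
  - rewrite E0. unfold g1. rewrite cos_0, sin_0. destruct y; simpl. f_equal. ring.
  - assert (L : locally 0 (fun s => 0 < g2 s)).
    { apply (ex_derive_continuous g2 0); [now exists (fst y - e)|].
      apply open_gt. now rewrite E0. }
    revert L. apply filter_imp. intros s Hs. split; [exact Hs|]. simpl fst. simpl snd.
    assert (Q : (g1 s - e) ^ 2 + g2 s ^ 2 - t * g2 s =
      ((fst y - e) ^ 2 + (snd y - t / 2) ^ 2) * (Rsqr (sin s) + Rsqr (cos s)) - (t / 2) ^ 2).
    { unfold g1, g2, Rsqr. field. }
    rewrite sin2_cos2, Rmult_1_r in Q.
    replace ((fst y - e) ^ 2) with (t * snd y - snd y ^ 2) in Q by lra.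
    apply Rminus_diag_uniq. rewrite Q. field.
  - intros []; assumption. }
transitivity (2 * snd y * (v I1 * - (snd y - t / 2) + v I2 * (fst y - e))
  + v I1 * ((fst y - e) ^ 2 + snd y ^ 2 - t * snd y)).
- field.
- rewrite E', Et. ring.
Qed.

(** The isometry [z |-> - 1 / (z - e)] of the half-plane, which moves the ideal
    point [e] to infinity. *)
Definition inversion (e : R) (z : R * R) : R * R :=
  (- (fst z - e) / ((fst z - e) ^ 2 + snd z ^ 2), snd z / ((fst z - e) ^ 2 + snd z ^ 2)).

Section Inversion.
Variables (e : R) (S : R * R -> Prop) (f : R * R -> R * R).
Hypothesis HS : open S.
Hypothesis Sf : forall j, smooth S (fun z => coord j (f z)).
Hypothesis Hup : forall x, S x -> upper (f x).

Let d (x : R * R) : R := (coord I1 (f x) - e) ^ 2 + coord I2 (f x) ^ 2.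

Lemma inversion_den_pos x : S x -> 0 < d x.
Proof.
intros Hx. assert (P := Hup x Hx). unfold upper in P.
generalize (pow2_ge_0 (coord I1 (f x) - e)) (pow_lt _ 2 P). unfold d. simpl. lra.
Qed.

Lemma inversion_upper x : S x -> upper (inversion e (f x)).
Proof.
intros Hx. apply Rdiv_lt_0_compat; [now apply Hup | exact (inversion_den_pos x Hx)].
Qed.

Lemma smooth_den : smooth S d.
Proof.
apply smooth_plus; auto; apply smooth_pow; auto.
apply smooth_minus; auto. apply smooth_const.
Qed.

Lemma smooth_inversion j : smooth S (fun z => coord j (inversion e (f z))).
Proof.
assert (N : forall x, S x -> d x <> 0) by (intros; now apply Rgt_not_eq, inversion_den_pos).
destruct j.
- apply (smooth_div S HS (fun z => - (coord I1 (f z) - e)) d); auto using smooth_den.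
  apply smooth_opp; auto. apply smooth_minus; auto. apply smooth_const.
- apply (smooth_div S HS (fun z => coord I2 (f z)) d); auto using smooth_den.
Qed.

Lemma jac_inversion x i : S x ->
  jac (fun z => inversion e (f z)) x I1 i =
    (((coord I1 (f x) - e) ^ 2 - coord I2 (f x) ^ 2) * jac f x I1 i +
     2 * (coord I1 (f x) - e) * coord I2 (f x) * jac f x I2 i) / d x ^ 2 /\
  jac (fun z => inversion e (f z)) x I2 i =
    (((coord I1 (f x) - e) ^ 2 - coord I2 (f x) ^ 2) * jac f x I2 i -
     2 * (coord I1 (f x) - e) * coord I2 (f x) * jac f x I1 i) / d x ^ 2.
Proof.
intros Hx. assert (N := Rgt_not_eq _ _ (inversion_den_pos x Hx)).
assert (Df : forall k, is_pd i (fun z => coord k (f z)) x (jac f x k i))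
  by (intros k; now apply (smooth_is_pd S)).
assert (D1 : is_pd i (fun z => coord I1 (f z) - e) x (jac f x I1 i - 0))
  by (apply is_pd_minus; [apply Df | apply is_pd_const]).
assert (Dd : is_pd i (fun z => / d z) x (- (2 * (coord I1 (f x) - e) * (jac f x I1 i - 0)
  + 2 * coord I2 (f x) * jac f x I2 i) * / d x * / d x)).
{ apply is_pd_inv; auto.
  exact (is_pd_plus i _ _ x _ _ (is_pd_pow2 _ _ _ _ D1) (is_pd_pow2 _ _ _ _ (Df I2))). }
split.
- apply is_pd_unique.
  eapply is_derive_ext; [|refine (eq_ind _ (is_pd i _ x)
    (is_pd_mult i _ _ x _ _ (is_pd_opp _ _ _ _ D1) Dd) _ _)].
  + intros t. destruct i; reflexivity.
  + unfold d in *. field. exact N.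
- apply is_pd_unique.
  eapply is_derive_ext; [|refine (eq_ind _ (is_pd i _ x)
    (is_pd_mult i _ _ x _ _ (Df I2) Dd) _ _)].
  + intros t. destruct i; reflexivity.
  + unfold d in *. field. exact N.
Qed.

Lemma pull_inversion c x i j : 0 < c -> S x ->
  pull (fun z => inversion e (f z)) x (hyp_metric c tt (inversion e (f x))) i j =
  pull f x (hyp_metric c tt (f x)) i j.
Proof.
intros Hc Hx. assert (N := inversion_den_pos x Hx). assert (Y := Hup x Hx).
unfold pull, Sum.
rewrite !(fun i => proj1 (jac_inversion x i Hx)), !(fun i => proj2 (jac_inversion x i Hx)).
unfold hyp_metric. simpl ix_eqb. cbv iota.
change (snd (inversion e (f x))) with (coord I2 (f x) / d x).
change (snd (f x)) with (coord I2 (f x)). change (0 < coord I2 (f x)) in Y.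
unfold d in *. field. repeat split; lra.
Qed.

End Inversion.

(** The isometry is restricted to a small square, which is connected. If the
    common centre of the horocycles is a point of the axis, an inversion moves it
    to infinity; then the horocycles are horizontal lines and their normals are
    vertical. *)
Lemma horocycle_normal_divergence (M : surface) (g : metric M) (xi : vfield M) c :
  unit_field g xi -> 0 < c -> horocycle_normal c g xi -> squared_divergence g xi c.
Proof.
intros Hunit Hc [HL HN] a x0 Hx0.
destruct (HL (par a x0)) as [V [phi [HV Hiso]]].
destruct (isometry_chart M g c V phi a Hiso) as [HO _].
destruct (open_square _ x0 HO (conj Hx0 HV)) as [r [Hr HrO]].
set (S := square x0 r). set (V' := fun q => exists x, S x /\ par a x = q).
assert (HSd : forall x, S x -> dom a x) by (intros x Hx; now apply HrO).
assert (HS : open S) by apply square_open.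
assert (HS0 : S x0) by now apply square_center.
assert (Hiso' : isometry g (hyp_metric c) V' phi).
{ apply (isometry_restrict M g c V); auto.
  - now apply mopen_image.
  - intros q [x [Hx E]]. rewrite <- E. now apply HrO. }
destruct (isometry_chart M g c V' phi a Hiso') as [_ [Sf Hpull]].
assert (SV : forall x, S x -> dom a x /\ V' (par a x)) by (intros x Hx; split; auto; now exists x).
assert (Sf' : forall i, smooth S (fun z => coord i (chart_map phi a z))).
{ intros i. apply (smooth_sub _ S _ SV (Sf i)). }
assert (Hup : forall x, S x -> upper (chart_map phi a x)).
{ intros x _. exact (proj2_sig (phi (par a x))). }
destruct (HN V' phi (connected_square M a x0 r HSd) Hiso') as [w Hw].
assert (Hw' : forall x t, S x -> horocycle w t (chart_map phi a x) ->
  normal_to (hyp_metric c tt) (horocycle w t) (chart_map phi a x)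
    (push (chart_map phi a) x (xi a x))).
{ intros x t Hx. apply Hw; now apply SV. }
destruct w as [e|].
- apply (vertical_field_divergence M g xi Hunit c a S
    (fun x => inversion e (chart_map phi a x)) x0); auto.
  + intros j. now apply smooth_inversion.
  + intros x Hx. now apply (inversion_upper e S).
  + intros x i j Hx. rewrite (pull_inversion e S) by auto. apply Hpull; now apply SV.
  + intros x Hx. unfold push, Sum.
    rewrite !(fun i => proj1 (jac_inversion e S _ Sf' Hup x i Hx)).
    set (y := chart_map phi a x).
    set (t := ((fst y - e) ^ 2 + snd y ^ 2) / snd y).
    assert (Y : 0 < snd y) by now apply Hup.
    assert (Q : horocycle (Some e) t y).
    { split; [exact Y|]. unfold t. field. lra. }
    generalize (normal_to_circle c e y _ Hc Y (Hw' x t Hx Q)). unfold push, Sum.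
    intros E. simpl coord.
    set (D := (fst y - e) ^ 2 + snd y ^ 2).
    apply (Rmult_eq_compat_r (/ D ^ 2)) in E.
    rewrite Rmult_0_l in E. rewrite <- E. unfold Rdiv. ring.
- apply (vertical_field_divergence M g xi Hunit c a S (chart_map phi a) x0); auto.
  + intros x i j Hx. apply Hpull; now apply SV.
  + intros x Hx. apply (normal_to_line c (chart_map phi a x)); auto.
    apply Hw'; auto. split; auto.
Qed.

(** * Fields of divergence [c] or [- c] on pieces of the hyperbolic plane *)

(** The metric of the image is [h + m^2 b b], and [b b] is intrinsic. *)
Lemma squared_divergence_unique U U' h xi a b a' b' x :
  adapted U h xi a b -> adapted U' h xi a' b' ->
  (forall y k, U y -> cov h xi xi y k = 0) -> (forall y k, U' y -> cov h xi xi y k = 0) ->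
  U x -> U' x -> divergence a b x ^ 2 = divergence a' b' x ^ 2.
Proof.
intros HA HA' G G' Hx Hx'.
assert (E : forall i, (divergence a b x ^ 2 - divergence a' b' x ^ 2) * b x i ^ 2 = 0).
{ intros i.
  assert (S := section_adapted U h xi a b HA G x i i Hx).
  rewrite (section_adapted U' h xi a' b' HA' G' x i i Hx') in S.
  assert (N := coframe_metric _ _ _ _ (adapted_coframe _ _ _ _ _ HA) x i i Hx).
  rewrite (coframe_metric _ _ _ _ (adapted_coframe _ _ _ _ _ HA') x i i Hx') in N.
  rewrite <- (adapted_dual_form U h xi a b x i HA Hx) in S, N.
  rewrite <- (adapted_dual_form U' h xi a' b' x i HA' Hx') in S, N.
  assert (N' : b' x i * b' x i = b x i * b x i) by lra.
  rewrite N' in S. lra. }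
assert (W := coframe_wedge _ _ _ _ (adapted_coframe _ _ _ _ _ HA) x Hx).
assert (E1 := E I1). assert (E2 := E I2). unfold wedge in W.
apply Rmult_integral in E1, E2. destruct E1 as [E1|E1]; [lra|]. destruct E2 as [E2|E2]; [lra|].
exfalso. apply W. replace (b x I1) with 0 by nra. replace (b x I2) with 0 by nra. ring.
Qed.

(** The Euclidean unit vector along the image of [xi]. *)
Definition direction (c : R) (f : R * R -> R * R) (xi : lfield) (x : R * R) (k : ix) : R :=
  push f x (xi x) k / (c * coord I2 (f x)).

(** The coframe [dX / (c Y)], [dY / (c Y)], rotated so that its first form is
    dual to [xi]. *)
Definition rotated1 (c : R) (f : R * R -> R * R) (xi : lfield) (x : R * R) (i : ix) : R :=
  let u := direction c f xi x in
  (u I1 * jac f x I1 i + u I2 * jac f x I2 i) / (c * coord I2 (f x)).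

Definition rotated2 (c : R) (f : R * R -> R * R) (xi : lfield) (x : R * R) (i : ix) : R :=
  let u := direction c f xi x in
  (u I1 * jac f x I2 i - u I2 * jac f x I1 i) / (c * coord I2 (f x)).

(** For divergence [eps c], [eps = 1] or [- 1], the angle of the direction has
    this derivative, multiplied by [Y]. *)
Definition rotation_rate (eps : R) (f : R * R -> R * R) (u : vec) (x : R * R) (i : ix) : R :=
  - (1 + eps * u I2) * jac f x I1 i + eps * u I1 * jac f x I2 i.

Definition turning (eps c : R) (f : R * R -> R * R) (xi : lfield) (x : R * R) : Prop :=
  let u := direction c f xi in
  forall i,
    pd i (fun z => u z I1) x * coord I2 (f x) = - u x I2 * rotation_rate eps f (u x) x i /\
    pd i (fun z => u z I2) x * coord I2 (f x) = u x I1 * rotation_rate eps f (u x) x i.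

(** The ideal endpoint of the geodesic through [y] with direction [- eps u], as a
    point of the projective line: the homogeneous coordinates [N1], [N2] with
    endpoint [N2 / N1] are normalized by a positive quantity [T], the trace of
    the null vector that represents the endpoint in the hyperboloid model. *)
Definition endpoint (eps : R) (y : R * R) (u : vec) (i : ix) : R :=
  let v1 := - eps * u I1 in
  let v2 := - eps * u I2 in
  let X := coord I1 y in
  let Y := coord I2 y in
  let T := X ^ 2 * (1 - v2) + 2 * X * Y * v1 + Y ^ 2 * (1 + v2) + (1 - v2) in
  match i with I1 => (1 - v2) / T | I2 => (X * (1 - v2) + Y * v1) / T end.

(** Multiplied by [1 - v2], the trace is a sum of squares. *)
Lemma endpoint_trace_pos X Y v1 v2 : 0 < Y -> v1 ^ 2 + v2 ^ 2 = 1 ->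
  0 < X ^ 2 * (1 - v2) + 2 * X * Y * v1 + Y ^ 2 * (1 + v2) + (1 - v2).
Proof.
intros HY Hv.
assert (B : v2 <= 1) by nra.
destruct (Req_dec v2 1) as [E|E].
- assert (v1 = 0) by nra. subst. generalize (pow_lt _ 2 HY). lra.
- assert (P : 0 < 1 - v2) by lra.
  apply (Rmult_lt_reg_l (1 - v2)); auto.
  replace ((1 - v2) * (X ^ 2 * (1 - v2) + 2 * X * Y * v1 + Y ^ 2 * (1 + v2) + (1 - v2)))
    with ((X * (1 - v2) + Y * v1) ^ 2 + Y ^ 2 * (1 - (v1 ^ 2 + v2 ^ 2)) + (1 - v2) ^ 2) by ring.
  rewrite Hv. generalize (pow2_ge_0 (X * (1 - v2) + Y * v1)) (pow_lt _ 2 P). lra.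
Qed.

Section HalfPlaneField.
Variables (c : R) (S : R * R -> Prop) (f : R * R -> R * R) (h : lmetric) (xi : lfield).
Hypothesis Hc : 0 < c.
Hypothesis HS : open S.
Hypothesis Sf : forall j, smooth S (fun z => coord j (f z)).
Hypothesis Hup : forall x, S x -> upper (f x).
Hypothesis Hpull : forall x i j, S x -> h x i j = pull f x (hyp_metric c tt (f x)) i j.
Hypothesis Sxi : forall i, smooth S (fun z => xi z i).
Hypothesis Hunit : forall x, S x -> dot h x (xi x) (xi x) = 1.
Hypothesis Hdet : forall x, S x -> 0 < det h x.

Let u := direction c f xi.

Lemma half_plane_nonzero x : S x -> coord I2 (f x) <> 0 /\ c <> 0.
Proof. intros Hx. split; [apply Rgt_not_eq; now apply Hup | lra]. Qed.

Lemma half_plane_metric x i j : S x -> h x i j =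
  (jac f x I1 i * jac f x I1 j + jac f x I2 i * jac f x I2 j) / (c * coord I2 (f x)) ^ 2.
Proof.
intros Hx. rewrite Hpull by auto. unfold pull, Sum, hyp_metric. simpl. field.
exact (half_plane_nonzero x Hx).
Qed.

Lemma jac_det_nonzero x : S x -> jac_det f x <> 0.
Proof.
intros Hx E. assert (D := Hdet x Hx). revert D.
replace (det h x) with (jac_det f x ^ 2 / (c * coord I2 (f x)) ^ 4).
- rewrite E. unfold Rdiv. replace (0 ^ 2) with 0 by ring. lra.
- unfold det. rewrite !half_plane_metric by auto. unfold jac_det. field.
  exact (half_plane_nonzero x Hx).
Qed.

Lemma direction_unit x : S x -> u x I1 ^ 2 + u x I2 ^ 2 = 1.
Proof.
intros Hx. rewrite <- (Hunit x Hx). unfold dot. unfold Sum.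
rewrite !half_plane_metric by auto. unfold u, direction, push, Sum. field.
exact (half_plane_nonzero x Hx).
Qed.

Lemma smooth_direction k : smooth S (fun z => u z k).
Proof.
apply smooth_div; auto.
- apply smooth_Sum; auto. intros i. apply smooth_mult; auto. now apply smooth_jac.
- apply smooth_mult; auto. apply smooth_const.
- intros x Hx. destruct (half_plane_nonzero x Hx). apply Rmult_integral_contrapositive_currified; auto.
Qed.

Lemma direction_pd x i : S x ->
  u x I1 * pd i (fun z => u z I1) x + u x I2 * pd i (fun z => u z I2) x = 0.
Proof.
intros Hx.
assert (D : is_pd i (fun z => u z I1 ^ 2 + u z I2 ^ 2) x
  (2 * u x I1 * pd i (fun z => u z I1) x + 2 * u x I2 * pd i (fun z => u z I2) x)).
{ apply is_pd_plus; apply is_pd_pow2; apply (smooth_is_pd S); auto; apply smooth_direction. }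
apply is_pd_unique in D. rewrite (pd_ext_loc i S _ (fun _ => 1) x HS Hx direction_unit) in D.
rewrite (is_pd_unique _ _ _ _ (is_pd_const i 1 x)) in D. lra.
Qed.

Let al := rotated1 c f xi.
Let be := rotated2 c f xi.

Lemma wedge_rotated x : S x -> wedge al be x = jac_det f x / (c * coord I2 (f x)) ^ 2.
Proof.
intros Hx. transitivity ((u x I1 ^ 2 + u x I2 ^ 2) * (jac_det f x / (c * coord I2 (f x)) ^ 2)).
- unfold wedge, al, be, rotated1, rotated2, jac_det. fold u. cbv zeta. field. exact (half_plane_nonzero x Hx).
- rewrite direction_unit by auto. ring.
Qed.

Lemma rotated_adapted : adapted S h xi al be.
Proof.
assert (Sj : forall k i, smooth S (fun z => jac f z k i)) by (intros; now apply smooth_jac).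
assert (Su := smooth_direction).
assert (Nz : forall x, S x -> c * coord I2 (f x) <> 0).
{ intros x Hx. destruct (half_plane_nonzero x Hx).
  apply Rmult_integral_contrapositive_currified; auto. }
assert (Sd : smooth S (fun x => c * coord I2 (f x))).
{ apply smooth_mult; auto. apply smooth_const. }
split; [split|..]; auto.
- intros i. apply smooth_div; auto. apply smooth_plus; auto; apply smooth_mult; auto.
- intros i. apply smooth_div; auto. apply smooth_minus; auto; apply smooth_mult; auto.
- intros x i j Hx. rewrite half_plane_metric by auto.
  transitivity ((u x I1 ^ 2 + u x I2 ^ 2) *
   ((jac f x I1 i * jac f x I1 j + jac f x I2 i * jac f x I2 j) / (c * coord I2 (f x)) ^ 2)).
  + rewrite direction_unit by auto. ring.
  + unfold al, be, rotated1, rotated2. fold u. cbv zeta. field. exact (half_plane_nonzero x Hx).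
- intros x Hx. rewrite wedge_rotated by auto. unfold Rdiv.
  apply Rmult_integral_contrapositive_currified; [now apply jac_det_nonzero|].
  now apply Rinv_neq_0_compat, pow_nonzero, Nz.
- intros x Hx. rewrite <- (direction_unit x Hx). unfold contract, al, rotated1, Sum. fold u. cbv zeta.
  unfold u, direction, push, Sum. field. exact (half_plane_nonzero x Hx).
- intros x Hx. unfold contract, be, rotated2, Sum. fold u. cbv zeta. unfold u, direction, push, Sum. field.
  exact (half_plane_nonzero x Hx).
Qed.

(** Comparing [d al = 0] and [d be = m al ^ be] with the derivatives of the
    half-plane coframe determines the derivative of the angle of [u]. *)
Lemma turning_of_divergence eps x : S x -> curl al x = 0 ->
  curl be x = eps * c * wedge al be x -> turning eps c f xi x.
Proof.
intros Hx Ca Cb. rewrite wedge_rotated in Cb by auto.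
assert (Sj : forall k i, smooth S (fun z => jac f z k i)) by (intros; now apply smooth_jac).
assert (Su := smooth_direction).
assert (Nz := half_plane_nonzero x Hx).
assert (Dq : forall i, is_pd i (fun z => / (c * coord I2 (f z))) x
  (- (0 * coord I2 (f x) + c * jac f x I2 i) * / (c * coord I2 (f x)) * / (c * coord I2 (f x)))).
{ intros i. apply (is_pd_inv i (fun x => c * coord I2 (f x))).
  - exact (is_pd_mult i (fun _ => c) (fun z => coord I2 (f z)) x _ _ (is_pd_const i c x)
      (smooth_is_pd S _ i x (Sf I2) Hx)).
  - destruct Nz. apply Rmult_integral_contrapositive_currified; auto. }
assert (Dm : forall i k n j, is_pd i (fun z => u z k * jac f z n j) x
  (pd i (fun z => u z k) x * jac f x n j + u x k * pd i (fun z => jac f z n j) x)).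
{ intros i k n j. apply is_pd_mult; now apply (smooth_is_pd S). }
unfold curl in Ca, Cb. unfold al, rotated1 in Ca.
unfold be, rotated2 in Cb. fold u in Ca, Cb. cbv zeta in Ca, Cb. unfold Rdiv in Ca at 1 2.
unfold Rdiv in Cb at 1 2.
rewrite !(fun i j => is_pd_unique i _ x _ (is_pd_mult i _ _ x _ _
  (is_pd_plus i _ _ x _ _ (Dm i I1 I1 j) (Dm i I2 I2 j)) (Dq i))) in Ca.
rewrite !(fun i j => is_pd_unique i _ x _ (is_pd_mult i _ _ x _ _
  (is_pd_minus i _ _ x _ _ (Dm i I1 I2 j) (Dm i I2 I1 j)) (Dq i))) in Cb.
assert (Sch : forall k, pd I1 (fun z => jac f z k I2) x = pd I2 (fun z => jac f z k I1) x)
  by (intros k; exact (smooth_schwarz S _ x HS (Sf k) Hx)).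
rewrite !Sch in Ca, Cb.
assert (Un := direction_unit x Hx).
assert (J := jac_det_nonzero x Hx).
(* [psi] is the derivative of the angle *)
assert (Psi : exists psi : ix -> R, forall i,
  pd i (fun z => u z I1) x = - u x I2 * psi i /\ pd i (fun z => u z I2) x = u x I1 * psi i).
{ exists (fun i => u x I1 * pd i (fun z => u z I2) x - u x I2 * pd i (fun z => u z I1) x).
  intros i. assert (D := direction_pd x i Hx). split.
  - transitivity ((u x I1 ^ 2 + u x I2 ^ 2) * pd i (fun z => u z I1) x
      - u x I1 * (u x I1 * pd i (fun z => u z I1) x + u x I2 * pd i (fun z => u z I2) x)).
    + rewrite Un, D. ring. + ring.
  - transitivity ((u x I1 ^ 2 + u x I2 ^ 2) * pd i (fun z => u z I2) x
      - u x I2 * (u x I1 * pd i (fun z => u z I1) x + u x I2 * pd i (fun z => u z I2) x)).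
    + rewrite Un, D. ring. + ring. }
destruct Psi as [psi Psi].
rewrite !(fun i => proj1 (Psi i)), !(fun i => proj2 (Psi i)) in Ca, Cb.
assert (T : forall i, psi i * coord I2 (f x) = rotation_rate eps f (u x) x i).
{ assert (Ca' : psi I1 * (- u x I2 * jac f x I1 I2 + u x I1 * jac f x I2 I2)
    - psi I2 * (- u x I2 * jac f x I1 I1 + u x I1 * jac f x I2 I1)
    + u x I1 * jac_det f x / coord I2 (f x) = 0).
  { apply (f_equal (Rmult (c * coord I2 (f x)))) in Ca. rewrite Rmult_0_r in Ca.
    rewrite <- Ca. unfold jac_det. field. exact Nz. }
  assert (Cb' : - psi I1 * (u x I1 * jac f x I1 I2 + u x I2 * jac f x I2 I2)
    + psi I2 * (u x I1 * jac f x I1 I1 + u x I2 * jac f x I2 I1)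
    - u x I2 * jac_det f x / coord I2 (f x) = eps * jac_det f x / coord I2 (f x)).
  { apply (f_equal (Rmult (c * coord I2 (f x)))) in Cb.
    transitivity (c * coord I2 (f x) * (eps * c * (jac_det f x / (c * coord I2 (f x)) ^ 2))).
    - rewrite <- Cb. unfold jac_det. field. exact Nz.
    - field. exact Nz. }
  apply (f_equal (Rmult (coord I2 (f x)))) in Ca', Cb'. rewrite Rmult_0_r in Ca'.
  assert (Ca2 : coord I2 (f x) * (psi I1 * (- u x I2 * jac f x I1 I2 + u x I1 * jac f x I2 I2)
    - psi I2 * (- u x I2 * jac f x I1 I1 + u x I1 * jac f x I2 I1))
    + u x I1 * jac_det f x = 0) by (rewrite <- Ca'; field; apply Nz).
  assert (Cb2 : coord I2 (f x) * (- psi I1 * (u x I1 * jac f x I1 I2 + u x I2 * jac f x I2 I2)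
    + psi I2 * (u x I1 * jac f x I1 I1 + u x I2 * jac f x I2 I1))
    - u x I2 * jac_det f x - eps * jac_det f x = 0).
  { transitivity (coord I2 (f x) * (- psi I1 * (u x I1 * jac f x I1 I2 + u x I2 * jac f x I2 I2)
    + psi I2 * (u x I1 * jac f x I1 I1 + u x I2 * jac f x I2 I1)
    - u x I2 * jac_det f x / coord I2 (f x)) -
     coord I2 (f x) * (eps * jac_det f x / coord I2 (f x))); [field; apply Nz | rewrite Cb'; ring]. }
  clear - Ca2 Cb2 Un J. unfold rotation_rate.
  (* Cramer's rule for the two equations, whose determinant is [jac_det f x] up to
     the factor [u_1^2 + u_2^2 = 1] *)
  intros i. apply (Rmult_eq_reg_r (jac_det f x)); auto.
  apply Rminus_diag_uniq.
  transitivity ((u x I1 ^ 2 + u x I2 ^ 2 - 1) * (jac_det f x * (- psi i * coord I2 (f x) - jac f x I1 i)) +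
    (u x I1 * jac f x I1 i + u x I2 * jac f x I2 i) *
    (coord I2 (f x) * (psi I1 * (- u x I2 * jac f x I1 I2 + u x I1 * jac f x I2 I2)
    - psi I2 * (- u x I2 * jac f x I1 I1 + u x I1 * jac f x I2 I1))
    + u x I1 * jac_det f x) +
    (u x I1 * jac f x I2 i - u x I2 * jac f x I1 i) *
    (coord I2 (f x) * (- psi I1 * (u x I1 * jac f x I1 I2 + u x I2 * jac f x I2 I2)
    + psi I2 * (u x I1 * jac f x I1 I1 + u x I2 * jac f x I2 I1))
    - u x I2 * jac_det f x - eps * jac_det f x)).
  - unfold jac_det. destruct i; ring.
  - rewrite Ca2, Cb2, Un. ring. }
intros i. fold u. rewrite (proj1 (Psi i)), (proj2 (Psi i)), <- T. split; ring.
Qed.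

(** The homogeneous coordinates and the trace all have the same logarithmic
    derivative. *)
Lemma endpoint_pd eps x i k : eps ^ 2 = 1 -> S x -> turning eps c f xi x ->
  is_pd i (fun z => endpoint eps (f z) (u z) k) x 0.
Proof.
intros He Hx Ht. destruct (Ht i) as [T1 T2]. fold u in T1, T2.
assert (Y := proj1 (half_plane_nonzero x Hx)).
assert (Un := direction_unit x Hx).
assert (Du : forall k, is_pd i (fun z => u z k) x (pd i (fun z => u z k) x))
  by (intros; apply (smooth_is_pd S); auto; apply smooth_direction).
assert (Df : forall k, is_pd i (fun z => coord k (f z)) x (jac f x k i))
  by (intros; now apply (smooth_is_pd S)).
set (v1 := fun z => - eps * u z I1). set (v2 := fun z => - eps * u z I2).
set (X := fun z => coord I1 (f z)). set (y := fun z => coord I2 (f z)).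
set (rho := (v1 x * jac f x I1 i + (1 + v2 x) * jac f x I2 i) / y x).
assert (Uv : v1 x ^ 2 + v2 x ^ 2 = 1).
{ unfold v1, v2. transitivity (eps ^ 2 * (u x I1 ^ 2 + u x I2 ^ 2)); [ring|]. rewrite He, Un. ring. }
set (t := - (1 - v2 x) * jac f x I1 i - v1 x * jac f x I2 i).
assert (Et : rotation_rate eps f (u x) x i = t).
{ unfold rotation_rate, t, v1, v2. ring. }
assert (D1 : is_pd i v1 x (- v2 x * t / y x)).
{ replace (- v2 x * t / y x) with (0 * u x I1 + - eps * pd i (fun z => u z I1) x).
  - exact (is_pd_mult i (fun _ => - eps) (fun z => u z I1) x _ _ (is_pd_const i _ x) (Du I1)).
  - rewrite <- Et. unfold v2, y. apply (Rmult_eq_reg_r (coord I2 (f x))); auto.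
    transitivity (- eps * (pd i (fun z => u z I1) x * coord I2 (f x))); [ring|].
    rewrite T1. field. exact Y. }
assert (D2 : is_pd i v2 x (v1 x * t / y x)).
{ replace (v1 x * t / y x) with (0 * u x I2 + - eps * pd i (fun z => u z I2) x).
  - exact (is_pd_mult i (fun _ => - eps) (fun z => u z I2) x _ _ (is_pd_const i _ x) (Du I2)).
  - rewrite <- Et. unfold v1, y. apply (Rmult_eq_reg_r (coord I2 (f x))); auto.
    transitivity (- eps * (pd i (fun z => u z I2) x * coord I2 (f x))); [ring|].
    rewrite T2. field. exact Y. }
assert (DX : is_pd i X x (jac f x I1 i)) by exact (Df I1).
assert (DY : is_pd i y x (jac f x I2 i)) by exact (Df I2).
assert (Y' : y x <> 0) by exact Y.
assert (DA : is_pd i (fun z => 1 - v2 z) x (0 - v1 x * t / y x))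
  by (apply is_pd_minus; [apply is_pd_const | exact D2]).
assert (EA : 0 - v1 x * t / y x = rho * (1 - v2 x)).
{ unfold t, rho. apply Rminus_diag_uniq.
  transitivity ((v1 x ^ 2 + v2 x ^ 2 - 1) * jac f x I2 i / y x); [field; exact Y'|].
  rewrite Uv. unfold Rdiv. ring. }
assert (DB : is_pd i (fun z => 1 + v2 z) x (0 + v1 x * t / y x))
  by (apply is_pd_plus; [apply is_pd_const | exact D2]).
set (N := fun z => X z * (1 - v2 z) + y z * v1 z).
assert (DN := is_pd_plus i _ _ x _ _ (is_pd_mult i _ _ x _ _ DX DA)
  (is_pd_mult i _ _ x _ _ DY D1)).
change (is_pd i N x (jac f x I1 i * (1 - v2 x) + X x * (0 - v1 x * t / y x) +
  (jac f x I2 i * v1 x + y x * (- v2 x * t / y x)))) in DN.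
assert (EN : jac f x I1 i * (1 - v2 x) + X x * (0 - v1 x * t / y x) +
  (jac f x I2 i * v1 x + y x * (- v2 x * t / y x)) = rho * N x).
{ rewrite EA. unfold t, rho, N. apply Rminus_diag_uniq.
  transitivity ((1 - (v1 x ^ 2 + v2 x ^ 2)) * jac f x I1 i); [field; exact Y'|].
  rewrite Uv. ring. }
set (T := fun z => X z ^ 2 * (1 - v2 z) + 2 * X z * y z * v1 z + y z ^ 2 * (1 + v2 z)
  + (1 - v2 z)).
assert (DT := is_pd_plus i _ _ x _ _ (is_pd_plus i _ _ x _ _ (is_pd_plus i _ _ x _ _
  (is_pd_mult i _ _ x _ _ (is_pd_pow2 i _ x _ DX) DA)
  (is_pd_mult i _ _ x _ _ (is_pd_mult i _ _ x _ _
     (is_pd_mult i _ _ x _ _ (is_pd_const i 2 x) DX) DY) D1))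
  (is_pd_mult i _ _ x _ _ (is_pd_pow2 i _ x _ DY) DB)) DA).
match type of DT with is_pd _ _ _ ?e => assert (ET : e = rho * T x) end.
{ rewrite EA. unfold t, rho, T. apply Rminus_diag_uniq.
  transitivity ((1 - (v1 x ^ 2 + v2 x ^ 2)) * (2 * X x * jac f x I1 i + y x * jac f x I2 i)).
  - field. exact Y'.
  - rewrite Uv. ring. }
assert (PT : 0 < T x) by (apply endpoint_trace_pos; [now apply Hup | exact Uv]).
rewrite EA in DA. rewrite EN in DN.
assert (DT' : is_pd i T x (rho * T x)) by (rewrite <- ET; exact DT).
assert (Q : forall F, is_pd i F x (rho * F x) -> is_pd i (fun z => F z / T z) x 0).
{ intros F HF.
  replace 0 with (rho * F x * / T x + F x * (- (rho * T x) * / T x * / T x)) by (field; lra).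
  apply (is_pd_mult i F (fun z => / T z)); auto. apply is_pd_inv; [exact DT' | lra]. }
destruct k; [exact (Q _ DA) | exact (Q _ DN)].
Qed.

(** The two rates of rotation differ by [2 (u_1 dY - u_2 dX)], which does not vanish
    because [f] is not singular. *)
Lemma turning_exclusive x : S x -> turning 1 c f xi x -> turning (- 1) c f xi x -> False.
Proof.
intros Hx H1 H2. assert (Un := direction_unit x Hx).
assert (E : forall i, u x I1 * jac f x I2 i = u x I2 * jac f x I1 i).
{ intros i. destruct (H1 i) as [A1 A2], (H2 i) as [B1 B2].
  fold u in A1, A2, B1, B2.
  rewrite A1 in B1. rewrite A2 in B2. unfold rotation_rate in *.
  set (d := u x I1 * jac f x I2 i - u x I2 * jac f x I1 i).
  assert (C1 : u x I1 * d = 0) by (unfold d; lra).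
  assert (C2 : u x I2 * d = 0) by (unfold d; lra).
  apply Rminus_diag_uniq. fold d.
  transitivity ((u x I1 ^ 2 + u x I2 ^ 2) * d); [rewrite Un; ring|].
  transitivity (u x I1 * (u x I1 * d) + u x I2 * (u x I2 * d)); [ring|].
  rewrite C1, C2. ring. }
apply (jac_det_nonzero x Hx). unfold jac_det.
assert (W1 : u x I1 * (jac f x I1 I1 * jac f x I2 I2 - jac f x I1 I2 * jac f x I2 I1) = 0).
{ transitivity (jac f x I1 I1 * (u x I1 * jac f x I2 I2) - jac f x I1 I2 * (u x I1 * jac f x I2 I1));
    [ring|]. rewrite !E. ring. }
assert (W2 : u x I2 * (jac f x I1 I1 * jac f x I2 I2 - jac f x I1 I2 * jac f x I2 I1) = 0).
{ transitivity ((u x I2 * jac f x I1 I1) * jac f x I2 I2 - (u x I2 * jac f x I1 I2) * jac f x I2 I1);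
    [ring|]. rewrite <- !E. ring. }
set (d := jac f x I1 I1 * jac f x I2 I2 - jac f x I1 I2 * jac f x I2 I1) in *.
transitivity ((u x I1 ^ 2 + u x I2 ^ 2) * d); [rewrite Un; ring|].
transitivity (u x I1 * (u x I1 * d) + u x I2 * (u x I2 * d)); [ring|].
rewrite W1, W2. ring.
Qed.

End HalfPlaneField.

(** With [v = - eps u], an endpoint at infinity means that [v] is vertical. For a
    finite endpoint [e], the vector from the Euclidean centre of the horocycle
    through [y] to [y] is a multiple of [v]. In both cases differentiating the
    equation of the horocycle along the curve gives [v . gam' = 0]. *)
Lemma endpoint_normal eps c y (u F : vec) r1 r2 t : eps ^ 2 = 1 -> 0 < c -> upper y ->
  u I1 ^ 2 + u I2 ^ 2 = 1 -> (forall k, F k = u k * (c * coord I2 y)) ->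
  endpoint eps y u I1 = r1 -> endpoint eps y u I2 = r2 ->
  let w := if Req_EM_T r1 0 then None else Some (r2 / r1) in
  horocycle w t y -> normal_to (hyp_metric c tt) (horocycle w t) y F.
Proof.
intros He Hc Hy Hu HF Er1 Er2 w Hw gam gam' G0 GL GD.
unfold upper in Hy.
set (v1 := - eps * u I1). set (v2 := - eps * u I2).
assert (Uv : v1 ^ 2 + v2 ^ 2 = 1).
{ unfold v1, v2. transitivity (eps ^ 2 * (u I1 ^ 2 + u I2 ^ 2)); [ring|]. rewrite He, Hu. ring. }
assert (PT := endpoint_trace_pos (coord I1 y) (coord I2 y) v1 v2 Hy Uv).
unfold endpoint in Er1, Er2. cbv zeta in Er1, Er2. fold v1 v2 in Er1, Er2.
set (T := coord I1 y ^ 2 * (1 - v2) + 2 * coord I1 y * coord I2 y * v1 +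
  coord I2 y ^ 2 * (1 + v2) + (1 - v2)) in *.
assert (Fu : forall k, F k = - eps * (- eps * u k) * (c * coord I2 y)).
{ intros k. rewrite HF. transitivity (eps ^ 2 * u k * (c * coord I2 y)); [rewrite He; ring | ring]. }
enough (E : v1 * gam' I1 + v2 * gam' I2 = 0).
{ rewrite hyp_dot, !Fu. fold v1 v2.
  transitivity (- eps * (c * coord I2 y) * (v1 * gam' I1 + v2 * gam' I2) * / (c * snd y) ^ 2);
    [ring|]. rewrite E. ring. }
unfold w in *. destruct (Req_EM_T r1 0) as [Z|NZ].
- assert (V2 : v2 = 1).
  { apply (f_equal (fun r => r * T)) in Er1. rewrite Z in Er1. unfold Rdiv in Er1.
    rewrite Rmult_assoc, Rinv_l, Rmult_1_r, Rmult_0_l in Er1 by lra. lra. }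
  assert (V1 : v1 = 0) by nra.
  assert (D : gam' I2 = 0).
  { rewrite <- (is_derive_unique _ _ _ (GD I2)).
    rewrite (Derive_ext_loc _ (fun _ => t)).
    - apply Derive_const.
    - revert GL. apply filter_imp. intros s [_ Hs]. exact Hs. }
  rewrite V1, D. ring.
- assert (V2 : 1 - v2 <> 0).
  { intros Z. apply NZ. rewrite <- Er1, Z. unfold Rdiv. ring. }
  assert (Ee : r2 / r1 = coord I1 y + coord I2 y * v1 / (1 - v2)).
  { rewrite <- Er1, <- Er2. field. split; [exact V2 | lra]. }
  set (e := r2 / r1) in *. clearbody e.
  destruct Hw as [_ Hw].
  assert (Et : t = 2 * coord I2 y / (1 - v2)).
  { apply (Rmult_eq_reg_r (snd y)); [|lra]. rewrite <- Hw, Ee. simpl coord.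
    transitivity (snd y ^ 2 * ((v1 ^ 2 + v2 ^ 2) + 1 - 2 * v2) / (1 - v2) ^ 2); [field; exact V2|].
    rewrite Uv. field. exact V2. }
  assert (D : 2 * (coord I1 y - e) * gam' I1 + (2 * coord I2 y - t) * gam' I2 = 0).
  { set (G := fun s => (coord I1 (gam s) - e) ^ 2 + coord I2 (gam s) ^ 2 - t * coord I2 (gam s)).
    assert (DG : is_derive G 0 (2 * (coord I1 y - e) * gam' I1 + (2 * coord I2 y - t) * gam' I2)).
    { assert (A1 := is_derive_minus _ _ _ _ _ (GD I1) (is_derive_const e 0)).
      assert (A2 := is_derive_pow _ 2 _ _ A1). assert (A3 := is_derive_pow _ 2 _ _ (GD I2)).
      assert (A4 := is_derive_minus _ _ _ _ _ (is_derive_plus _ _ _ _ _ A2 A3)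
        (is_derive_scal _ _ t _ (GD I2))).
      unfold G. revert A4. unfold minus, plus, opp, zero; simpl. rewrite !G0.
      intros A4. replace (2 * (fst y - e) * gam' I1 + (2 * snd y - t) * gam' I2) with
        ((1 + 1) * (gam' I1 + - 0) * ((fst y + - e) * 1) +
          (1 + 1) * gam' I2 * (snd y * 1) + - (t * gam' I2)) by ring.
      exact A4. }
    rewrite <- (is_derive_unique _ _ _ DG).
    rewrite (Derive_ext_loc _ (fun _ => 0)); [apply Derive_const|].
    revert GL. apply filter_imp. intros s [_ Hs]. unfold G. simpl coord. rewrite Hs. ring. }
  rewrite Et, Ee in D.
  assert (K : -2 * coord I2 y / (1 - v2) * (v1 * gam' I1 + v2 * gam' I2) = 0).
  { rewrite <- D. field. exact V2. }
  apply Rmult_integral in K. destruct K as [K|K]; auto. exfalso.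
  apply (f_equal (fun r => r * (1 - v2))) in K.
  replace (-2 * coord I2 y / (1 - v2) * (1 - v2)) with (-2 * coord I2 y) in K by (field; exact V2).
  simpl coord in K. lra.
Qed.

(** * The common centre of the horocycles *)

(** The points of [V] where [P] holds and those where it fails form two open sets. *)
Lemma connected_propagation (M : surface) (V P : pt M -> Prop) : connected V ->
  (forall a x0, dom a x0 -> V (par a x0) -> exists r, 0 < r /\ forall x, square x0 r x ->
     dom a x /\ V (par a x) /\ (P (par a x) <-> P (par a x0))) ->
  forall p q, V p -> V q -> P p -> P q.
Proof.
intros HV HP p q Hp Hq HPp.
assert (O : forall Q : pt M -> Prop,
  (forall a x y, P (par a x) <-> P (par a y) -> Q (par a y) -> Q (par a x)) ->
  mopen (fun p => V p /\ Q p)).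
{ intros Q HQ a x0 [Hx0 [HVx0 HQx0]]. destruct (HP a x0 Hx0 HVx0) as [r [Hr Hs]].
  apply locally_square. exists r. split; auto. intros x Hx.
  destruct (Hs x Hx) as [H1 [H2 H3]]. repeat split; auto. now apply (HQ a x x0). }
destruct (HV (fun p => V p /\ P p) (fun p => V p /\ ~ P p)) as [H|H].
- apply O. tauto.
- apply O. tauto.
- intros y Hy. destruct (classic (P y)); auto.
- intros y _ [[_ H1] [_ H2]]. contradiction.
- now apply H.
- destruct (H p Hp) as [_ N]. contradiction.
Qed.

Section Horocycles.
Variables (M : surface) (g : metric M) (xi : vfield M) (c : R).
Hypothesis Hunit : unit_field g xi.
Hypothesis Hgeo : geodesic_field g xi.
Hypothesis Hc : 0 < c.
Hypothesis HD : squared_divergence g xi c.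
Variables (V : pt M -> Prop) (phi : pt M -> pt half_plane).
Hypothesis Hiso : isometry g (hyp_metric c) V phi.

Let O (a : chart M) (x : R * R) : Prop := dom a x /\ V (par a x).
Let f (a : chart M) : R * R -> R * R := chart_map phi a.
Let u (a : chart M) : lfield := direction c (f a) (xi a).

Let HO a : open (O a) := proj1 (isometry_chart M g c V phi a Hiso).
Let Sf a : forall j, smooth (O a) (fun z => coord j (f a z)) :=
  proj1 (proj2 (isometry_chart M g c V phi a Hiso)).

Let Hup a x : O a x -> upper (f a x).
Proof. intros _. exact (proj2_sig (phi (par a x))). Qed.

Let Hpull a x i j : O a x ->
  gcomp g a x i j = pull (f a) x (hyp_metric c tt (f a x)) i j.
Proof. intros [H1 H2]. now apply (isometry_chart M g c V phi a Hiso). Qed.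

Let Sxi a i : smooth (O a) (fun z => xi a z i).
Proof. apply (smooth_sub (dom a)); [now intros x [? _] | apply vfield_smooth]. Qed.

Let Hu a x : O a x -> dot (gcomp g a) x (xi a x) (xi a x) = 1.
Proof. intros [H _]. now apply Hunit. Qed.

Let Hdet a x : O a x -> 0 < det (gcomp g a) x.
Proof. intros [H _]. now apply metric_det_pos. Qed.

(** The divergence is [c] or [- c] and continuous, so its sign is the same at all
    nearby points. *)
Lemma turning_locally a x0 : O a x0 -> exists r eps, 0 < r /\ (eps = 1 \/ eps = - 1) /\
  forall x, square x0 r x -> O a x /\ turning eps c (f a) (xi a) x.
Proof.
intros H0. destruct (HD a x0 (proj1 H0)) as [U [al [be [HU0 [HUd [HA Hdiv]]]]]].
assert (HR := rotated_adapted c (O a) (f a) (gcomp g a) (xi a) Hc (HO a) (Sf a) (Hup a)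
  (Hpull a) (Sxi a) (Hu a) (Hdet a)).
set (m := divergence (rotated1 c (f a) (xi a)) (rotated2 c (f a) (xi a))).
assert (GR : forall y k, O a y -> cov (gcomp g a) (xi a) (xi a) y k = 0)
  by (intros y k [Hy _]; now apply Hgeo).
assert (GU : forall y k, U y -> cov (gcomp g a) (xi a) (xi a) y k = 0)
  by (intros y k Hy; apply Hgeo; auto).
assert (HUo := coframe_open _ _ _ _ (adapted_coframe _ _ _ _ _ HA)).
assert (Hm : forall x, O a x /\ U x -> m x ^ 2 = c ^ 2).
{ intros x [H1 H2]. rewrite <- (Hdiv x H2).
  exact (squared_divergence_unique _ _ _ _ _ _ _ _ x HR HA GR GU H1 H2). }
destruct (locally_constant_sign (fun x => O a x /\ U x) m c x0) as [r [Hr Hs]]; auto.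
- now apply open_and.
- intros x [Hx _]. apply (smooth_continuous (O a)); auto. exact (smooth_divergence _ _ _ _ _ HR).
- assert (E0 := Hm x0 (conj H0 HU0)).
  assert (Ec : m x0 = c \/ m x0 = - c).
  { assert (E : (m x0 - c) * (m x0 + c) = 0) by (ring_simplify; lra).
    apply Rmult_integral in E. lra. }
  exists r, (m x0 / c). split; auto. split.
  { destruct Ec as [E|E]; rewrite E; [left | right]; field; lra. }
  intros x Hx. destruct (Hs x Hx) as [[H1 H2] E]. split; auto.
  apply (turning_of_divergence c (O a) (f a) (gcomp g a) (xi a)); auto.
  + exact (adapted_closed _ _ _ _ _ HR GR x H1).
  + replace (m x0 / c * c) with (m x) by (rewrite E; field; lra).
    exact (curl_divergence _ _ _ _ _ HR x H1).
Qed.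

Lemma chart_map_transition a b x : overlap a b x -> f a x = f b (transition a b x).
Proof.
intros H. unfold f, chart_map. now rewrite (proj2 (overlap_dom M a b x H)).
Qed.

Lemma overlap_O a b x : O a x -> overlap a b x -> O b (transition a b x).
Proof.
intros [_ H1] H. destruct (overlap_dom M a b x H) as [H2 E]. split; auto. now rewrite E.
Qed.

Lemma jac_chart_map_transition a b x k i : O a x -> overlap a b x ->
  jac (f a) x k i =
  Sum (fun n => jac (f b) (transition a b x) k n * jac (transition a b) x n i).
Proof.
intros HOx Hx.
transitivity (jac (fun z => f b (transition a b z)) x k i).
- apply (jac_ext_loc (overlap a b)); auto; [apply overlap_open|].
  intros z Hz. now apply chart_map_transition.
- apply (jac_comp (O b) (overlap a b)); auto.
  + now apply overlap_O. + apply transition_smooth.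
Qed.

Lemma direction_transition a b x k : O a x -> overlap a b x ->
  u a x k = u b (transition a b x) k.
Proof.
intros HOx Hx. unfold u, direction. rewrite <- (chart_map_transition a b x Hx).
f_equal. unfold push. unfold Sum at 1. rewrite !(jac_chart_map_transition a b x _ _ HOx Hx).
assert (E : forall k, xi b (transition a b x) k = push (transition a b) x (xi a x) k)
  by (intros n; exact (vfield_compat M xi a b x n (proj1 Hx) (proj2 Hx))).
unfold Sum. rewrite !E. unfold push, Sum. ring.
Qed.

Lemma turning_transition eps a b x : O a x -> overlap a b x ->
  turning eps c (f b) (xi b) (transition a b x) -> turning eps c (f a) (xi a) x.
Proof.
intros HOx Hx HT i. fold (u a).
assert (OO : open (fun z => O a z /\ overlap a b z)).
{ apply open_and; [apply HO | apply overlap_open]. }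
assert (P : forall k, pd i (fun z => u a z k) x =
  Sum (fun n => pd n (fun z => u b z k) (transition a b x) * jac (transition a b) x n i)).
{ intros k.
  rewrite (pd_ext_loc i _ _ (fun z => u b (transition a b z) k) x OO (conj HOx Hx)).
  - apply (pd_comp (O b) (overlap a b) (fun z => u b z k)); auto.
    + apply (smooth_direction c (O b)); auto.
    + now apply overlap_O.
    + apply transition_smooth.
  - intros z [Hz1 Hz2]. now apply direction_transition. }
rewrite !P, (chart_map_transition a b x Hx), !(direction_transition a b x _ HOx Hx).
unfold rotation_rate. rewrite !(jac_chart_map_transition a b x _ _ HOx Hx).
destruct (HT I1) as [A1 A2], (HT I2) as [B1 B2]. fold (u b) in A1, A2, B1, B2.
rewrite !(direction_transition a b x _ HOx Hx).
unfold Sum. rewrite !Rmult_plus_distr_r.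
split.
- transitivity (pd I1 (fun z => u b z I1) (transition a b x) * coord I2 (f b (transition a b x))
    * jac (transition a b) x I1 i +
    pd I2 (fun z => u b z I1) (transition a b x) * coord I2 (f b (transition a b x))
    * jac (transition a b) x I2 i); [ring|].
  rewrite A1, B1. unfold rotation_rate. ring.
- transitivity (pd I1 (fun z => u b z I2) (transition a b x) * coord I2 (f b (transition a b x))
    * jac (transition a b) x I1 i +
    pd I2 (fun z => u b z I2) (transition a b x) * coord I2 (f b (transition a b x))
    * jac (transition a b) x I2 i); [ring|].
  rewrite A2, B2. unfold rotation_rate. ring.
Qed.

(** [turning eps] stands for the sign of the divergence. Unlike the divergence
    itself it involves only functions on [V], through the map [phi], so that its
    independence of the chart is just the chain rule. *)
Let converges (eps : R) (r : vec) (a : chart M) (x : R * R) : Prop :=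
  turning eps c (f a) (xi a) x /\ forall k, endpoint eps (f a x) (u a x) k = r k.

Lemma endpoint_transition eps a b x k : O a x -> overlap a b x ->
  endpoint eps (f a x) (u a x) k =
  endpoint eps (f b (transition a b x)) (u b (transition a b x)) k.
Proof.
intros HOx Hx. rewrite <- (chart_map_transition a b x Hx).
unfold endpoint. now rewrite !(direction_transition a b x _ HOx Hx).
Qed.

Lemma converges_transition eps r a b x y : O a x -> dom b y -> par b y = par a x ->
  converges eps r b y -> converges eps r a x.
Proof.
intros HOx Hy E [H1 H2].
assert (Hx : overlap a b x) by (split; [apply HOx | now exists y]).
assert (Ey : transition a b x = y) by (unfold transition; rewrite <- E; now apply crd_par).
split.
- apply (turning_transition eps a b); auto. now rewrite Ey.
- intros k. rewrite (endpoint_transition eps a b) by auto. now rewrite Ey.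
Qed.

(** While the sign of the divergence is [eps] the endpoint has derivative zero;
    near a point where it is [- eps] the sign alone excludes convergence. *)
Lemma converges_locally eps r a x0 : (eps = 1 \/ eps = - 1) -> O a x0 ->
  exists rho, 0 < rho /\ forall x, square x0 rho x ->
    O a x /\ (converges eps r a x <-> converges eps r a x0).
Proof.
intros He H0. destruct (turning_locally a x0 H0) as [rho [eps' [Hrho [He' HT]]]].
exists rho. split; auto. intros x Hx. destruct (HT x Hx) as [H1 H2]. split; auto.
assert (Hx0 := square_center x0 rho Hrho).
destruct (Req_dec eps eps') as [E|E].
- subst eps'.
  assert (C : forall k, endpoint eps (f a x) (u a x) k = endpoint eps (f a x0) (u a x0) k).
  { intros k. apply (square_constant x0 rho (fun z => endpoint eps (f a z) (u a z) k)); auto.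
    intros i y Hy. destruct (HT y Hy) as [Hy1 Hy2].
    apply (endpoint_pd c (O a) (f a) (gcomp g a) (xi a)); auto.
    destruct He as [He|He]; rewrite He; ring. }
  unfold converges. split; intros [_ H].
  + split; [now apply HT|]. intros k. now rewrite <- C.
  + split; auto. intros k. now rewrite C.
- assert (N : forall y, square x0 rho y -> ~ converges eps r a y).
  { intros y Hy [Hc1 _]. destruct (HT y Hy) as [Hy1 Hy2].
    destruct He as [He|He], He' as [He'|He']; subst; try (now apply E).
    - apply (turning_exclusive c (O a) (f a) (gcomp g a) (xi a) Hc (Hup a) (Hpull a) (Hu a)
        (Hdet a) y Hy1 Hc1 Hy2).
    - apply (turning_exclusive c (O a) (f a) (gcomp g a) (xi a) Hc (Hup a) (Hpull a) (Hu a)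
        (Hdet a) y Hy1 Hy2 Hc1). }
  split; intros H; exfalso; [exact (N x Hx H) | exact (N x0 Hx0 H)].
Qed.

(** Sign and endpoint at one point of [V] propagate to all of [V]. *)
Lemma common_endpoint : connected V -> exists w : option R,
  forall (a : chart M) (x : R * R) (t : R), dom a x -> V (par a x) ->
    horocycle w t (f a x) ->
    normal_to (hyp_metric c tt) (horocycle w t) (f a x) (push (f a) x (xi a x)).
Proof.
intros HV.
destruct (classic (exists p, V p)) as [[p Hp]|N].
2: { exists None. intros a x t _ Hx. exfalso. apply N. eauto. }
destruct (patch_cover M p) as [a0 [x0 [Hx0 E0]]].
assert (HO0 : O a0 x0) by (split; auto; now rewrite E0).
destruct (turning_locally a0 x0 HO0) as [rho [eps [Hrho [He HT]]]].
destruct (HT x0 (square_center x0 rho Hrho)) as [_ HT0].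
set (r := endpoint eps (f a0 x0) (u a0 x0)).
set (P := fun q => exists b y, dom b y /\ par b y = q /\ converges eps r b y).
assert (PE : forall a x, O a x -> (P (par a x) <-> converges eps r a x)).
{ intros a x Hx. split.
  - intros [b [y [Hy [E H]]]]. exact (converges_transition eps r a b x y Hx Hy E H).
  - intros H. exists a, x. split; [apply Hx|]. auto. }
assert (HP : forall q, V q -> P q).
{ intros q Hq. apply (connected_propagation M V P HV) with (p := p); auto.
  - intros a x1 Hx1 HVx1. destruct (converges_locally eps r a x1 He (conj Hx1 HVx1)) as [s [Hs C]].
    exists s. split; auto. intros x Hx. destruct (C x Hx) as [[H1 H2] H3].
    split; [|split]; auto. rewrite !PE; auto; now split.
  - rewrite <- E0. apply PE; auto. split; auto. }
assert (e1 : eps ^ 2 = 1) by (destruct He as [He|He]; rewrite He; ring).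
exists (if Req_EM_T (r I1) 0 then None else Some (r I2 / r I1)).
intros a x t Hx HVx. assert (HOx : O a x) by now split.
destruct (proj1 (PE a x HOx) (HP _ HVx)) as [_ Er].
apply (endpoint_normal eps c (f a x) (u a x)); auto.
- apply (direction_unit c (O a) (f a) (gcomp g a)); auto.
- intros k. unfold u, direction. field.
  exact (half_plane_nonzero c (O a) (f a) Hc (Hup a) x HOx).
Qed.

End Horocycles.

Lemma squared_divergence_horocycle_normal (M : surface) (g : metric M) (xi : vfield M) c :
  unit_field g xi -> geodesic_field g xi -> 0 < c -> squared_divergence g xi c ->
  horocycle_normal c g xi.
Proof.
intros Hunit Hgeo Hc HD. split.
- now apply (metric_locally_hyperbolic M g xi).
- intros V phi HV Hiso. exact (common_endpoint M g xi c Hunit Hgeo Hc HD V phi Hiso HV).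
Qed.

Theorem theorem3p3 (M : surface) (g : metric M) (K : R) (xi : vfield M)
  (HK : constant_curvature g K)
  (Hunit : unit_field g xi)
  (Hgeo : geodesic_field g xi) :
  ((exists kappa : R, constant_curvature (section_metric g xi) kappa) <->
     (exists c : R, 0 < c /\ K = - c ^ 2 /\ horocycle_normal c g xi) \/
     (K = 0 /\ parallel_field g xi) \/
     K = 1)
  /\
  (forall c : R, 0 < c -> K = - c ^ 2 -> horocycle_normal c g xi ->
     constant_curvature (section_metric g xi) (- c ^ 2) /\
     locally_isometric (section_metric g xi) (hyp_metric c))
  /\
  (K = 0 -> parallel_field g xi ->
     constant_curvature (section_metric g xi) 0 /\
     locally_isometric (section_metric g xi) g)
  /\
  (K = 1 -> constant_curvature (section_metric g xi) 0).
Proof.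
assert (A : forall c : R, 0 < c -> K = - c ^ 2 -> horocycle_normal c g xi ->
  constant_curvature (section_metric g xi) (- c ^ 2) /\
  locally_isometric (section_metric g xi) (hyp_metric c)).
{ intros c Hc E HN.
  assert (HD := horocycle_normal_divergence M g xi c Hunit Hc HN).
  split; [|now apply (section_locally_hyperbolic M g xi)].
  replace (- c ^ 2) with ((1 - K) * (K - c ^ 4) / (1 + c ^ 2) ^ 2).
  - now apply section_gauss_squared_divergence.
  - rewrite E. generalize (pow2_ge_0 c). intros P. field. simpl in P. lra. }
assert (B : K = 0 -> parallel_field g xi ->
  constant_curvature (section_metric g xi) 0 /\
  locally_isometric (section_metric g xi) g).
{ intros E HP.
  assert (HD := proj1 (parallel_iff_squared_divergence M g xi Hunit Hgeo) HP). split.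
  - replace 0 with ((1 - K) * (K - 0 ^ 4) / (1 + 0 ^ 2) ^ 2) at 1 by (rewrite E; field).
    now apply section_gauss_squared_divergence.
  - apply locally_isometric_refl; [apply metric_tensor_compat|].
    intros a x i j Hx. rewrite (section_squared_divergence M g xi Hgeo 0) by auto. ring. }
assert (C : K = 1 -> constant_curvature (section_metric g xi) 0).
{ intros E a x Hx. unfold section_metric.
  rewrite (gauss_section (dom a) (gcomp g a) (xi a) _ _
    (unit_field_adapted M g xi a Hunit) (fun x k => Hgeo a x k) K (HK a) x Hx).
  rewrite E. unfold Rdiv. ring. }
split; [|split; [|split]]; auto. split.
- intros [kappa Hk]. destruct (Req_dec K 1) as [E|E]; auto.
  destruct (constant_section_curvature M g xi Hunit Hgeo K kappa HK Hk E) as [HK0 HD].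
  destruct (Req_dec K 0) as [Z|Z].
  + right; left. split; auto. apply (parallel_iff_squared_divergence M g xi Hunit Hgeo).
    rewrite Z, Ropp_0, sqrt_0 in HD. exact HD.
  + left. exists (sqrt (- K)). assert (P : 0 < sqrt (- K)) by (apply sqrt_lt_R0; lra).
    split; auto. split; [rewrite pow2_sqrt; lra|].
    now apply squared_divergence_horocycle_normal.
- intros [[c [Hc [E HN]]]|[[E HP]|E]].
  + exists (- c ^ 2). now apply A.
  + exists 0. now apply B.
  + exists 0. now apply C.
Qed.
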